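(* Let $\varphi$ be an Orlicz N-function satisfying Assumption Q, with density $f$ and Young–Fenchel transform $\varphi^*$. Let $\mathbf X(t)$, $t\in\mathbb R$, be a random process in $Sub_\varphi(\Omega)$ which is measurable and continuous in the norm $\tau_\varphi(\cdot)$. Let $\phi$ be an $f$-wavelet and $\psi$ the corresponding $m$-wavelet, both real-valued and continuous, and both satisfying Assumption S with the function $\Phi$. Let $c:\mathbb R\to\mathbb R$ be an even function, non-decreasing on $[0,\infty)$, with $c(0)>1$, for which there exist $A:(0,\infty)\to(0,\infty)$ and $x_0\in\mathbb R$ such that $c(ax)\le c(x)A(a)$ for all $x\ge x_0$ and all $a>0$. Assume $\int_{\mathbb R}c(x)\Phi(|x|)\,dx<\infty$ and $\tau_\varphi(t)\le c(t)$ for all $t\in\mathbb R$. Suppose that for some $T>0$ and $p\ge1$ $$\int_0^T(\tau_\varphi(t))^p\,dt<\infty .$$ If $$\int_0^T\big(\tau_\varphi(\mathbf X_{n,\mathbf k_n}(t)-\mathbf X_{m,\mathbf k_m}(t))\big)^p\,dt\to0\quad\text{when }\mathbf k_n,\mathbf k_m\to\infty,$$ then $\mathbf X_{n,\mathbf k_n}\to\mathbf X$ in the space $L_p([0,T])$ in probability when $\mathbf k_n\to\infty$, i.e. for every $\varepsilon>0$ $$\mathbf P\left\{\Big(\int_0^T|\mathbf X_{n,\mathbf k_n}(t)-\mathbf X(t)|^p\,dt\Big)^{1/p}>\varepsilon\right\}\to0\quad\text{when }\mathbf k_n\to\infty.$$ Furthermore, with $c_n^\infty:=\int_0^T\big(\tau_\varphi(\mathbf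 X_{n,\mathbf k_n}(t)-\mathbf X(t))\big)^p\,dt$, for every $\varepsilon>c_n^\infty\big(f(p\,(c_n^\infty/\varepsilon)^{1/p})\big)^p$, $$\mathbf P\left\{\int_0^T|\mathbf X_{n,\mathbf k_n}(t)-\mathbf X(t)|^p\,dt>\varepsilon\right\}\le2\exp\left\{-\varphi^*\big((\varepsilon/c_n^\infty)^{1/p}\big)\right\}.$$
   Context: Sub-Gaussian notions. An Orlicz N-function is a continuous even convex function $\varphi:\mathbb R\to\mathbb R$, monotonically increasing for $x>0$, with $\varphi(0)=0$, $\varphi(x)/x\to0$ as $x\to0$ and $\varphi(x)/x\to\infty$ as $x\to\infty$. Assumption Q: $\lim_{x\to0}\varphi(x)/x^2=c_0>0$ (the value $c_0=+\infty$ is allowed). Every N-function is $\varphi(u)=\int_0^{|u|}f(v)\,dv$ with $f$ nondecreasing, right-continuous, $f(0)=0$, $f(x)\to\infty$ as $x\to\infty$; $f$ is the density of $\varphi$. The Young–Fenchel transform is $\varphi^*(x)=\sup_{y\in\mathbb R}(xy-\varphi(y))$. On a probability space $(\Omega,\mathcal B,\mathbf P)$, a zero-mean random variable $\xi$ is in $Sub_\varphi(\Omega)$ if there is $r\ge0$ with $\mathbf E\exp(\lambda\xi)\le\exp(\varphi(r\lambda))$ for all $\lambda\in\mathbb R$; $\tau_\varphi(\xi):=\inf\{a\ge0:\mathbf E\exp(\lambda\xi)\le\exp(\varphi(a\lambda))\ \forall\lambda\in\mathbb R\}$ is a Banach norm on this space. A process $\mathbf X(t)$, $t\in\mathbf T$,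 is in $Sub_\varphi(\Omega)$ if $\mathbf X(t)\in Sub_\varphi(\Omega)$ for all $t\in\mathbf T$ and $\sup_{t\in\mathbf T}\tau_\varphi(\mathbf X(t))<\infty$; write $\tau_\varphi(t):=\tau_\varphi(\mathbf X(t))$. Wavelets. Fourier transform: $\widehat\phi(y)=\int_{\mathbb R}e^{-iyx}\phi(x)\,dx$. A function $\phi\in L_2(\mathbb R)$ is an $f$-wavelet if $\widehat\phi(0)\ne0$, $\widehat\phi$ is continuous at $0$, $\sum_{k\in\mathbb Z}|\widehat\phi(y+2\pi k)|^2=1$ a.e., and there is a $2\pi$-periodic $m_0\in L_2([0,2\pi])$ with $\widehat\phi(y)=m_0(y/2)\widehat\phi(y/2)$ a.e. The corresponding $m$-wavelet $\psi$ is the inverse Fourier transform of $\widehat\psi(y)=\overline{m_0(y/2+\pi)}\,e^{-iy/2}\,\widehat\phi(y/2)$. Set $\phi_{jk}(x)=2^{j/2}\phi(2^jx-k)$, $\psi_{jk}(x)=2^{j/2}\psi(2^jx-k)$. Assumption S for a function $\delta$, with function $\Phi$: $\Phi:[0,\infty)\to[0,\infty)$ is decreasing, $\Phi(0)<\infty$, $|\delta(x)|\le\Phi(|x|)$ a.e., and $\int_{\mathbb R}\Phi(|x|)\,dx<\infty$. Wavelet approximants. $\xi_{0k}:=\int_{\mathbb R}\mathbf X(t)\overline{\phi_{0k}(t)}\,dt$, $\eta_{jk}:=\int_{\mathbb R}\mathbf X(t)\overline{\psi_{jk}(t)}\,dt$ (mean-square integrals), and $\mathbf X_{n,\mathbf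 k_n}(t):=\sum_{|k|\le k_0'}\xi_{0k}\phi_{0k}(t)+\sum_{j=0}^{n-1}\sum_{|k|\le k_j}\eta_{jk}\psi_{jk}(t)$, where $\mathbf k_n=(k_0'(n),k_0(n),\dots,k_{n-1}(n))$ (index $(n)$ omitted). $\mathbf k_n\to\infty$ means $n\to\infty$, $k_0'\to\infty$ and $k_j\to\infty$ for every $j\in\mathbb N_0=\{0,1,2,\dots\}$. *)

(* Defs.v *)
From HB Require Import structures.
From mathcomp Require Import all_boot all_order all_algebra.
From mathcomp Require Import complex.
From mathcomp Require Import all_classical all_reals all_analysis.

Set Implicit Arguments.
Unset Strict Implicit.
Unset Printing Implicit Defensive.

Import Order.TTheory GRing.Theory Num.Theory.
Import numFieldNormedType.Exports.

Local Open Scope classical_set_scope.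
Local Open Scope ring_scope.

Definition orlicz_N_function (R : realType) (phi : R -> R) : Prop :=
  [/\ continuous phi,
      (forall x, phi (- x) = phi x),
      convex_function (setT : set (convex_lmodType R^o)) phi &
      [/\ (forall x y, 0 < x -> x < y -> phi x < phi y),
          phi 0 = 0,
          phi x / x @[x --> 0^'] --> 0 &
          phi x / x @[x --> +oo] --> +oo]].

Definition assumption_Q (R : realType) (phi : R -> R) : Prop :=
  exists2 c0 : \bar R, (0 < c0)%E &
    (phi x / x ^+ 2)%:E @[x --> 0^'] --> c0.

(* Only the values of [f] on [0, +oo[ are constrained. *)
Definition density_of (R : realType) (phi f : R -> R) : Prop :=
  [/\ (forall x y, 0 <= x -> x <= y -> f x <= f y),
      (forall x, 0 <= x -> f y @[y --> x^'+] --> f x),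
      f 0 = 0,
      f x @[x --> +oo] --> +oo &
      (forall u, phi u = \int[lebesgue_measure]_(v in `[0, `|u|]) f v)].

(* The argument ranges over the extended reals, so that the value at +oo is
   sup_y (+oo * y - phi y) = +oo. *)
Definition young_fenchel (R : realType) (phi : R -> R) (x : \bar R) : \bar R :=
  ereal_sup [set (x * y%:E - (phi y)%:E)%E | y in [set: R]].

Section sub_gaussian.
Context {R : realType} {d : measure_display} {Omega : measurableType d}.
Variables (P : probability Omega R) (phi : R -> R).

Definition mgf_bound (xi : Omega -> R) (a : R) : Prop :=
  forall lambda : R,
    ('E_P[fun w => expR (lambda * xi w)] <= (expR (phi (a * lambda)))%:E)%E.

Definition subphi (xi : Omega -> R) : Prop :=
  [/\ measurable_fun setT xi,
      P.-integrable setT (EFin \o xi),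
      ('E_P[xi] = 0)%E &
      exists2 r : R, 0 <= r & mgf_bound xi r].

(* Equal to +oo if no [a] is admissible. *)
Definition tau (xi : Omega -> R) : \bar R :=
  ereal_inf [set a%:E | a in [set a : R | 0 <= a /\ mgf_bound xi a]].

Definition subphi_process (X : R -> Omega -> R) : Prop :=
  (forall t, subphi (X t)) /\ (ereal_sup [set tau (X t) | t in [set: R]] < +oo)%E.

Definition tau_continuous (X : R -> Omega -> R) : Prop :=
  forall t, tau (fun w => X s w - X t w) @[s --> t] --> 0%E.

End sub_gaussian.

Definition measurable_process (R : realType) (d : measure_display)
    (Omega : measurableType d) (X : R -> Omega -> R) : Prop :=
  measurable_fun setT (fun z : R * Omega => X z.1 z.2).

Section mean_square_integral.
Context {R : realType} {d : measure_display} {Omega : measurableType d}.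
Variable P : probability Omega R.

Definition ms_dist2 (Y Z : Omega -> R) : \bar R :=
  ('E_P[fun w => ((Y w - Z w) ^+ 2)%R])%E.

(* [I] is the mean-square limit of the Riemann sums of the process [Y] on
   [a, b], over the subdivisions a = s 0 <= ... <= s N = b with tags [u i]
   in [s i, s (i+1)], as the mesh tends to 0. *)
Definition ms_integral_on (Y : R -> Omega -> R) (a b : R) (I : Omega -> R) :
    Prop :=
  measurable_fun setT I /\
  forall e : R, 0 < e -> exists2 delta : R, 0 < delta &
    forall (N : nat) (s u : nat -> R),
      s 0%N = a -> s N = b ->
      (forall i, (i < N)%N ->
         s i <= u i <= s i.+1 /\ s i.+1 - s i < delta) ->
      (ms_dist2 (fun w => (\sum_(i < N) Y (u i) w * (s i.+1 - s i))%R) I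
         < e%:E)%E.

Definition ms_integral (Y : R -> Omega -> R) (xi : Omega -> R) : Prop :=
  measurable_fun setT xi /\
  exists I : R -> R -> Omega -> R,
    (forall a b, a <= b -> ms_integral_on Y a b (I a b)) /\
    forall e : R, 0 < e ->
      \forall a \near -oo & b \near +oo, (ms_dist2 (I a b) xi < e%:E)%E.

End mean_square_integral.

Section wavelets.
Context {R : realType}.
Local Open Scope complex_scope.
Local Notation mu := (@lebesgue_measure R).

Definition cis (y : R) : R[i] := cos y +i* sin y.

(* The integral of e^{-iyx} g(x) for real-valued g, by real and imaginary
   parts; meaningful for integrable g, as are the functions satisfying
   [assumption_S] below. *)
Definition fourier (g : R -> R) (y : R) : R[i] :=
  (\int[mu]_x (cos (y * x) * g x)) -i* (\int[mu]_x (sin (y * x) * g x)).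

Definition sqnormc (z : R[i]) : R := complex.Re z ^+ 2 + complex.Im z ^+ 2.

Definition L2_periodic (m0 : R -> R[i]) : Prop :=
  [/\ (forall y, m0 (y + 2 * pi) = m0 y),
      measurable_fun `[0, 2 * pi] (fun y => complex.Re (m0 y)),
      measurable_fun `[0, 2 * pi] (fun y => complex.Im (m0 y)) &
      (\int[mu]_(y in `[0%R, (2 * pi)%R]) (sqnormc (m0 y))%:E < +oo)%E].

Definition refinement_mask (phi : R -> R) (m0 : R -> R[i]) : Prop :=
  L2_periodic m0 /\
  {ae mu, forall y, fourier phi y = m0 (y / 2) * fourier phi (y / 2)}.

Definition f_wavelet (phi : R -> R) : Prop :=
  [/\ phi \in Lfun mu 2%:E,
      fourier phi 0 != 0,
      (fourier phi y : R[i]^o) @[y --> (0 : R)] --> (fourier phi 0 : R[i]^o),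
      {ae mu, forall y : R,
        (\esum_(k in [set: int])
           (sqnormc (fourier phi (y + 2 * pi * k%:~R)))%:E = 1)%E} &
      exists m0, refinement_mask phi m0].

(* [psi] is the inverse Fourier transform of the displayed function, i.e. the
   latter is the Fourier transform of [psi].  The mask of an f-wavelet is
   unique almost everywhere. *)
Definition m_wavelet (phi psi : R -> R) : Prop :=
  psi \in Lfun mu 2%:E /\
  exists2 m0, refinement_mask phi m0 &
    {ae mu, forall y, fourier psi y =
      (m0 (y / 2 + pi))^* * cis (- (y / 2)) * fourier phi (y / 2)}.

(* [Phi] is a function from [0, +oo[ to itself, so that Phi(0) < +oo. *)
Definition assumption_S (Phi delta : R -> R) : Prop :=
  [/\ (forall x, 0 <= x -> 0 <= Phi x),
      (forall x y, 0 <= x -> x <= y -> Phi y <= Phi x),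
      {ae mu, forall x, `|delta x| <= Phi `|x|} &
      (\int[mu]_x (Phi `|x|)%:E < +oo)%E].

Definition dilate (g : R -> R) (j : nat) (k : int) (x : R) : R :=
  2 `^ (j%:R / 2) * g (2 ^+ j * x - k%:~R).

End wavelets.

(* The vector (k_0', k_0, ..., k_{n-1}) with n = [level]; the entries
   [kdetail j] with j >= n are irrelevant. *)
Record trunc_index := TruncIndex {
  level : nat ;
  kscale : nat ;
  kdetail : nat -> nat
}.

(* The filter of k_n -> oo: the coarsest one along which n -> oo, k_0' -> oo
   and k_j -> oo for every j.  Since N <= n, the entries k_j with j < N below
   are entries of the vector. *)
Definition trunc_infty : set_system trunc_index :=
  filter_from setT (fun N : nat =>
    [set k | [/\ (N <= level k)%N, (N <= kscale k)%N &
               forall j, (j < N)%N -> (N <= kdetail k j)%N]]).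

#[global] Instance trunc_infty_filter : ProperFilter trunc_infty.
Proof.
apply: filter_from_proper => [|N _]; last first.
  by exists (TruncIndex N N (fun=> N)); split.
apply: filter_from_filter; first by exists 0%N.
move=> M N _ _; exists (maxn M N) => // k [].
rewrite !geq_max => /andP[lM lN] /andP[sM sN] dk.
by split; split=> // j jlt; have := dk j; rewrite leq_max jlt ?orbT => /(_ isT);
  rewrite geq_max => /andP[].
Qed.

Section approximants.
Context {R : realType} {Omega : Type}.

Definition sum_abs_le (K : nat) (F : int -> R) : R :=
  \sum_(0 <= i < (2 * K)%N.+1) F (i%:Z - K%:Z).

Definition approximant (phi psi : R -> R) (xi : int -> Omega -> R)
    (eta : nat -> int -> Omega -> R) (k : trunc_index) (t : R) (w : Omega) : R :=
  sum_abs_le (kscale k) (fun i => xi i w * dilate phi 0 i t) +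
  \sum_(j < level k)
    sum_abs_le (kdetail k j) (fun i => eta j i w * dilate psi j i t).

End approximants.

(* Main.v *)
(* Write X_k for the approximant of index k. For a random variable Z with
   |Z| <= 1 the function x(s) = E[X(s) Z] is continuous, and
   E[X_k(t) Z] = int x(s) K_k(t, s) ds for the truncated wavelet kernel K_k. The
   two-scale relations and the quadrature mirror identity, integrated over the
   frequency, show that without truncation the kernel of level n is
   2^n sum_i phi(2^n t - i) phi(2^n s - i): it has integral 1, because the
   periodization of phi is constant equal to +-1, and it is dominated by a
   dilate of Phi. Taking for Z the sign of X_k(t) - X(t), we get
   E|X_k(t) - X(t)| -> 0 when first the truncations and then the level tend to
   infinity. As tau is lower semicontinuous for the L1 distance, Fatou's lemma,
   applied twice, turns the Cauchy hypothesis into c_k -> 0 for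
   c_k = int tau(X_k - X)^p. The tail bound comes from the tangent of the convex
   part of x |-> exp(a x^(1/p)) and Markov's inequality, and together with
   c_k -> 0 it gives the convergence in probability. *)

Require Import Defs.
From HB Require Import structures.
From mathcomp Require Import all_boot all_order all_algebra.
From mathcomp Require Import complex.
From mathcomp Require Import all_classical all_reals all_analysis.
From mathcomp Require Import measurable_realfun.
From mathcomp Require Import ring lra zify.

Set Implicit Arguments.
Unset Strict Implicit.
Unset Printing Implicit Defensive.

Import Order.TTheory GRing.Theory Num.Theory.
Import numFieldNormedType.Exports.

Local Open Scope classical_set_scope.
Local Open Scope ring_scope.

(** The two limits cannot be taken together. The truncated kernel is bounded only scale by scale, by
    a majorant whose mass grows like the level n; the bound uniform in n holds for the full kernel,
    after telescoping. So convergence in mean is proved only along the indices (n; K, K, ..., K), K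
    first and then n. This is enough: the Cauchy hypothesis compares an arbitrary X_k with all these
    indices beyond some rank, and each limit costs one use of Fatou's lemma. The mean-square
    integrals are limits of Riemann sums and have no pathwise meaning; a fixed bounded Z turns them
    into integrals of continuous numerical functions. The relations between Fourier transforms hold
    only almost everywhere. They become identities between Zak transforms at almost every frequency;
    Parseval's identity in the frequency then gives the kernel identity at every pair (s, t), and
    the limits at frequency 0 are taken along good frequencies tending to 0. *)

Lemma cvg_continuous_comp {R : realType} {T : Type} {F : set_system T}
    {FF : Filter F} (g : R -> R) (f : T -> R) (a : R) :
  continuous g -> f x @[x --> F] --> a -> g (f x) @[x --> F] --> g a.
Proof. by move=> cg fa; exact: (cvg_comp f g fa (cg a)). Qed.

(** * The sub-Gaussian norm *)

Section orlicz.
Context {R : realType} {v : R -> R}.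
Hypothesis Hv : orlicz_N_function v.

Lemma orlicz_continuous : continuous v.
Proof. by case: Hv. Qed.

Lemma orlicz0 : v 0 = 0.
Proof. by case: Hv => _ _ _ []. Qed.

Lemma orlicz_norm x : v `|x| = v x.
Proof. by case: Hv => _ vN _ _; case: (ger0P x). Qed.

Lemma orlicz_ler_norm x y : `|x| <= `|y| -> v x <= v y.
Proof.
rewrite -[v x]orlicz_norm -[v y]orlicz_norm.
have /=: {in Num.nneg &, {homo v : a b / a < b}}.
  case: Hv => _ _ _ [vlt v0 _ _] a b; rewrite !nnegrE le_eqVlt.
  move=> /orP[/eqP <- _ b0|a0 _]; last exact: vlt.
  case: Hv => cv _ _ _.
  (* Strict growth is assumed between positive arguments only; 0 is reached as the limit of the
     points [b / 2 / n.+1], whose values are at most [v (b / 2)]. *)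
  rewrite v0; have h : v (b / 2) < v b by apply: vlt; lra.
  apply: le_lt_trans h; rewrite -v0.
  have : v (b / 2 / n.+1%:R) @[n --> \oo] --> v 0.
    apply: continuous_cvg; first exact: cv.
    rewrite -(mulr0 (b / 2)); apply: cvgMl_tmp; exact: cvg_harmonic.
  move/cvg_lim => <- //.
  apply: limr_le => //.
    apply/cvg_ex; exists (v 0); apply: continuous_cvg; first exact: cv.
    rewrite -(mulr0 (b / 2)); apply: cvgMl_tmp; exact: cvg_harmonic.
  apply: nearW => n.
  have b2 : 0 < b / 2 by lra.
  have [->|n0] := eqVneq n 0%N; first by rewrite divr1.
  apply/ltW/vlt; first by rewrite divr_gt0.
  by rewrite ltr_pdivrMr // ltr_pMr // ltr1n ltnS lt0n.
move=> h; rewrite le_eqVlt => /orP[/eqP -> //|xy].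
by apply/ltW/h => //; rewrite nnegrE.
Qed.

Lemma orlicz_ge0 x : 0 <= v x.
Proof. by rewrite -orlicz0 orlicz_ler_norm // normr0. Qed.

End orlicz.

Section tau.
Context {R : realType} {d : measure_display} {Omega : measurableType d}.
Variables (P : probability Omega R) (v : R -> R).
Hypothesis Hv : orlicz_N_function v.
Implicit Types xi zeta : Omega -> R.

Lemma mgf_bound_le xi a b : 0 <= a -> a <= b ->
  mgf_bound P v xi a -> mgf_bound P v xi b.
Proof.
move=> a0 ab h l; apply: le_trans (h l) _.
rewrite lee_fin ler_expR (orlicz_ler_norm Hv) // !normrM ler_wpM2r //.
by rewrite !ger0_norm // (le_trans a0).
Qed.

Lemma tau_ge0 xi : (0 <= tau P v xi)%E.
Proof. by apply: le_ereal_inf_tmp => _ [a [a0 _] <-]; rewrite lee_fin. Qed.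

Lemma mgf_bound_tau xi a : 0 <= a -> mgf_bound P v xi a ->
  (tau P v xi <= a%:E)%E.
Proof. by move=> a0 h; apply: ereal_inf_lbound; exists a. Qed.

Lemma tau_lt_mgf_bound xi b : (tau P v xi < b%:E)%E -> mgf_bound P v xi b.
Proof.
move=> /ereal_inf_lt[_ [a [a0 ha] <-]]; rewrite lte_fin => ab.
exact: mgf_bound_le a0 (ltW ab) ha.
Qed.

(** The infimum defining [tau] is attained: the bound holds at [a + 1 / n.+1] and passes to the
    limit by continuity of [v]. *)
Lemma tau_le_mgf_bound xi a : (tau P v xi <= a%:E)%E -> mgf_bound P v xi a.
Proof.
move=> ta l.
suff h : (expR (v ((a + n.+1%:R^-1) * l)))%:E @[n --> \oo] -->
    (expR (v (a * l)))%:E.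
  apply: cvge_ge h; apply: nearW => n.
  apply: tau_lt_mgf_bound; apply: le_lt_trans ta _.
  by rewrite lte_fin ltrDl invr_gt0.
apply: cvg_EFin; first exact: nearW.
apply: (cvg_continuous_comp (@continuous_expR R)).
apply: (cvg_continuous_comp (orlicz_continuous Hv)).
apply: cvgMr_tmp.
by rewrite -[X in _ --> X]addr0; apply: cvgD; [exact: cvg_cst|exact: cvg_harmonic].
Qed.

Lemma tauP xi a : 0 <= a -> (tau P v xi <= a%:E)%E <-> mgf_bound P v xi a.
Proof. by move=> a0; split; [exact: tau_le_mgf_bound|exact: mgf_bound_tau]. Qed.

(** exp (l |x|) is at most exp (l x) + exp (- l x), and [v] is even. *)
Lemma expectation_expR_norm xi (a l : R) : measurable_fun setT xi ->
  mgf_bound P v xi a ->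
  ('E_P[fun w => expR (l * `|xi w|)] <= (2 * expR (v (a * l)))%:E)%E.
Proof.
move=> mxi h.
have mE k : measurable_fun setT (EFin \o (fun w => expR (k * xi w))).
  apply/measurable_EFinP; apply: measurableT_comp => //.
  by apply: measurable_funM.
apply: (@le_trans _ _ ('E_P[fun w => expR (l * xi w)] +
                      'E_P[fun w => expR (- l * xi w)])%E).
  rewrite unlock -ge0_integralD //; [|exact: mE|exact: mE].
  apply: ge0_le_integral => //.
  - apply/measurable_EFinP; apply: measurableT_comp => //.
    by apply: measurable_funM => //; exact: measurableT_comp.
  - by apply: emeasurable_funD; exact: mE.
  - move=> w _; rewrite -EFinD lee_fin; case: (ger0P (xi w)) => _.
      by rewrite lerDl expR_ge0.
    by rewrite mulrN mulNr lerDr expR_ge0.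
rewrite mulrDl mul1r EFinD leeD // -[leRHS]/((expR _)%:E).
have := h (- l); rewrite mulrN.
by case: Hv => _ -> _ _.
Qed.

(** For b above [tau], |xi| / b is below exp (|xi| / b), whose mean is at most 2 exp (v 1); let b
    decrease to [tau]. Taking b strictly above also covers [tau = 0]. *)
Lemma expectation_norm_le_tau xi : measurable_fun setT xi ->
  ('E_P[fun w => `|xi w|%R] <= (2 * expR (v 1))%:E * tau P v xi)%E.
Proof.
move=> mxi.
have K0 : 0 < 2 * expR (v 1) by rewrite mulr_gt0 ?expR_gt0.
have := tau_ge0 xi; case E : (tau P v xi) => [t| |] // t0; last first.
  by rewrite gt0_muley ?lte_fin // leey.
apply/lee_addgt0Pr => e e0; rewrite -EFinM -EFinD.
pose b := t + e / (2 * expR (v 1)).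
have b0 : 0 < b by rewrite ltr_wpDl // divr_gt0.
have hb : mgf_bound P v xi b.
  by apply: tau_lt_mgf_bound; rewrite E lte_fin ltrDl divr_gt0.
have := expectation_expR_norm b^-1 mxi hb.
rewrite mulfV ?gt_eqF // => h.
rewrite (_ : _ + e = b * (2 * expR (v 1))); last first.
  by rewrite /b; field; rewrite gt_eqF ?expR_gt0.
rewrite EFinM; apply: le_trans (lee_wpmul2l _ h); last by rewrite lee_fin ltW.
rewrite unlock -ge0_integralZl_EFin //; last 2 first.
- apply/measurable_EFinP; apply: measurableT_comp => //.
  by apply: measurable_funM => //; exact: measurableT_comp.
- by rewrite ltW.
apply: ge0_le_integral => //.
- by apply/measurable_EFinP; exact: measurableT_comp.
- apply/measurable_EFinP; apply: measurable_funM => //.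
  apply: measurableT_comp => //.
  by apply: measurable_funM => //; exact: measurableT_comp.
- move=> w _; rewrite -EFinM lee_fin -ler_pdivrMl //.
  by apply: le_trans (expR_ge1Dx _); rewrite lerDr.
Qed.

End tau.

(** * Lower limits of sequences of extended reals *)

Section limn_einf.
Context {R : realType}.
Implicit Types (u : (\bar R)^nat) (x : \bar R).

Lemma limn_einfE u : limn_einf u = ereal_sup (range (einfs u)).
Proof.
by rewrite limn_einf_lim; apply/cvg_lim => //; exact: cvg_einfs_sup.
Qed.

Lemma limn_einf_lt_exists u x : (limn_einf u < x)%E ->
  forall N, exists2 n, (N <= n)%N & (u n < x)%E.
Proof.
rewrite limn_einfE => ux N.
have : (einfs u N < x)%E.
  by apply: le_lt_trans ux; apply: ereal_sup_ubound; exists N.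
by move=> /ereal_inf_lt[_ [n Nn <-] unx]; exists n.
Qed.

Lemma limn_einf_le_near u x N : (forall n, (N <= n)%N -> (u n <= x)%E) ->
  (limn_einf u <= x)%E.
Proof.
rewrite limn_einfE => h; apply: ge_ereal_sup => _ [n _ <-].
apply: (@le_trans _ _ (u (maxn n N))); last by apply: h; exact: leq_maxr.
by apply: ereal_inf_lbound; exists (maxn n N) => //=; exact: leq_maxl.
Qed.

Lemma limn_einf_ge0 u : (forall n, 0 <= u n)%E -> (0 <= limn_einf u)%E.
Proof.
move=> u0; rewrite limn_einfE; apply: (@le_trans _ _ (einfs u 0%N)).
  by apply: le_ereal_inf_tmp => _ [n _ <-].
by apply: ereal_sup_ubound; exists 0%N.
Qed.

Lemma measurable_fun_limn_einf {d} {T : measurableType d} (D : set T)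
    (f : (T -> \bar R)^nat) : (forall n, measurable_fun D (f n)) ->
  measurable_fun D (fun t => limn_einf (f ^~ t)).
Proof.
move=> mf; rewrite (_ : (fun _ => _) =
    (fun t => - limn_esup (fun n => - f n t))%E).
  apply: measurableT_comp => //.
  apply: (@measurable_fun_limn_esup _ _ _ _ (fun n t => - f n t)%E) => n.
  exact: measurableT_comp.
apply/funext => t; rewrite -limn_einfN; congr limn_einf.
by apply/funext => n /=; rewrite oppeK.
Qed.

End limn_einf.

(** * Measurability of the norm in a parameter *)

Section tau_measurable.
Context {R : realType} {d1 d2 : measure_display} {T : measurableType d1}
  {Omega : measurableType d2}.
Variables (P : probability Omega R) (v : R -> R).
Hypothesis Hv : orlicz_N_function v.

(** Approximate l by rationals: Fatou's lemma on the left, continuity of [v] on the right. Countably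
    many conditions then decide [tau <= a], which [measurable_tau] needs. *)
Lemma mgf_bound_ratr (xi : Omega -> R) a : measurable_fun setT xi ->
  (forall q : rat, ('E_P[fun w => expR (ratr q * xi w)] <=
     (expR (v (a * ratr q)))%:E)%E) -> mgf_bound P v xi a.
Proof.
move=> mxi h l.
have /choice[q lq] : forall n : nat, exists q : rat,
    ratr q \in `]l, (l + n.+1%:R^-1)[.
  by move=> n; apply: rat_in_itvoo; rewrite ltrDl invr_gt0.
have qcvg : ratr (q n) @[n --> \oo] --> l.
  apply: (@squeeze_cvgr _ _ _ _ (cst l) (fun n => l + n.+1%:R^-1)).
  - by apply: nearW => n; have := lq n; rewrite in_itv /= => /andP[/ltW -> /ltW ->].
  - exact: cvg_cst.
  - by rewrite -[X in _ --> X]addr0; apply: cvgD; [exact: cvg_cst|exact: cvg_harmonic].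
have vcvg : expR (v (a * ratr (q n))) @[n --> \oo] --> expR (v (a * l)).
  apply: (cvg_continuous_comp (@continuous_expR R)).
  by apply: (cvg_continuous_comp (orlicz_continuous Hv)); exact: cvgMl_tmp.
apply/lee_addgt0Pr => e e0.
move/cvgrPdist_le : vcvg => /(_ e e0)[N _ hN].
rewrite unlock (_ : \int[P]_w (expR (l * xi w))%:E =
    \int[P]_w limn_einf (fun n => (expR (ratr (q n) * xi w))%:E))%E; last first.
  apply: eq_integral => w _.
  suff : (expR (ratr (q n) * xi w))%:E @[n --> \oo] --> (expR (l * xi w))%:E.
    by move=> c; rewrite is_cvg_limn_einfE; [apply/esym/cvg_lim|exact: cvgP c].
  apply: cvg_EFin; first exact: nearW.
  by apply: (cvg_continuous_comp (@continuous_expR R)); exact: cvgMr_tmp.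
apply: le_trans.
  apply: (fatou P measurableT) => [n|n w _]; last by rewrite lee_fin expR_ge0.
  by apply/measurable_EFinP; apply: measurableT_comp => //; exact: measurable_funM.
apply: (@limn_einf_le_near _ _ _ N) => n Nn.
have := h (q n); rewrite unlock => /le_trans; apply.
have := hN n Nn; rewrite -EFinD lee_fin ler_distlC => /andP[_].
by rewrite addrC.
Qed.

(** [tau > a] means that some rational exponent violates the moment bound; each violation set is
    measurable by Tonelli, the moment being an integral with parameter t. *)
Lemma measurable_tau (Y : T -> Omega -> R) :
  measurable_fun setT (fun z : T * Omega => Y z.1 z.2) ->
  measurable_fun setT (fun t => tau P v (Y t)).
Proof.
move=> mY; apply: (measurability _ (ErealGenOInfty.measurableE R)).
move=> /= _ [_ [a ->]] <-; rewrite setTI.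
have [a0|a0] := ltP a 0.
  rewrite (_ : _ @^-1` _ = setT) //; apply/seteqP; split => // t _ /=.
  by rewrite in_itv /= andbT (lt_le_trans _ (tau_ge0 _ _ _)).
have mYt t : measurable_fun setT (Y t).
  exact: (measurableT_comp mY (measurable_pair1 t)).
rewrite (_ : _ @^-1` _ = \bigcup_(q in [set: rat]) [set t |
   ((expR (v (a * ratr q)))%:E < 'E_P[fun w => expR (ratr q * Y t w)])%E]).
  apply: bigcupT_measurable_rat => q.
  rewrite -[X in measurable X]setTI.
  apply: emeasurable_fun_o_infty => //; rewrite unlock.
  apply: (@measurable_fun_fubini_tonelli_F _ _ T Omega R P
    (fun z => (expR (ratr q * Y z.1 z.2))%:E)) => [|z]; last first.
    by rewrite lee_fin expR_ge0.
  by apply/measurable_EFinP; apply: measurableT_comp => //; exact: measurable_funM.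
apply/seteqP; split => t /=; rewrite in_itv /= andbT.
  move=> at_; apply: contrapT => hq; move: at_; apply/negP; rewrite -leNgt.
  apply/tauP => //; apply: mgf_bound_ratr => // q; rewrite leNgt; apply/negP => hlt.
  by apply: hq; exists q.
move=> [q _ /=]; apply: contraTT; rewrite -!leNgt => /(tauP _ Hv _ a0).
exact.
Qed.

End tau_measurable.

(** * Lower semicontinuity of the norm for the L1 distance *)

Section tau_lsc.
Context {R : realType} {d : measure_display} {Omega : measurableType d}.
Variables (P : probability Omega R) (v : R -> R).
Hypothesis Hv : orlicz_N_function v.

(* The truncation [min (exp x) M] is [M]-Lipschitz, so that the truncated
   exponential moments are continuous for the L1 distance. *)
Lemma minr_expR_le (M x y : R) : 0 <= M ->
  Order.min (expR x) M <= expR y + M * `|x - y|.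
Proof.
move=> M0; have [xy|yx] := leP x y.
  rewrite ge_min; apply/orP; left.
  by rewrite (@le_trans _ _ (expR y)) ?ler_expR // lerDl mulr_ge0.
have e1 : 1 - (x - y) <= expR (y - x).
  by apply: le_trans (expR_ge1Dx _); rewrite opprB.
have e2 : expR y = expR x * expR (y - x) by rewrite -expRD addrC subrK.
have x0 := expR_gt0 x.
rewrite ger0_norm; last by rewrite subr_ge0 ltW.
have d0 : 0 <= x - y by rewrite subr_ge0 ltW.
have e3 : expR x * (1 - (x - y)) <= expR y by rewrite e2 ler_pM2l.
rewrite minEle; case: ifPn => [xM|].
  by have := ler_wpM2r d0 xM; lra.
rewrite -ltNge => /ltW Mx; have [d1|d1] := leP (x - y) 1.
  by have := ler_wpM2r (_ : 0 <= 1 - (x - y)) Mx; rewrite subr_ge0 => /(_ d1); lra.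
by have := ler_wpM2l M0 (ltW d1); have := expR_ge0 y; lra.
Qed.

(** L1 closeness says nothing about exponential moments, but it controls those truncated at n. So
    the bound is carried from Z to Y at each n, and Fatou's lemma removes the truncation. *)
Lemma tau_le_approx (Y : Omega -> R) (a : R) : measurable_fun setT Y -> 0 <= a ->
  (forall e : R, 0 < e -> exists Z : Omega -> R, [/\ measurable_fun setT Z,
     ('E_P[fun w => `|Z w - Y w|%R] < e%:E)%E & (tau P v Z <= a%:E)%E]) ->
  (tau P v Y <= a%:E)%E.
Proof.
move=> mY a0 h; apply: mgf_bound_tau => // l.
have trunc (n : nat) : ('E_P[fun w => Order.min (expR (l * Y w)) n%:R] <=
    (expR (v (a * l)))%:E)%E.
  apply/lee_addgt0Pr => e e0.
  (* The truncated moment varies by at most n |l| times the L1 distance; the [+ 1] allows the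
     division when n or l is 0. *)
  have K0 : 0 < n%:R * `|l| + 1 :> R by rewrite ltr_wpDl // mulr_ge0.
  have [Z [mZ YZ tZ]] := h _ (divr_gt0 e0 K0).
  have mZY : measurable_fun setT (fun w => `|Z w - Y w|).
    by apply: measurableT_comp => //; exact: measurable_funB.
  apply: (@le_trans _ _ ('E_P[fun w => expR (l * Z w)] +
      (n%:R * `|l|)%:E * 'E_P[fun w => `|Z w - Y w|%R])%E).
    rewrite unlock -ge0_integralZl_EFin ?mulr_ge0 //; last first.
      exact/measurable_EFinP.
    rewrite -ge0_integralD //; last 2 first.
    - by apply/measurable_EFinP; apply: measurableT_comp => //; exact: measurable_funM.
    - by apply: measurable_funeM; exact/measurable_EFinP.
    apply: ge0_le_integral => //.
    - apply/measurable_EFinP; apply: measurable_minr => //.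
      by apply: measurableT_comp => //; exact: measurable_funM.
    - apply: emeasurable_funD; last by apply: measurable_funeM; exact/measurable_EFinP.
      by apply/measurable_EFinP; apply: measurableT_comp => //; exact: measurable_funM.
    - move=> w _; rewrite -EFinM -EFinD lee_fin.
      apply: le_trans (minr_expR_le _ (l * Z w) _) _ => //.
      by rewrite lerD2l -mulrBr normrM mulrA distrC.
  rewrite leeD //; first exact: (tau_le_mgf_bound Hv tZ l).
  apply: le_trans (lee_wpmul2l _ (ltW YZ)) _; first by rewrite lee_fin mulr_ge0.
  rewrite -EFinM lee_fin mulrCA ler_piMr //; first exact: ltW.
  by rewrite ler_pdivrMr // mul1r lerDl.
have mE : measurable_fun setT (fun w => expR (l * Y w)).
  by apply: measurableT_comp => //; exact: measurable_funM.
rewrite unlock (_ : \int[P]_w (expR (l * Y w))%:E =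
    \int[P]_w limn_einf (fun n => (Order.min (expR (l * Y w)) n%:R)%:E))%E; last first.
  apply: eq_integral => w _;
  suff : (Order.min (expR (l * Y w)) n%:R)%:E @[n --> \oo] --> (expR (l * Y w))%:E.
    by move=> c; rewrite is_cvg_limn_einfE; [apply/esym/cvg_lim|exact: cvgP c].
  apply: cvg_near_cst; near=> n; congr EFin; apply/min_idPl.
  by near: n; exact: nbhs_infty_ger.
apply: le_trans.
  apply: (fatou P measurableT) => [n|n w _]; last first.
    by rewrite lee_fin le_min expR_ge0 ler0n.
  by apply/measurable_EFinP; exact: measurable_minr.
apply: (@limn_einf_le_near _ _ _ 0%N) => n _.
by have := trunc n; rewrite unlock.
Unshelve. all: by end_near. Qed.

End tau_lsc.

(** * The tail bound *)

Section real_inequalities.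
Context {R : realType}.
Implicit Types a p s t th y z : R.

(** Bernoulli's inequality for the real power s of exp z. It follows from exp ((s - 1) z) >= 1 + (s
    - 1) z and exp z (1 - z) <= 1. *)
Lemma expR_bernoulli s z : 1 <= s -> 1 + s * (expR z - 1) <= expR (s * z).
Proof.
move=> s1.
have -> : expR (s * z) = expR z * expR ((s - 1) * z).
  by rewrite -expRD; congr expR; ring.
have h1 : expR z * (1 + (s - 1) * z) <= expR z * expR ((s - 1) * z).
  by rewrite ler_pM2l ?expR_gt0 // expR_ge1Dx.
have h2 : expR z * (1 - z) <= 1.
  rewrite -[leRHS](expRxMexpNx_1 z) ler_pM2l ?expR_gt0 //.
  exact: expR_ge1Dx.
have := ler_wpM2l (_ : 0 <= s - 1) h2; rewrite subr_ge0 => /(_ s1).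
by move: h1; rewrite !mulrDr; lra.
Qed.

(* The tangent at [th `^ p] of the function [exp (a x^(1/p))], which is convex
   above [(p / a) `^ p]. *)
Lemma powR_le_expR_tangent p a th t y : 1 <= p -> 0 < th -> p <= a * th ->
  0 < t -> 0 <= y ->
  expR (a * th) * (a * th / p) / th `^ p * y `^ p <=
  t `^ p * expR (a * t^-1 * y) + expR (a * th) * (a * th / p - 1) * t `^ p.
Proof.
move=> p1 th0 path t0 y0.
have p0 : 0 < p by lra.
set s := a * th / p.
have s1 : 1 <= s by rewrite /s ler_pdivlMr // mul1r.
(* In this normalized variable the point of tangency is x = 1. *)
pose x := y / (t * th).
have x0 : 0 <= x by rewrite divr_ge0 // mulr_ge0 // ltW.
have yE : y = x * t * th.
  by rewrite /x -mulrA divfK // mulf_neq0 // gt_eqF.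
clearbody x.
have xp : x `^ p <= expR ((x - 1) * p).
  rewrite expRM ge0_ler_powR ?nnegrE ?expR_ge0 //; first exact: ltW.
  by apply: le_trans (expR_ge1Dx _); lra.
(* With z = p (x - 1) and s = a th / p the exponent s z is a y / t - a th; the power x^p enters
   through x <= exp (x - 1). *)
have := expR_bernoulli ((x - 1) * p) s1.
have -> : s * ((x - 1) * p) = a * t^-1 * y - a * th.
  by rewrite yE /s; field; rewrite !gt_eqF.
rewrite expRB => h.
have {}h : 1 + s * (x `^ p - 1) <= expR (a * t^-1 * y) / expR (a * th).
  by apply: le_trans h; rewrite lerD2l ler_wpM2l ?lerD2r //; lra.
have E0 := expR_gt0 (a * th).
have {}h := ler_wpM2l (ltW E0) h.
rewrite mulrCA divff ?gt_eqF // mulr1 in h.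
have yp : y `^ p = x `^ p * t `^ p * th `^ p.
  have t0' := ltW t0; have th0' := ltW th0.
  by rewrite yE powRM ?mulr_ge0 // powRM.
have thp : 0 < th `^ p by rewrite powR_gt0.
have -> : expR (a * th) * s / th `^ p * y `^ p =
    expR (a * th) * s * x `^ p * t `^ p.
  by rewrite yp; field; rewrite gt_eqF.
have := ler_wpM2r (powR_ge0 t p) h.
by rewrite -/s; lra.
Qed.

End real_inequalities.

(** * Tonelli's theorem with one variable restricted to a set *)

Section fubini_on.
Local Open Scope ereal_scope.
Context {d1 d2} {T1 : measurableType d1} {T2 : measurableType d2} {R : realType}.
Variables (m1 : {sigma_finite_measure set T1 -> \bar R})
  (m2 : {sigma_finite_measure set T2 -> \bar R}) (D : set T1).
Hypothesis mD : measurable D.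
Variable F : T1 * T2 -> \bar R.
Hypothesis mF : measurable_fun setT F.
Hypothesis F0 : forall z, 0 <= F z.

Let G (z : T1 * T2) : \bar R := F z * (\1_D z.1)%:E.

Let mG : measurable_fun setT G.
Proof.
apply: emeasurable_funM => //; apply/measurable_EFinP.
by apply: measurableT_comp => //; exact: measurable_indic.
Qed.

Let G0 z : 0 <= G z.
Proof. by rewrite mule_ge0 // lee_fin indicE. Qed.

Let GE y : \int[m1]_(x in D) F (x, y) = \int[m1]_x G (x, y).
Proof.
rewrite integral_mkcond; apply: eq_integral => x _.
by rewrite /G patchE indicE /=; case: ifPn => _; rewrite ?mule1 ?mule0.
Qed.

Lemma measurable_integral_on :
  measurable_fun setT (fun y => \int[m1]_(x in D) F (x, y)).
Proof.
under eq_fun do rewrite GE.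
exact: (measurable_fun_fubini_tonelli_G (m1 := m1) G mG G0).
Qed.

Lemma fubini_tonelli_on :
  \int[m2]_y \int[m1]_(x in D) F (x, y) = \int[m1]_(x in D) \int[m2]_y F (x, y).
Proof.
under eq_integral do rewrite GE.
rewrite -(fubini_tonelli G mG G0) [RHS]integral_mkcond.
apply: eq_integral => x _; rewrite patchE /G /=; case: ifPn => xD.
  by apply: eq_integral => y _; rewrite indicE xD mule1.
by under eq_integral do rewrite indicE (negbTE xD) mule0; rewrite integral0.
Qed.

End fubini_on.

Section tail_bound.
Context {R : realType} {d1 d2 : measure_display} {T : measurableType d1}
  {Omega : measurableType d2}.
Variables (mu : {sigma_finite_measure set T -> \bar R})
  (P : probability Omega R) (v : R -> R) (D : set T) (Y : T -> Omega -> R) (p : R).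
Hypothesis Hv : orlicz_N_function v.
Hypothesis mD : measurable D.
Hypothesis mY : measurable_fun setT (fun z : T * Omega => Y z.1 z.2).
Hypothesis p1 : 1 <= p.

Let mYt t : measurable_fun setT (Y t).
Proof. exact: (measurableT_comp mY (measurable_pair1 t)). Qed.

Let p0 : 0 < p. Proof. by rewrite (lt_le_trans _ p1). Qed.
Let pn0 : p != 0. Proof. by rewrite gt_eqF. Qed.

Let ta t := fine (tau P v (Y t)).

Let mta : measurable_fun setT ta.
Proof. by apply: measurableT_comp => //; exact: measurable_tau. Qed.

Let ta0 t : 0 <= ta t.
Proof. by apply: fine_ge0; exact: tau_ge0. Qed.

Let mtaX (q : R) : measurable_fun setT (fun t => ta t `^ q).
Proof. exact: measurableT_comp (measurable_powR q) mta. Qed.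

Let mtaup : measurable_fun setT (fun t => tau P v (Y t) `^ p)%E.
Proof. exact: (measurableT_comp (measurable_poweR p) (measurable_tau P Hv mY)). Qed.

(** This is tau^p exp (a |Y| / tau) wherever [tau] is positive and finite. Since [fine] sends +oo to
    0, [ta] vanishes for both degenerate values; there W is +oo unless Y = 0. This keeps the tangent
    inequality true even when the coefficient of tau^p in it is 0. *)
Let W (a : R) (z : T * Omega) : \bar R :=
  ((ta z.1 `^ p * expR (a * ta z.1 `^ (-1) * `|Y z.1 z.2|))%:E +
   (+oo * (\1_[set t | ta t = 0] z.1)%:E) * `|Y z.1 z.2|%:E)%E.

Let mta00 : measurable [set t | ta t = 0].
Proof.
by have := mta measurableT (measurable_set1 (0 : R)); rewrite setTI.
Qed.

Let mW a : measurable_fun setT (W a).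
Proof.
have mYz : measurable_fun setT (fun z : T * Omega => `|Y z.1 z.2|).
  exact: measurableT_comp.
have m1 (q : R) : measurable_fun setT (fun z : T * Omega => ta z.1 `^ q).
  exact: measurableT_comp (mtaX q) measurable_fst.
apply: emeasurable_funD.
  apply/measurable_EFinP; apply: measurable_funM => //.
  apply: measurableT_comp => //; apply: measurable_funM => //.
  exact: measurable_funM.
apply: emeasurable_funM; last exact/measurable_EFinP.
apply: measurable_funeM; apply/measurable_EFinP.
by apply: measurableT_comp => //; exact: measurable_indic.
Qed.

Let W0 a z : (0 <= W a z)%E.
Proof.
by rewrite /W adde_ge0 ?lee_fin ?mulr_ge0 ?powR_ge0 ?expR_ge0.
Qed.

(** If [tau = 0] then E|Y| = 0 by [expectation_norm_le_tau], so the infinite term integrates to 0.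
    Otherwise, for finite [tau], this is the moment bound at the exponent a / tau. *)
Let EW (a : R) t : (\int[P]_w W a (t, w) <=
  (2 * expR (v a))%:E * tau P v (Y t) `^ p)%E.
Proof.
have K0 : 0 < 2 * expR (v a) by rewrite mulr_gt0 ?expR_gt0.
have mN : measurable_fun setT (fun w => `|Y t w|%:E).
  by apply/measurable_EFinP; exact: measurableT_comp.
rewrite /W /=; have := tau_ge0 P v (Y t).
case E : (tau P v (Y t)) => [x| |] // x0; last first.
  by rewrite poweRyr // gt0_muley ?lte_fin // leey.
have taE : ta t = x by rewrite /ta E.
have [x00|xn0] := eqVneq x 0.
  rewrite indicE mem_set /=; last by rewrite taE.
  rewrite (eq_integral (fun w => +oo * `|Y t w|%:E)%E); last first.
    by move=> w _; rewrite taE x00 powR0 // mul0r add0e mule1.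
  rewrite ge0_integralZl // ?leey //.
  suff -> : (\int[P]_w `|Y t w|%:E = 0)%E.
    by rewrite mule0 mule_ge0 ?poweR_ge0 // lee_fin ?powR_ge0 // ltW.
  apply/eqP; rewrite eq_le integral_ge0 // andbT.
  have := expectation_norm_le_tau P Hv (mYt t).
  by rewrite unlock E x00 mule0.
rewrite indicE memNset /=; last by rewrite taE; apply/eqP.
rewrite (eq_integral (fun w => (x `^ p)%:E *
    (expR (a * x^-1 * `|Y t w|))%:E)%E); last first.
  by move=> w _; rewrite mule0 mul0e adde0 taE EFinM powR_inv1.
rewrite ge0_integralZl_EFin ?powR_ge0 //; last first.
  apply/measurable_EFinP; apply: measurableT_comp => //.
  by apply: measurable_funM => //; exact: measurableT_comp.
rewrite muleC lee_wpmul2r // ?lee_fin ?powR_ge0 //.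
have hm : mgf_bound P v (Y t) x by apply: (tau_le_mgf_bound Hv); rewrite E.
have := expectation_expR_norm Hv (a * x^-1) (mYt t) hm.
by rewrite unlock mulrCA mulfV // mulr1.
Qed.

(** Markov's inequality for G, the integral of W over D. Where the level c th^p is exceeded, the
    integrated tangent inequality reads exp (a th) s c <= G + exp (a th) (s - 1) c, so the slope s
    drops out and G >= exp (a th) c. By Tonelli the mean of G is at most 2 exp (v a) c. *)
Lemma Lp_tail_bound_aux (c th a : R) : 0 < c -> 0 < th -> p <= a * th ->
  (\int[mu]_(t in D) (tau P v (Y t) `^ p) <= c%:E)%E ->
  (P [set w | (c * th `^ p)%:E < \int[mu]_(t in D) (`|Y t w|%R `^ p)%:E]%E <=
    (2 * expR (v a - a * th))%:E)%E.
Proof.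
move=> c0 th0 path Ic.
set A := [set w | _]; set s := a * th / p.
have s1 : 1 <= s by rewrite /s ler_pdivlMr // mul1r.
have E0 := expR_gt0 (a * th).
have thp : 0 < th `^ p by rewrite powR_gt0.
pose G (w : Omega) := (\int[mu]_(t in D) W a (t, w))%E.
have mG : measurable_fun setT G by exact: measurable_integral_on.
have mZ : measurable_fun setT (fun w => \int[mu]_(t in D) (`|Y t w|%R `^ p)%:E)%E.
  apply: (measurable_integral_on mu mD (F := fun z => (`|Y z.1 z.2| `^ p)%:E)).
    apply/measurable_EFinP; apply: (measurableT_comp (measurable_powR p)).
    exact: measurableT_comp.
  by move=> z; rewrite lee_fin powR_ge0.
have mA : measurable A.
  by rewrite -[X in measurable X]setTI; apply: emeasurable_fun_o_infty.
have AG w : A w -> ((expR (a * th) * c)%:E <= G w)%E.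
  rewrite /A /= => Zw.
  have mYw : measurable_fun D (fun t => `|Y t w|).
    apply: measurable_funTS; apply: measurableT_comp => //.
    exact: (measurableT_comp mY (measurable_pair2 w)).
  have mYp : measurable_fun D (fun t => (`|Y t w| `^ p)%:E).
    apply/measurable_EFinP.
    exact: (measurableT_comp (measurable_powR p)).
  have mtp : measurable_fun D (fun t => tau P v (Y t) `^ p)%E.
    exact: measurable_funTS.
  have mWw : measurable_fun D (fun t => W a (t, w)).
    by apply: measurable_funTS; exact: (measurableT_comp (mW a) (measurable_pair2 w)).
  have k1 : 0 <= expR (a * th) * s / th `^ p.
    by apply: divr_ge0; [apply: mulr_ge0; [exact: ltW|exact: le_trans s1]|exact: ltW].
  have k2 : 0 <= expR (a * th) * (s - 1) by rewrite mulr_ge0 ?subr_ge0 // expR_ge0.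
  have hpt t : ((expR (a * th) * s / th `^ p)%:E * (`|Y t w| `^ p)%:E <=
      W a (t, w) + (expR (a * th) * (s - 1))%:E * tau P v (Y t) `^ p)%E.
    rewrite /W /=; have := tau_ge0 P v (Y t).
    case E : (tau P v (Y t)) => [x| |] // x0.
      have taE : ta t = x by rewrite /ta E.
      have [x00|xn0] := eqVneq x 0.
        rewrite indicE mem_set /=; last by rewrite taE.
        rewrite x00 powR0 // mule0 adde0 mule1 taE x00 powR0 // mul0r add0e.
        have := normr_ge0 (Y t w); rewrite le_eqVlt => /orP[/eqP <-|Y0].
          by rewrite powR0 // mule0.
        by rewrite gt0_mulye ?lte_fin // leey.
      rewrite indicE memNset /=; last by rewrite taE; apply/eqP.
      rewrite mule0 mul0e adde0 taE -!EFinM -EFinD lee_fin powR_inv1 //.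
      apply: powR_le_expR_tangent => //.
      by rewrite lt_neqAle eq_sym xn0.
    have taE : ta t = 0 by rewrite /ta E.
    rewrite indicE mem_set //= (negPf pn0) mule1 taE powR0 // mul0r add0e.
    have k2y : (0 <= (expR (a * th) * (s - 1))%:E * +oo)%E.
      by rewrite mule_ge0 // ?lee_fin // leey.
    have := normr_ge0 (Y t w); rewrite le_eqVlt => /orP[/eqP <-|Y0].
      by rewrite powR0 // !mule0 add0e.
    rewrite [(+oo * _)%E]gt0_mulye ?lte_fin // addye ?leey //.
    by rewrite gt_eqF // (lt_le_trans (ltNyr 0)).
  have hI : ((expR (a * th) * s / th `^ p)%:E *
       \int[mu]_(t in D) (`|Y t w| `^ p)%:E <=
     G w + (expR (a * th) * (s - 1))%:E * c%:E)%E.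
    rewrite -ge0_integralZl_EFin //.
    apply: (@le_trans _ _ (\int[mu]_(t in D) (W a (t, w) +
        (expR (a * th) * (s - 1))%:E * tau P v (Y t) `^ p))%E).
      apply: ge0_le_integral => //.
      - by move=> t _; rewrite -EFinM lee_fin mulr_ge0 // powR_ge0.
      - exact: measurable_funeM.
      - by apply: emeasurable_funD => //; exact: measurable_funeM.
    rewrite ge0_integralD //; last 2 first.
    - by move=> t _; rewrite mule_ge0 ?lee_fin // poweR_ge0.
    - exact: measurable_funeM.
    rewrite leeD2l // ge0_integralZl_EFin //; last by move=> t _; exact: poweR_ge0.
    by rewrite lee_wpmul2l // lee_fin.
  have := le_trans (lee_wpmul2l _ (ltW Zw)) hI; rewrite lee_fin => /(_ k1).
  rewrite -!EFinM -leeBlDr // -EFinB; apply: le_trans; rewrite lee_fin.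
  rewrite (_ : _ / _ * _ = expR (a * th) * s * c); last first.
    by field; rewrite gt_eqF.
  by lra.
have K0 : 0 < expR (a * th) * c by rewrite mulr_gt0.
have : ((expR (a * th) * c)%:E * P A <= (2 * expR (v a) * c)%:E)%E.
  rewrite -integral_cst //.
  apply: (@le_trans _ _ (\int[P]_(w in A) G w)%E).
    apply: ge0_le_integral => //; first by move=> w _; rewrite lee_fin ltW.
    exact: measurable_funTS.
  apply: (@le_trans _ _ (\int[P]_w G w)%E).
    apply: ge0_subset_integral => //.
    by move=> w _; exact: integral_ge0.
  rewrite fubini_tonelli_on //.
  apply: (@le_trans _ _ (\int[mu]_(t in D)
      ((2 * expR (v a))%:E * tau P v (Y t) `^ p))%E).
    apply: ge0_le_integral => //.
    - by move=> t _; exact: integral_ge0.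
    - apply: measurable_funTS.
      exact: (@measurable_fun_fubini_tonelli_F _ _ T Omega R P).
    - by apply: measurable_funTS; exact: measurable_funeM.
  rewrite ge0_integralZl_EFin //; last 2 first.
  - by move=> t _; exact: poweR_ge0.
  - exact: measurable_funTS.
  by rewrite [leRHS]EFinM lee_wpmul2l // lee_fin mulr_ge0 // expR_ge0.
have : P A \is a fin_num by exact: fin_num_measure.
move/fineK => <-; rewrite -EFinM !lee_fin => h.
rewrite -(ler_pM2l K0); apply: le_trans h _.
rewrite expRB [leRHS](_ : _ = 2 * expR (v a) * c) //.
by field; rewrite gt_eqF.
Qed.

End tail_bound.

(** * Increments of an N-function and its density *)

Section density.
Context {R : realType} {v f : R -> R}.
Hypothesis Hf : density_of v f.
Local Notation mu := (@lebesgue_measure R).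

Lemma density_ge0 x : 0 <= x -> 0 <= f x.
Proof. by case: Hf => fm _ f0 _ _ x0; rewrite -f0 fm. Qed.

Lemma density_integrable b : mu.-integrable `[0, b] (EFin \o f).
Proof.
case: Hf => fm _ _ _ _.
apply: measurable_bounded_integrable => //.
- by rewrite /= lebesgue_measure_itv /=; case: ifPn => _ //; rewrite ltry.
(* Monotonicity is known on the half-line only; composing with [max x 0] gives a function monotone
   everywhere, hence measurable. *)
- apply: (eq_measurable_fun (fun x : R => f (Order.max x 0 : R))) => /=.
    by move=> x; rewrite inE /= in_itv /= => /andP[x0 _]; rewrite max_l.
  apply: nondecreasing_measurable => // x y xy.
  by apply: fm; [rewrite le_max lexx orbT|rewrite ge_max !le_max xy lexx !orbT].
- exists (f b); split; first exact: num_real.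
  move=> M bM x /=; rewrite in_itv /= => /andP[x0 xb].
  by rewrite ger0_norm ?density_ge0 // ltW // (le_lt_trans _ bM) // fm.
Qed.

(** Serves for the exponents too small for [Lp_tail_bound_aux]: a bound on f at the right end
    controls the growth of v up to there. *)
Lemma density_increment a b : 0 <= a -> a <= b -> v b - v a <= (b - a) * f b.
Proof.
move=> a0 ab; have b0 := le_trans a0 ab; case: (Hf) => fm _ _ _ vE.
rewrite !vE !ger0_norm // (@Rintegral_itvB _ f (BLeft 0) (BRight b) a); last 3 first.
- exact: density_integrable.
- by rewrite bnd_simp.
- by rewrite bnd_simp.
apply: (@le_trans _ _ (\int[mu]_(x in `]a, b]) f b)).
  apply: le_Rintegral => //.
  - apply: integrableS (density_integrable b) => //.
    by apply: subset_itvr; rewrite bnd_simp.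
  - apply: measurable_bounded_integrable => //.
      by rewrite /= lebesgue_measure_itv /=; case: ifPn => _ //; rewrite ltry.
    by exists `|f b|; split; [exact: num_real|by move=> M bM x _ /=; exact: ltW].
  - move=> x /=; rewrite in_itv /= => /andP[ax xb].
    by apply: fm => //; rewrite (le_trans a0) // ltW.
rewrite Rintegral_cst //= lebesgue_measure_itv /= lte_fin.
have [ab'|ba] := ltP a b; first by rewrite /= mulrC.
by rewrite (le_anti (introT andP (conj ab ba))) subrr mul0r mulr0.
Qed.

End density.

Section tail_theorem.
Context {R : realType} {d1 d2 : measure_display} {T : measurableType d1}
  {Omega : measurableType d2}.
Variables (mu : {sigma_finite_measure set T -> \bar R})
  (P : probability Omega R) (v f : R -> R) (D : set T) (Y : T -> Omega -> R) (p : R).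
Hypothesis Hv : orlicz_N_function v.
Hypothesis Hf : density_of v f.
Hypothesis mD : measurable D.
Hypothesis mY : measurable_fun setT (fun z : T * Omega => Y z.1 z.2).
Hypothesis p1 : 1 <= p.

Let p0 : 0 < p. Proof. by rewrite (lt_le_trans _ p1). Qed.
Let ip0 : 0 < p^-1. Proof. by rewrite invr_gt0. Qed.

Let Ic := (\int[mu]_(t in D) (tau P v (Y t) `^ p))%E.

Let Ic0 : (0 <= Ic)%E.
Proof. by apply: integral_ge0 => t _; exact: poweR_ge0. Qed.

Lemma Lp_tail_bound (e : R) :
  (Ic * (f (p * fine (Ic / e%:E) `^ p^-1) `^ p)%:E < e%:E)%E ->
  (P [set w | (e%:E < \int[mu]_(t in D) (`|Y t w|%R `^ p)%:E)%E]
     <= 2%:E * expeR (- young_fenchel v ((e%:E / Ic) `^ p^-1)))%E.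
Proof.
move=> hyp.
have e0 : 0 < e.
  rewrite -lte_fin; apply: le_lt_trans hyp.
  by rewrite mule_ge0 // lee_fin powR_ge0.
set A := [set w | _].
have PA1 : (P A <= 1)%E.
  apply: probability_le1; rewrite -[X in measurable X]setTI.
  apply: emeasurable_fun_o_infty => //.
  apply: (measurable_integral_on mu mD (F := fun z => (`|Y z.1 z.2| `^ p)%:E)).
    apply/measurable_EFinP; apply: (measurableT_comp (measurable_powR p)).
    exact: measurableT_comp.
  by move=> z; rewrite lee_fin powR_ge0.
have [r Er] : exists r, P A = r%:E.
  by exists (fine (P A)); rewrite fineK // ge0_fin_numE // (le_lt_trans PA1) // ltry.
move: hyp Ic0; case Ec : Ic => [c| |] // hyp c0; last first.
  (* For infinite c the conjugate is taken at 0, where it is at most 0, so the right-hand side is at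
     least 2. *)
  rewrite invey mule0 poweR0r ?gt_eqF // (le_trans PA1) //.
  have h : (1 <= expeR (- young_fenchel v 0))%E.
    rewrite -expeR0 lee_expeR oppe_ge0; apply: ge_ereal_sup => _ [y _ <-].
    by rewrite mul0e sub0e -EFinN lee_fin oppr_le0 (orlicz_ge0 Hv).
  by apply: (le_trans h); rewrite -[leLHS]mul1e lee_wpmul2r ?expeR_ge0 // lee_fin; lra.
have bound (c' th a : R) : 0 < c' -> c <= c' -> 0 < th -> e = c' * th `^ p ->
    p <= a * th -> r <= 2 * expR (v a - a * th).
  move=> c'0 cc' th0 eE path; rewrite -lee_fin -Er /A eE.
  apply: Lp_tail_bound_aux => //.
  by rewrite -/Ic Ec lee_fin.
have {}bound (c' th a : R) : 0 < c' -> c <= c' -> 0 < th -> e = c' * th `^ p ->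
    p <= a * th -> 0 < r -> a * th - v a <= - ln (r / 2).
  move=> c'0 cc' th0 eE path r0.
  rewrite lerNr opprB -ler_expR lnK ?posrE ?divr_gt0 //.
  by rewrite ler_pdivrMr // mulrC (bound c').
rewrite Er; have [r0|r0] := leP r 0.
  by rewrite (@le_trans _ _ 0%E) ?lee_fin // mule_ge0 // expeR_ge0.
suff YF : (young_fenchel v ((e%:E / c%:E) `^ p^-1) <= (- ln (r / 2))%:E)%E.
  apply: (@le_trans _ _ (2%:E * expeR (ln (r / 2))%:E)%E).
    by rewrite /= lnK ?posrE ?divr_gt0 // lee_fin; lra.
  by rewrite lee_wpmul2l // lee_expeR leeNr.
move: c0; rewrite lee_fin le_eqVlt => /orP[/eqP c0|c0].
  (* If c = 0, any positive c' is allowed, hence any th: with exponent 1 a large th contradicts P(A)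
     = r > 0. The 1 added in th makes the contradiction strict. *)
  exfalso.
  pose th := Order.max p (v 1 - ln (r / 2) + 1).
  have th0 : 0 < th by rewrite lt_max p0.
  have thp : 0 < th `^ p by rewrite powR_gt0.
  have := bound (e / th `^ p) th 1; rewrite -c0 divfK ?gt_eqF // mul1r.
  move=> /(_ _ _ th0 erefl _ r0); rewrite divr_gt0 // ltW ?divr_gt0 //.
  have : p <= th by rewrite le_max lexx.
  have : v 1 - ln (r / 2) + 1 <= th by rewrite le_max lexx orbT.
  by move=> h ph /(_ isT isT ph); lra.
rewrite inver gt_eqF // -EFinM; set th := (e / c) `^ p^-1.
have th0 : 0 < th by rewrite powR_gt0 // divr_gt0.
have thp : th `^ p = e / c.
  by rewrite -powRrM mulVf ?gt_eqF // powRr1 // divr_ge0 ?ltW.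
have eE : e = c * th `^ p by rewrite thp mulrCA mulfV ?mulr1 // gt_eqF.
(* This is the hypothesis on e, since (c / e)^(1/p) is 1 / th and e = c th^p. *)
have fth : f (p / th) <= th.
  move: hyp; rewrite inver gt_eqF // -EFinM /=.
  have -> : (c / e) `^ p^-1 = th^-1.
    have thn0 : th != 0 by rewrite gt_eqF.
    apply: (mulIf thn0); rewrite mulVf // /th -powRM ?divr_ge0 ?ltW //.
    by rewrite mulrA divfK ?gt_eqF // divff ?gt_eqF // powR1.
  rewrite lte_fin => /ltW; rewrite [leRHS]eE ler_pM2l //.
  rewrite leNgt => h; rewrite leNgt; apply: contra h => h.
  by apply: gt0_ltr_powR; rewrite ?nnegrE // ltW // (lt_trans th0).
apply: ge_ereal_sup => _ [y _ <-]; rewrite -EFinM -EFinB lee_fin.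
have pth0 : 0 <= p / th by rewrite divr_ge0 ?ltW.
have := bound c th; rewrite lexx => /(_ _ c0 isT th0 eE); set B := ln _.
move=> {}bound.
have hy : th * y - v y <= th * `|y| - v `|y|.
  by rewrite (orlicz_norm Hv) lerD2r ler_pM2l // ler_norm.
apply: (le_trans hy).
(* Below p / th the density is at most th, so th y - v y does not exceed its value at p / th, which
   is covered by the first case. *)
have [yb|yb] := leP (p / th) `|y|.
  have := bound `|y|; rewrite -ler_pdivrMr // => /(_ yb r0).
  by rewrite mulrC.
apply: (le_trans _ (bound (p / th) _ r0)); last by rewrite divfK // gt_eqF.
have := density_increment Hf (normr_ge0 y) (ltW yb).
have : (p / th - `|y|) * f (p / th) <= (p / th - `|y|) * th.
  by rewrite ler_wpM2l // subr_ge0 ltW.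
by lra.
Qed.

End tail_theorem.

(** * Sums over the integers and periodizations *)

Section affine_change.
Context {R : realType}.
Local Notation mu := (@lebesgue_measure R).
Variables (a b : R).
Hypothesis a0 : 0 < a.

Let aff (x : R) : measurableTypeR R := a * x + b.

Let maff : measurable_fun [set: measurableTypeR R] aff.
Proof.
apply: continuous_measurable_fun => x; apply: cvgD; last exact: cvg_cst.
by apply: cvgMl_tmp; exact: cvg_id.
Qed.

(** The image of the measure under x |-> a x + b, multiplied by a, agrees with Lebesgue measure on
    half-open intervals, hence everywhere by uniqueness. *)
Lemma lebesgue_measure_affine (A : set R) : measurable A ->
  mu ((fun x => a * x + b) @^-1` A) = (a^-1%:E * mu A)%E.
Proof.
move=> mA; have an0 : a != 0 by rewrite gt_eqF.
pose nu : {measure set (measurableTypeR R) -> \bar R} :=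
  mscale (NngNum (ltW a0)) (pushforward mu aff).
have nuE : forall B, measurable B -> mu B = nu maff B.
  apply: lebesgue_measure_unique => _ [[x y] /= xy <-].
  rewrite /nu /mscale /= /pushforward /= lebesgue_measure_itv /= lte_fin.
  rewrite (_ : aff @^-1` _ = `](x - b) / a, (y - b) / a]%classic); last first.
    apply/seteqP; split=> t /=; rewrite /aff !in_itv /=;
      by rewrite ltr_pdivrMr // ler_pdivlMr // [t * a]mulrC ltrBlDr lerBrDr.
  rewrite lebesgue_measure_itv /= lte_fin ltr_pM2r ?invr_gt0 // ltrD2r.
  case: ifPn => _; last by rewrite mule0.
  by rewrite -EFinB -EFinM; congr EFin; field.
rewrite [in RHS]nuE // /nu /mscale /= muleA -EFinM mulVf // mul1e.
by [].
Qed.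

Lemma ge0_integral_affine (F : R -> \bar R) : measurable_fun setT F ->
  (forall x, 0 <= F x)%E ->
  (\int[mu]_x F (a * x + b)%R = a^-1%:E * \int[mu]_x F x)%E.
Proof.
move=> mF F0; have an0 : a != 0 by rewrite gt_eqF.
have ai0 : 0 <= a^-1 by rewrite invr_ge0 ltW.
rewrite -(@ge0_integral_mscale _ _ _ mu _ measurableT (NngNum ai0)) //.
have /(_ measurableT mF) := @ge0_integral_pushforward _ _ (measurableTypeR R)
  (measurableTypeR R) R aff maff mu setT F.
move=> <-; last by move=> x _; exact: F0.
apply: eq_measure_integral => A mA _.
by rewrite /mscale /= /pushforward /= lebesgue_measure_affine.
Qed.

Lemma integrable_affine (F : R -> R) : mu.-integrable setT (EFin \o F) ->
  mu.-integrable setT (EFin \o (fun x => F (a * x + b))).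
Proof.
move=> /integrableP[mF iF]; apply/integrableP; split.
  exact: measurableT_comp mF maff.
rewrite (@ge0_integral_affine (fun x => `|(F x)%:E|)%E) //=.
  by rewrite lte_mul_pinfty // lee_fin invr_ge0 ltW.
apply/measurable_EFinP; apply: measurableT_comp => //.
exact/measurable_EFinP.
Qed.

Lemma Rintegral_affine (F : R -> R) : mu.-integrable setT (EFin \o F) ->
  \int[mu]_x F (a * x + b) = a^-1 * \int[mu]_x F x.
Proof.
move=> iF; have mF : measurable_fun setT (EFin \o F) := measurable_int _ iF.
have an0 : 0 <= a^-1 by rewrite invr_ge0 ltW.
have fp (G : R -> \bar R) : measurable_fun setT G -> (forall x, 0 <= G x)%E ->
    (\int[mu]_x G (a * x + b)%R = a^-1%:E * \int[mu]_x G x)%E.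
  exact: ge0_integral_affine.
rewrite /Rintegral integralE [in RHS]integralE.
rewrite -[X in _ = X]/(fine a^-1%:E * _) -fineM //; last first.
  rewrite fin_numB.
  by rewrite integrable_pos_fin_num // integrable_neg_fin_num.
congr fine; rewrite muleBr //; last first.
  by apply: fin_num_adde_defr; exact: integrable_pos_fin_num.
congr (_ - _)%E.
  rewrite -(fp _ (measurable_funepos mF)); last by move=> x; exact: funepos_ge0.
  by apply: eq_integral => x _; rewrite unlock.
rewrite -(fp _ (measurable_funeneg mF)); last by move=> x; exact: funeneg_ge0.
by apply: eq_integral => x _; rewrite unlock.
Qed.

Lemma ae_affine (Q : R -> Prop) : {ae mu, forall x, Q x} ->
  {ae mu, forall x, Q (a * x + b)}.
Proof.
move=> [N [mN N0 QN]]; exists ((fun x => a * x + b) @^-1` N); split.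
- by rewrite -[X in measurable X]setTI; exact: maff.
- by rewrite lebesgue_measure_affine // N0 mule0.
- by move=> x /= nQ; apply: QN.
Qed.

End affine_change.

(** * Absolutely convergent sums over the integers *)

Section zsum.
Context {R : realType}.
Implicit Types (g h : int -> R) (K : nat).

Lemma sum_abs_le0 g : sum_abs_le 0 g = g 0.
Proof. by rewrite /sum_abs_le muln0 big_nat1. Qed.

Lemma sum_abs_leS K g :
  sum_abs_le K.+1 g = sum_abs_le K g + g (K.+1)%:Z + g (- (K.+1)%:Z).
Proof.
rewrite /sum_abs_le mulnS big_nat_recl // big_nat_recr //=.
rewrite [LHS]addrC; congr (_ + _ + _).
- apply: eq_bigr => i _; congr g; lia.
- congr g; lia.
- congr g; lia.
Qed.

Lemma sum_abs_leD K g h :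
  sum_abs_le K (fun k => g k + h k) = sum_abs_le K g + sum_abs_le K h.
Proof. by rewrite /sum_abs_le big_split. Qed.

Lemma sum_abs_leZ K a g : sum_abs_le K (fun k => a * g k) = a * sum_abs_le K g.
Proof. by rewrite /sum_abs_le big_distrr. Qed.

Lemma sum_abs_leN K g : sum_abs_le K (fun k => - g k) = - sum_abs_le K g.
Proof. by rewrite /sum_abs_le sumrN. Qed.

Lemma sum_abs_leB K g h :
  sum_abs_le K (fun k => g k - h k) = sum_abs_le K g - sum_abs_le K h.
Proof. by rewrite sum_abs_leD sum_abs_leN. Qed.

Lemma ler_sum_abs_le K g h : (forall k, g k <= h k) ->
  sum_abs_le K g <= sum_abs_le K h.
Proof. by move=> gh; apply: ler_sum => i _; exact: gh. Qed.

Lemma sum_abs_le_ge0 K g : (forall k, 0 <= g k) -> 0 <= sum_abs_le K g.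
Proof. by move=> g0; apply: sumr_ge0. Qed.

Lemma ler_norm_sum_abs_le K g :
  `|sum_abs_le K g| <= sum_abs_le K (fun k => `|g k|).
Proof. exact: ler_norm_sum. Qed.

Lemma eq_sum_abs_le K g h : g =1 h -> sum_abs_le K g = sum_abs_le K h.
Proof. by move=> gh; apply: eq_bigr => i _. Qed.

Lemma sum_abs_le_nd g : (forall k, 0 <= g k) ->
  nondecreasing_seq (fun K => sum_abs_le K g).
Proof.
move=> g0; apply/nondecreasing_seqP => K.
by rewrite sum_abs_leS -addrA lerDl addr_ge0.
Qed.

(** Absolute summability. The partial sums are symmetric because the truncations of the approximants
    are. *)
Definition zsummable g := exists M, forall K, sum_abs_le K (fun k => `|g k|) <= M.

Definition zsum g := lim (sum_abs_le K g @[K --> \oo]).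

Lemma zsummable_le g h : zsummable h -> (forall k, `|g k| <= `|h k|) ->
  zsummable g.
Proof.
by move=> [M hM] gh; exists M => K; apply: le_trans (hM K); exact: ler_sum_abs_le.
Qed.

Lemma zsummableD g h : zsummable g -> zsummable h ->
  zsummable (fun k => g k + h k).
Proof.
move=> [M gM] [N hN]; exists (M + N) => K.
apply: le_trans (lerD (gM K) (hN K)); rewrite -sum_abs_leD.
by apply: ler_sum_abs_le => k; exact: ler_normD.
Qed.

Lemma zsummableZ a g : zsummable g -> zsummable (fun k => a * g k).
Proof.
move=> [M gM]; exists (`|a| * M) => K.
under eq_sum_abs_le do rewrite normrM.
by rewrite sum_abs_leZ ler_wpM2l.
Qed.

Let ge0_zsum_cvg g : (forall k, 0 <= g k) -> zsummable g ->
  sum_abs_le K g @[K --> \oo] --> zsum g.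
Proof.
move=> g0 [M gM]; apply: nondecreasing_is_cvgn; first exact: sum_abs_le_nd.
exists M => _ [K _ <-]; apply: le_trans (gM K).
by apply: ler_sum_abs_le => k; exact: ler_norm.
Qed.

(** g is the difference of g + |g| and |g|, two nonnegative families whose partial sums increase. *)
Lemma zsum_cvg g : zsummable g -> sum_abs_le K g @[K --> \oo] --> zsum g.
Proof.
move=> sg; have sa : zsummable (fun k => `|g k|).
  by apply: zsummable_le sg _ => k; rewrite normr_id.
have c1 : sum_abs_le K (fun k => g k + `|g k|) @[K --> \oo] -->
    zsum (fun k => g k + `|g k|).
  apply: ge0_zsum_cvg; last exact: zsummableD.
  by move=> k; have := ler_norm (- g k); rewrite normrN; lra.
have c2 := ge0_zsum_cvg (fun k => normr_ge0 (g k)) sa.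
suff : cvg (sum_abs_le K g @[K --> \oo]) by [].
rewrite (_ : sum_abs_le^~ g = (fun K => sum_abs_le K (fun k => g k + `|g k|) -
    sum_abs_le K (fun k => `|g k|))); first exact: cvgP (cvgB c1 c2).
by apply/funext => K; rewrite sum_abs_leD addrK.
Qed.

Lemma zsum_unique g l : sum_abs_le K g @[K --> \oo] --> l -> zsum g = l.
Proof. by move=> h; apply/cvg_lim. Qed.

Lemma zsumD g h : zsummable g -> zsummable h ->
  zsum (fun k => g k + h k) = zsum g + zsum h.
Proof.
move=> sg sh; apply: zsum_unique; under eq_fun do rewrite sum_abs_leD.
by apply: cvgD; exact: zsum_cvg.
Qed.

Lemma zsumZ a g : zsummable g -> zsum (fun k => a * g k) = a * zsum g.
Proof.
move=> sg; apply: zsum_unique; under eq_fun do rewrite sum_abs_leZ.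
by apply: cvgMl_tmp; exact: zsum_cvg.
Qed.

Lemma zsumB g h : zsummable g -> zsummable h ->
  zsum (fun k => g k - h k) = zsum g - zsum h.
Proof.
move=> sg sh; apply: zsum_unique; under eq_fun do rewrite sum_abs_leB.
by apply: cvgB; exact: zsum_cvg.
Qed.

Lemma ler_norm_zsum g M : (forall K, sum_abs_le K (fun k => `|g k|) <= M) ->
  `|zsum g| <= M.
Proof.
move=> gM; have sg : zsummable g by exists M.
have c : `|sum_abs_le K g| @[K --> \oo] --> `|zsum g|.
  by apply: cvg_norm; exact: zsum_cvg.
rewrite -(cvg_lim _ c) //; apply: limr_le; first exact: cvgP c.
by apply: nearW => K; rewrite (le_trans (ler_norm_sum_abs_le _ _)).
Qed.

Let sum_abs_le_zsum K h : (forall k, 0 <= h k) -> zsummable h ->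
  sum_abs_le K h <= zsum h.
Proof.
move=> h0 sh; apply: limr_ge; first exact: zsum_cvg.
by near=> L; apply: sum_abs_le_nd => //; near: L; exact: nbhs_infty_ge.
Unshelve. all: by end_near. Qed.

(** Both h - g and h + g are nonnegative, so their partial sums are at most their sums. *)
Lemma zsum_tail g h K : (forall k, `|g k| <= h k) -> zsummable h ->
  `|zsum g - sum_abs_le K g| <= zsum h - sum_abs_le K h.
Proof.
move=> gh sh; have h0 k : 0 <= h k by apply: le_trans (gh k).
have sg : zsummable g.
  by apply: zsummable_le sh _ => k; rewrite (le_trans (gh k)) // ler_norm.
have := @sum_abs_le_zsum K (fun k => h k - g k) _ _.
rewrite sum_abs_leB zsumB // => h1.
have := @sum_abs_le_zsum K (fun k => h k + g k) _ _.
rewrite sum_abs_leD zsumD // => h2.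
have {}h1 : sum_abs_le K h - sum_abs_le K g <= zsum h - zsum g.
  apply: h1 => [k|]; first by rewrite subr_ge0 (le_trans _ (gh k)) // ler_norm.
  apply: zsummableD => //; apply: zsummable_le sg _ => k; by rewrite normrN.
have {}h2 : sum_abs_le K h + sum_abs_le K g <= zsum h + zsum g.
  apply: h2 => [k|]; last exact: zsummableD.
  by have := gh k; have := ler_norm (- g k); rewrite normrN; lra.
by rewrite ler_norml; apply/andP; split; lra.
Qed.

Lemma cvg_sum_abs_le {T : Type} {F : set_system T} {FF : Filter F} K
    (u : T -> int -> R) (l : int -> R) :
  (forall k, u x k @[x --> F] --> l k) ->
  sum_abs_le K (u x) @[x --> F] --> sum_abs_le K l.
Proof.
move=> ul; elim: K => [|K IH].
  by rewrite sum_abs_le0; under eq_fun do rewrite sum_abs_le0; exact: ul.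
rewrite sum_abs_leS; under eq_fun do rewrite sum_abs_leS.
by apply: cvgD; [apply: cvgD|].
Qed.

(** Tannery's theorem: past a K where the tail of h is below e / 3, the tails of u and of l are too,
    and the finite sums converge. *)
Lemma zsum_dominated_cvg {T : Type} {F : set_system T} {FF : ProperFilter F}
    (u : T -> int -> R) (l h : int -> R) : zsummable h ->
  (\forall x \near F, forall k, `|u x k| <= h k) ->
  (forall k, u x k @[x --> F] --> l k) ->
  zsum (u x) @[x --> F] --> zsum l.
Proof.
move=> sh uh ul.
have lh k : `|l k| <= h k.
  have c : `|u x k| @[x --> F] --> `|l k| by apply: cvg_norm; exact: ul.
  rewrite -(cvg_lim _ c) //; apply: limr_le; first exact: cvgP c.
  by near=> x; move: k {c}; near: x.
apply/cvgrPdist_lt => e e0.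
have /cvgrPdist_lt /(_ (e / 3)) := zsum_cvg sh.
have e3 : 0 < e / 3 by rewrite divr_gt0.
move=> /(_ e3)[K _ /(_ K (leqnn _)) hK].
have : sum_abs_le K (u x) @[x --> F] --> sum_abs_le K l by exact: cvg_sum_abs_le.
move=> /cvgrPdist_lt /(_ _ e3) hu.
near=> x.
have ux : forall k, `|u x k| <= h k by near: x.
have d1 : `|sum_abs_le K l - sum_abs_le K (u x)| < e / 3 by near: x.
have := @zsum_tail _ _ K lh sh; have := @zsum_tail _ _ K ux sh.
have h' : zsum h - sum_abs_le K h < e / 3 by apply: le_lt_trans hK; exact: ler_norm.
move: d1; rewrite !ltr_norml !ler_norml => /andP[? ?] /andP[? ?] /andP[? ?].
by apply/andP; split; lra.
Unshelve. all: by end_near. Qed.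

End zsum.

Section lattice_sums.
Context {R : realType}.
Variable Psi : R -> R.
Hypothesis Psi0 : forall x, 0 <= x -> 0 <= Psi x.
Hypothesis Psid : forall x y, 0 <= x -> x <= y -> Psi y <= Psi x.
Variable M : R.
Hypothesis PsiM : forall N, \sum_(0 <= m < N) Psi m%:R <= M.

(** On each side of y, the successive integers lie at distances at least 0, 1, 2, ... from y, so
    each side contributes at most M. *)
Let sum_shift (y : R) N : \sum_(0 <= i < N) Psi `|y - i%:R| <= 2 * M.
Proof.
have [n [ny yn]] : exists n : nat, (forall i, (i < n)%N -> n.-1%:R - i%:R <= y - i%:R) /\
    y <= n%:R.
  have [y0|y0] := ltP y 0; first by exists 0%N; split => //; exact: ltW.
  have /andP[y1 y2] := truncn_itv y0.
  by exists (Num.truncn y).+1; split; [move=> i _; rewrite lerD2r|exact: ltW].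
have h1 N1 : (N1 <= n)%N -> \sum_(0 <= i < N1) Psi `|y - i%:R| <= M.
  move=> N1n; apply: le_trans (PsiM n).
  apply: (@le_trans _ _ (\sum_(0 <= i < n) Psi `|y - i%:R|)).
    rewrite [leRHS](@big_cat_nat _ _ _ N1 0 n) //= lerDl.
    by apply: sumr_ge0 => i _; exact: Psi0.
  rewrite [leRHS]big_nat_rev /= !big_nat.
  apply: ler_sum => i /andP[_ iN]; apply: Psid => //.
  apply: le_trans (ler_norm _); apply: le_trans (ny i iN).
  rewrite -natrB; last by rewrite -ltnS prednK // (leq_ltn_trans _ iN).
  by rewrite add0n -subn1 -subnDA add1n.
have h2 N1 : \sum_(n <= i < N1) Psi `|y - i%:R| <= M.
  have [nN|Nn] := leqP n N1; last first.
    by rewrite big_geq; [have := PsiM 0%N; rewrite big_geq|exact: ltnW].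
  apply: le_trans (PsiM (N1 - n)).
  rewrite -{1}[n]add0n big_addn !big_nat; apply: ler_sum => i _.
  apply: Psid => //; rewrite distrC; apply: le_trans (ler_norm _).
  by rewrite natrD; lra.
have [Nn|nN] := leqP N n.
  have M0 : 0 <= M by have := PsiM 0%N; rewrite big_geq.
  by apply: le_trans (h1 N Nn) _; lra.
by rewrite (@big_cat_nat _ _ _ n 0 N _ _ (leq0n _) (ltnW nN)) //= mulr_natl mulr2n lerD // h1.
Qed.

Lemma sum_abs_le_lattice (x : R) K :
  sum_abs_le K (fun k => Psi `|x - k%:~R|) <= 2 * M.
Proof.
apply: le_trans (sum_shift (x + K%:R) (2 * K).+1).
rewrite le_eqVlt; apply/orP; left; apply/eqP; apply: eq_bigr => i _.
by congr (Psi `|_|); rewrite rmorphB /=; ring.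
Qed.

End lattice_sums.

Section real_dominated_convergence.
Context {R : realType} {d} {T : measurableType d}.
Variables (mu : {measure set T -> \bar R}) (D : set T).
Hypothesis mD : measurable D.
Variables (f_ : nat -> T -> R) (f g : T -> R).
Hypothesis mf_ : forall n, measurable_fun D (f_ n).
Hypothesis f_f : forall x, D x -> f_ n x @[n --> \oo] --> f x.
Hypothesis ig : mu.-integrable D (EFin \o g).
Hypothesis f_g : forall n x, D x -> `|f_ n x| <= g x.

Let mf : measurable_fun D f.
Proof. exact: (measurable_fun_cvg mf_). Qed.

Let dct := @dominated_convergence _ _ _ mu D mD (fun n => EFin \o f_ n) (EFin \o f)
  (EFin \o g).

Lemma Rdominated_integrable : mu.-integrable D (EFin \o f).
Proof.
have [] // := dct.
- by move=> n; exact/measurable_EFinP.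
- exact/measurable_EFinP.
- apply: aeW => x Dx; apply: cvg_EFin; first exact: nearW.
  exact: f_f.
- by apply: aeW => x n Dx; rewrite lee_fin f_g.
Qed.

Lemma Rdominated_cvg :
  \int[mu]_(x in D) f_ n x @[n --> \oo] --> \int[mu]_(x in D) f x.
Proof.
have [] // := dct.
- by move=> n; exact/measurable_EFinP.
- exact/measurable_EFinP.
- apply: aeW => x Dx; apply: cvg_EFin; first exact: nearW.
  exact: f_f.
- by apply: aeW => x n Dx; rewrite lee_fin f_g.
move=> _ _ h; apply: fine_cvg; rewrite fineK //.
exact: (integrable_fin_num mD Rdominated_integrable).
Qed.

End real_dominated_convergence.

(** * Integrable decreasing majorants *)

Section envelope.
Context {R : realType}.
Local Notation mu := (@lebesgue_measure R).

(** The clauses of Assumption S that bear on the majorant alone. *)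
Definition envelope (Psi : R -> R) : Prop :=
  [/\ (forall x, 0 <= x -> 0 <= Psi x),
      (forall x y, 0 <= x -> x <= y -> Psi y <= Psi x) &
      (\int[mu]_x (Psi `|x|)%:E < +oo)%E].

Lemma measurable_envelope Psi : envelope Psi ->
  measurable_fun [set: R] (fun x => Psi `|x|).
Proof.
move=> [_ Pd _].
have -> : (fun x : R => Psi `|x|) = (fun x => Psi (Order.max x 0)) \o (fun x => `|x|).
  by apply/funext => x /=; rewrite max_l.
apply: measurableT_comp; last exact: normr_measurable.
apply: nonincreasing_measurable => // x y xy.
by apply: Pd; [rewrite le_max lexx orbT|rewrite ge_max !le_max xy lexx !orbT].
Qed.

Lemma envelope_integrable Psi : envelope Psi ->
  mu.-integrable setT (EFin \o (fun x => Psi `|x|)).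
Proof.
move=> eP; have mP := measurable_envelope eP; case: eP => P0 _ iP.
apply/integrableP; split; first exact/measurable_EFinP.
by under eq_integral do rewrite /= ger0_norm ?P0 //.
Qed.

Lemma integrable_indic_cc (a b k : R) :
  mu.-integrable setT (EFin \o (fun x => k * \1_(`[a, b]%classic : set R) x)).
Proof.
have h := @integrable_indic_itv R a b true false.
by apply: eq_integrable (integrableZl measurableT k h).
Qed.

(* The right-hand side below is again nonincreasing; it dominates
   [Psi `|a * x + b|] when [S] is [2 * `|b| / a] and [r] is [a / 2]. *)
Definition dilate_env (Psi : R -> R) (r S x : R) : R :=
  if x < S then Psi 0 else Psi (r * x).

Lemma envelope_dilate Psi r S : envelope Psi -> 0 < r ->
  envelope (dilate_env Psi r S).
Proof.
move=> eP r0; have mP := measurable_envelope eP.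
have iP := envelope_integrable eP; case: (eP) => P0 Pd _.
have d0 x : 0 <= x -> 0 <= dilate_env Psi r S x.
  by move=> x0; rewrite /dilate_env; case: ifPn => _; apply: P0 => //; rewrite mulr_ge0 // ltW.
have dd x y : 0 <= x -> x <= y -> dilate_env Psi r S y <= dilate_env Psi r S x.
  move=> x0 xy; rewrite /dilate_env; have [yS|yS] := ltP y S.
    by rewrite (le_lt_trans xy).
  have ry : 0 <= r * x by rewrite mulr_ge0 // ltW.
  case: ifPn => xS; apply: Pd => //; last by rewrite ler_pM2l.
  by rewrite (le_trans ry) // ler_pM2l.
split => //.
(* Integrable majorant: the plateau on [-S, S] plus the dilate of Psi on the whole line. *)
pose H x := Psi 0 * \1_(`[- S, S]%classic : set R) x + Psi `|r * x + 0|.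
have iH : mu.-integrable setT (EFin \o H).
  have := integrableD measurableT (integrable_indic_cc (- S) S (Psi 0))
    (integrable_affine 0 r0 iP).
  by apply: eq_integrable => // x _ /=; rewrite EFinD.
case/integrableP: iH => mH; apply: le_lt_trans.
apply: ge0_le_integral => //.
- by move=> x _; rewrite lee_fin d0.
- apply/measurable_EFinP.
  have -> : (fun x : R => dilate_env Psi r S `|x|) =
      (fun x => dilate_env Psi r S (Order.max x 0)) \o (fun x => `|x|).
    by apply/funext => x /=; rewrite max_l.
  apply: measurableT_comp; last exact: normr_measurable.
  apply: nonincreasing_measurable => // x y xy.
  by apply: dd; [rewrite le_max lexx orbT|rewrite ge_max !le_max xy lexx !orbT].
- exact: measurableT_comp.
- move=> x _; rewrite lee_fin; apply: le_trans (ler_norm _).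
  rewrite /dilate_env /H addr0 indicE; case: ifPn => xS.
    by rewrite mem_set ?mulr1 ?lerDl ?P0 //= in_itv /= -ler_norml ltW.
  by rewrite normrM (gtr0_norm r0) lerDr mulr_ge0 ?P0.
Qed.

Lemma dilate_env_affine Psi a b x : envelope Psi -> 0 < a ->
  Psi `|a * x + b| <= dilate_env Psi (a / 2) (2 * `|b| / a) `|x|.
Proof.
move=> [P0 Pd _] a0; rewrite /dilate_env; case: ifPn => xS; first exact: Pd.
apply: Pd; first by rewrite mulr_ge0 // divr_ge0 // ltW.
move: xS; rewrite -leNgt ler_pdivrMr // => xS.
have := ler_normB (a * x + b) b; rewrite addrK normrM (gtr0_norm a0); lra.
Qed.

(** Integral test on unit intervals; it compares from m = 1 on, hence the separate term [Psi 0]. *)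
Lemma envelope_sum_bound Psi : envelope Psi ->
  exists M, forall N, \sum_(0 <= m < N) Psi m%:R <= M.
Proof.
move=> eP; have mP := measurable_envelope eP; case: (eP) => P0 Pd iP.
have P0' x : (0 <= (Psi `|x|)%:E)%E by rewrite lee_fin P0.
pose I := (\int[mu]_x (Psi `|x|)%:E)%E.
have I0 : (0 <= I)%E by exact: integral_ge0.
exists (Psi 0 + fine I) => N.
suff h : forall n, ((\sum_(0 <= m < n) Psi m.+1%:R)%:E <=
    \int[mu]_(x in `[0%R, n%:R[) (Psi `|x|)%:E)%E.
  case: N => [|N]; first by rewrite big_geq // addr_ge0 ?P0 ?fine_ge0.
  rewrite big_nat_recl // lerD2l -lee_fin fineK ?ge0_fin_numE //.
  apply: le_trans (h N) _; apply: ge0_subset_integral => //.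
  exact/measurable_EFinP.
elim=> [|n IH]; first by rewrite big_geq // integral_ge0.
rewrite big_nat_recr //= EFinD.
have -> : `[0, n.+1%:R[%classic = `[0, n%:R[%classic `|` `[n%:R, n.+1%:R[%classic :> set R.
  apply/seteqP; split => x /=; rewrite !in_itv /=.
    by move=> /andP[x0 xn]; have [|] := ltP x n%:R; [left|right]; rewrite ?x0.
  case=> /andP[x0 xn]; rewrite ?x0 /=; first by rewrite (lt_trans xn) // ltr_nat.
  by rewrite (le_trans _ x0) // xn.
rewrite ge0_integral_setU //=; last 2 first.
- by apply: measurable_funTS; exact/measurable_EFinP.
- apply/disj_setPS => x [/=]; rewrite !in_itv /= => /andP[_ xn] /andP[nx _].
  by move: xn; rewrite ltNge nx.
apply: leeD => //.
apply: (@le_trans _ _ (\int[mu]_(x in `[n%:R, n.+1%:R[) (Psi n.+1%:R)%:E)%E).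
  rewrite integral_cst //= lebesgue_measure_itv /= lte_fin ltr_nat ltnSn.
  by rewrite -EFinB -natrB // subSnn mule1.
apply: ge0_le_integral => //.
- by move=> x _; rewrite lee_fin P0.
- by apply: measurable_funTS; exact/measurable_EFinP.
- move=> x /=; rewrite in_itv /= => /andP[nx xn].
  have x0 : 0 <= x by rewrite (le_trans _ nx).
  by rewrite lee_fin ger0_norm // Pd // ltW.
Qed.

Lemma envelope_lattice Psi : envelope Psi ->
  exists M, forall x K, sum_abs_le K (fun k => Psi `|x - k%:~R|) <= M.
Proof.
move=> eP; have [M hM] := envelope_sum_bound eP; case: eP => P0 Pd _.
by exists (2 * M) => x K; exact: sum_abs_le_lattice.
Qed.

End envelope.

Section trigonometric_periods.
Context {R : realType}.

Lemma cos_sin_2pi_int (k : int) :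
  cos (2 * pi * k%:~R) = 1 :> R /\ sin (2 * pi * k%:~R) = 0 :> R.
Proof.
have h (n : nat) : cos (2 * pi * n%:R) = 1 :> R /\ sin (2 * pi * n%:R) = 0 :> R.
  elim: n => [|n [IHc IHs]]; first by rewrite mulr0 cos0 sin0.
  have -> : 2 * pi * n.+1%:R = 2 * pi * n%:R + pi *+ 2 :> R.
    by rewrite -[n.+1]addn1 natrD mulr2n; ring.
  by rewrite cosD2pi sinD2pi.
case: k => n; first exact: h.
have [hc hs] := h n.+1.
by rewrite NegzE intrN mulrN cosN sinN hc hs oppr0.
Qed.

Lemma cosD2piZ (x : R) (k : int) : cos (x + 2 * pi * k%:~R) = cos x.
Proof. by have [c s] := cos_sin_2pi_int k; rewrite cosD c s mulr1 mulr0 subr0. Qed.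

Lemma sinD2piZ (x : R) (k : int) : sin (x + 2 * pi * k%:~R) = sin x.
Proof. by have [c s] := cos_sin_2pi_int k; rewrite sinD c s mulr1 mulr0 addr0. Qed.

End trigonometric_periods.

(** * Periodizations of continuous functions with integrable majorants *)

Section enveloped.
Context {R : realType}.
Local Notation mu := (@lebesgue_measure R).
Implicit Types (G T : R -> R).

Definition enveloped G : Prop :=
  continuous G /\ exists2 Psi, envelope Psi & forall x, `|G x| <= Psi `|x|.

Lemma envelopeD Psi Xi : @envelope R Psi -> envelope Xi ->
  envelope (fun x => Psi x + Xi x).
Proof.
move=> eP eX; have [P0 Pd _] := eP; have [X0 Xd _] := eX; split.
- by move=> x x0; rewrite addr_ge0 ?P0 ?X0.
- by move=> x y x0 xy; rewrite lerD ?Pd ?Xd.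
- have /integrableP[_] := integrableD measurableT (envelope_integrable eP)
    (envelope_integrable eX).
  apply: le_lt_trans; rewrite le_eqVlt; apply/orP; left; apply/eqP.
  apply: eq_integral => x _ /=; rewrite [`|_ + _|]ger0_norm //.
  by rewrite addr_ge0 ?P0 ?X0.
Qed.

Lemma envelopeZ (a : R) Psi : 0 <= a -> envelope Psi -> envelope (fun x => a * Psi x).
Proof.
move=> a0 eP; have [P0 Pd _] := eP; split.
- by move=> x x0; rewrite mulr_ge0 ?P0.
- by move=> x y x0 xy; rewrite ler_wpM2l ?Pd.
- have /integrableP[_] := integrableZl measurableT a (envelope_integrable eP).
  apply: le_lt_trans; rewrite le_eqVlt; apply/orP; left; apply/eqP.
  apply: eq_integral => x _ /=; rewrite [`|_ * _|]ger0_norm //.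
  by rewrite mulr_ge0 ?P0.
Qed.

Lemma enveloped_integrable G : enveloped G -> mu.-integrable setT (EFin \o G).
Proof.
move=> [cG [Psi eP GP]]; apply: le_integrable (envelope_integrable eP) => //.
  by apply/measurable_EFinP; exact: continuous_measurable_fun.
move=> x _ /=; rewrite lee_fin (le_trans (GP x)) // ler_norm.
by [].
Qed.

Lemma envelopedD G H : enveloped G -> enveloped H -> enveloped (fun x => G x + H x).
Proof.
move=> [cG [Psi eP GP]] [cH [Xi eX HX]]; split.
  by move=> x; apply: cvgD; [exact: cG|exact: cH].
exists (fun x => Psi x + Xi x); first exact: envelopeD.
by move=> x; rewrite (le_trans (ler_normD _ _)) // lerD.
Qed.

Lemma envelopedM G T (M : R) : enveloped G -> continuous T -> (forall x, `|T x| <= M) ->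
  enveloped (fun x => G x * T x).
Proof.
move=> [cG [Psi eP GP]] cT TM; split.
  by move=> x; apply: cvgM; [exact: cG|exact: cT].
have M0 : 0 <= M by apply: le_trans (TM 0).
exists (fun x => M * Psi x); first exact: envelopeZ.
by move=> x; rewrite normrM mulrC ler_pM.
Qed.

Lemma envelopedZ (a : R) G : enveloped G -> enveloped (fun x => a * G x).
Proof.
move=> eG; have := envelopedM (T := cst a) (M := `|a|) eG.
under [X in _ -> enveloped X]eq_fun do rewrite mulrC.
by apply=> // x; exact: cvg_cst.
Qed.

Lemma envelopedN G : enveloped G -> enveloped (fun x => - G x).
Proof. by move=> /(envelopedZ (-1)); under eq_fun do rewrite mulN1r. Qed.

Lemma enveloped_affine G a b : 0 < a -> enveloped G ->
  enveloped (fun x => G (a * x + b)).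
Proof.
move=> a0 [cG [Psi eP GP]]; split.
  move=> x; apply: (cvg_continuous_comp cG).
  by apply: cvgD; [apply: cvgMl_tmp; exact: cvg_id|exact: cvg_cst].
exists (dilate_env Psi (a / 2) (2 * `|b| / a)).
  by apply: envelope_dilate => //; rewrite divr_gt0.
by move=> x; apply: le_trans (GP _) _; exact: dilate_env_affine.
Qed.

Definition per G (s : R) : R := zsum (fun k : int => G (s - k%:~R)).

Lemma enveloped_sum_bound G : enveloped G ->
  exists M, forall s K, sum_abs_le K (fun k => `|G (s - k%:~R)|) <= M.
Proof.
move=> [_ [Psi eP GP]]; have [M hM] := envelope_lattice eP.
by exists M => s K; apply: le_trans (hM s K); exact: ler_sum_abs_le.
Qed.

Lemma per_summable G s : enveloped G -> zsummable (fun k => G (s - k%:~R)).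
Proof. by move=> /enveloped_sum_bound[M hM]; exists M. Qed.

(** If |s| <= S and |k| >= 2 S then |s - k| >= |k| / 2. One summable sequence thus dominates for all
    s in a bounded set, and the periodization is continuous by Tannery's theorem. *)
Lemma enveloped_local_majorant G (S : R) : enveloped G -> 0 <= S ->
  exists2 h : int -> R, zsummable h &
    forall s, `|s| <= S -> forall k, `|G (s - k%:~R)| <= h k.
Proof.
move=> [_ [Psi eP GP]] S0.
have eD : envelope (dilate_env Psi (1 / 2) (2 * S)).
  by apply: envelope_dilate => //; rewrite divr_gt0.
have [M hM] := envelope_lattice eD; have [D0 _ _] := eD; have [P0 Pd _] := eP.
exists (fun k => dilate_env Psi (1 / 2) (2 * S) `|0 - k%:~R|).
  exists M => K; apply: le_trans (hM 0 K); apply: ler_sum_abs_le => k.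
  by rewrite ger0_norm // D0.
move=> s sS k; apply: le_trans (GP _) _; rewrite sub0r normrN /dilate_env.
case: ifPn => [_|]; first exact: Pd.
rewrite -leNgt => h; apply: Pd; first by rewrite mulr_ge0.
by have := ler_normB (s - k%:~R) s; rewrite addrAC subrr add0r normrN; lra.
Qed.

Lemma per_continuous G : enveloped G -> continuous (per G).
Proof.
move=> eG s0; have S0 : 0 <= `|s0| + 1 by rewrite addr_ge0.
have [h sh hG] := enveloped_local_majorant eG S0.
apply: (@zsum_dominated_cvg _ _ (nbhs s0) _ (fun s (k : int) => G (s - k%:~R))
  (fun k => G (s0 - k%:~R)) h sh).
  near=> s; apply: hG.
  have : `|s - s0| < 1 by near: s; apply: cvgr_distC_lt => //; exact: cvg_id.
  by have := ler_normD (s - s0) s0; rewrite subrK; lra.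
move=> k; case: eG => cG _; apply: (cvg_continuous_comp cG).
by apply: cvgB; [exact: cvg_id|exact: cvg_cst].
Unshelve. all: by end_near. Qed.

Lemma sum_abs_le_delta (K : nat) (k0 : int) :
  sum_abs_le K (fun k => (k == k0)%:R) = (`|k0| <= K)%N%:R :> R.
Proof.
elim: K => [|K IH]; first by rewrite sum_abs_le0; congr (nat_of_bool _)%:R; lia.
rewrite sum_abs_leS IH -!natrD; congr (_%:R).
have [|] := eqVneq (K.+1%:Z) k0; have [|] := eqVneq (- K.+1%:Z) k0; lia.
Qed.

Lemma Rintegral_sum_abs_le (D : set (measurableTypeR R)) (H : int -> R -> R) K :
  measurable D ->
  (forall k, mu.-integrable D (EFin \o H k)) ->
  \int[mu]_(x in D) sum_abs_le K (fun k => H k x) =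
  sum_abs_le K (fun k => \int[mu]_(x in D) H k x) /\
  mu.-integrable D (EFin \o (fun x => sum_abs_le K (fun k => H k x))).
Proof.
move=> mD iH; elim: K => [|K [IH iS]].
  under eq_Rintegral do rewrite sum_abs_le0.
  rewrite sum_abs_le0; split => //.
  by apply: eq_integrable (iH 0) => // x _ /=; rewrite sum_abs_le0.
have iS1 := integrableD mD iS (iH K.+1%:Z).
have iS2 := integrableD mD iS1 (iH (- K.+1%:Z)).
split; last first.
  by apply: eq_integrable iS2 => // x _ /=; rewrite sum_abs_leS !EFinD.
under eq_Rintegral do rewrite sum_abs_leS.
by rewrite sum_abs_leS -IH RintegralD // RintegralD.
Qed.

(** By translation, the integral of the truncated sum of F (s - k) on the interval equals that of F
    on the union of the corresponding translates of the interval; both sides pass to the limit by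
    dominated convergence. *)
Lemma integral_unfold G T (M : R) a : enveloped G -> continuous T ->
  (forall x, `|T x| <= M) -> (forall x (k : int), T (x - k%:~R) = T x) ->
  \int[mu]_(s in `[a, a + 1[) (per G s * T s) = \int[mu]_x (G x * T x).
Proof.
move=> eG cT TM perT.
pose I : set R := `[a, a + 1[%classic.
have mI : measurable I by exact: measurable_itv.
have inI x : (x \in I) = (a <= x < a + 1).
  by apply/idP/idP; rewrite inE /I /= in_itv.
have eF := envelopedM eG cT TM.
have iF := enveloped_integrable eF.
set F := (fun x => G x * T x) in eF iF *.
have mF : measurable_fun [set: R] F.
  by apply: continuous_measurable_fun; case: eF.
have [B hB] := enveloped_sum_bound eF.
have i01 x : 0 <= (\1_I x : R) <= 1 by rewrite indicE; case: (_ \in _); rewrite ?lexx ?ler01.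
have iI k : mu.-integrable setT (EFin \o (fun s => F s * \1_I (s + k%:~R))).
  apply: le_integrable iF => //.
    apply/measurable_EFinP; apply: measurable_funM => //.
    apply: measurableT_comp; first exact: measurable_indic.
    by apply: measurable_funD => //; exact: measurable_cst.
  move=> x _ /=; rewrite lee_fin normrM ler_piMr //.
  by have /andP[h0 h1] := i01 (x + k%:~R); rewrite ger0_norm.
pose u K s := sum_abs_le K (fun k => F (s - k%:~R) * \1_I s).
pose w K s := sum_abs_le K (fun k => F s * \1_I (s + k%:~R)).
have uw K : \int[mu]_s u K s = \int[mu]_s w K s.
  have iF' k : mu.-integrable setT (EFin \o (fun s => F (s - k%:~R) * \1_I s)).
    have := integrable_affine (- k%:~R) ltr01 (iI k).
    by apply: eq_integrable => // x _ /=; rewrite mul1r subrK.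
  have [-> _] := Rintegral_sum_abs_le K measurableT iF'.
  have [-> _] := Rintegral_sum_abs_le K measurableT iI.
  apply: eq_sum_abs_le => k.
  have := Rintegral_affine (- k%:~R) ltr01 (iI k).
  rewrite invr1 mul1r => <-.
  by apply: eq_Rintegral => x _; rewrite mul1r subrK.
(* Exactly one integer translate of s lies in [a, a + 1[, so the truncated sum of indicators is 0 or
   1. *)
have wE s : exists k0 : int, forall K, w K s = F s * (`|k0| <= K)%N%:R.
  exists (Num.ceil (a - s)) => K.
  rewrite -sum_abs_le_delta -sum_abs_leZ; apply: eq_sum_abs_le => k; congr (_ * _).
  have /andP[h1 h2] := ceil_itv (a - s).
  rewrite intrB in h1.
  rewrite indicE inI; congr (nat_of_bool _)%:R; apply/idP/eqP.
    move=> /andP[ak ka]; apply/esym/ceil_def; rewrite intrB.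
    by apply/andP; split; lra.
  by move=> ->; apply/andP; split; lra.
have wcvg : \int[mu]_s w K s @[K --> \oo] --> \int[mu]_s F s.
  apply: (@Rdominated_cvg _ _ _ mu setT measurableT w F (fun s => `|F s|)) => //.
  - by move=> K; have [_ /(measurable_int mu) /measurable_EFinP] :=
      Rintegral_sum_abs_le K measurableT iI.
  - move=> s _; have [k0 hk0] := wE s; apply: cvg_near_cst; near=> K.
    rewrite hk0 (_ : (`|k0| <= K)%N = true) ?mulr1 //.
    by near: K; exact: nbhs_infty_ge.
  - exact: integrable_norm.
  - move=> K s _; have [k0 ->] := wE s; rewrite normrM ler_piMr //.
    by case: (_ <= _)%N; rewrite ?normr1 ?normr0.
have ucvg : \int[mu]_s u K s @[K --> \oo] --> \int[mu]_s (per G s * T s * \1_I s).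
  apply: (@Rdominated_cvg _ _ _ mu setT measurableT u _
    (fun s => B * \1_(`[a, a + 1]%classic : set R) s)) => //.
  - move=> K; have iF' k : mu.-integrable setT
        (EFin \o (fun s => F (s - k%:~R) * \1_I s)).
      have := integrable_affine (- k%:~R) ltr01 (iI k).
      by apply: eq_integrable => // x _ /=; rewrite mul1r subrK.
    by have [_ /(measurable_int mu) /measurable_EFinP] := Rintegral_sum_abs_le K measurableT iF'.
  - move=> s _; have -> : u^~ s = fun K => sum_abs_le K (fun k => G (s - k%:~R)) * T s * \1_I s.
      apply/funext => K; rewrite -mulrA mulrC -sum_abs_leZ; apply: eq_sum_abs_le => k.
      by rewrite (_ : F _ = G (s - k%:~R) * T s); [ring|rewrite /F perT].
    apply: cvgMr_tmp; apply: cvgMr_tmp; apply: zsum_cvg; exact: per_summable.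
  - exact: integrable_indic_cc.
  - move=> K s _; apply: le_trans (ler_norm_sum_abs_le _ _) _.
    have sI : sum_abs_le K (fun k => `|F (s - k%:~R) * \1_I s|) =
        \1_I s * sum_abs_le K (fun k => `|F (s - k%:~R)|).
      rewrite -sum_abs_leZ; apply: eq_sum_abs_le => k.
      by rewrite normrM mulrC; have /andP[h0 _] := i01 s; rewrite (ger0_norm h0).
    rewrite sI mulrC; apply: ler_pM.
    + by apply: sum_abs_le_ge0 => k.
    + by have /andP[] := i01 s.
    + exact: hB.
    + rewrite indicE inI; have [/andP[s1 s2]|_] := boolP (a <= s < a + 1).
        by rewrite indicE mem_set //= in_itv /= s1 ltW.
      by rewrite indicE; case: (_ \in _).
have uE : (fun K => \int[mu]_s u K s) = (fun K => \int[mu]_s w K s).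
  by apply/funext => K; exact: uw.
rewrite uE in ucvg.
have <- : \int[mu]_s (per G s * T s * \1_I s) = \int[mu]_s F s.
  by rewrite -(cvg_lim _ ucvg) //; exact/cvg_lim.
rewrite Rintegral_mkcond; apply: eq_Rintegral => x _.
by rewrite patchE indicE; case: ifPn => _; rewrite ?mulr1 ?mulr0.
Unshelve. all: by end_near. Qed.

End enveloped.

(** * Vanishing Fourier coefficients force a vanishing periodization *)

Section periodization_uniqueness.
Context {R : realType}.
Local Notation mu := (@lebesgue_measure R).
Implicit Types (G T : R -> R) (m k : int).

Lemma continuous_cos_lin (a : R) : continuous (fun s : R => cos (a * s)).
Proof.
move=> s; apply: (cvg_continuous_comp (@continuous_cos R)).
by apply: cvgMl_tmp; exact: cvg_id.
Qed.

Lemma continuous_sin_lin (a : R) : continuous (fun s : R => sin (a * s)).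
Proof.
move=> s; apply: (cvg_continuous_comp (@continuous_sin R)).
by apply: cvgMl_tmp; exact: cvg_id.
Qed.

Lemma enveloped_cos G a : enveloped G -> enveloped (fun s => G s * cos (a * s)).
Proof.
move=> eG; apply: (envelopedM (M := 1) eG); first exact: continuous_cos_lin.
by move=> x; exact: cos_max.
Qed.

Lemma enveloped_sin G a : enveloped G -> enveloped (fun s => G s * sin (a * s)).
Proof.
move=> eG; apply: (envelopedM (M := 1) eG); first exact: continuous_sin_lin.
by move=> x; exact: sin_max.
Qed.

(** By [integral_unfold], these are the Fourier coefficients of the periodization of G, written on
    the line. *)
Definition moments0 G : Prop := forall m,
  \int[mu]_s (G s * cos (2 * pi * m%:~R * s)) = 0 /\
  \int[mu]_s (G s * sin (2 * pi * m%:~R * s)) = 0.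

Lemma Rintegral_lin2 G H (a b : R) : enveloped G -> enveloped H ->
  \int[mu]_s (a * G s + b * H s) = a * \int[mu]_s G s + b * \int[mu]_s H s.
Proof.
move=> eG eH; have iG := enveloped_integrable eG.
have iH := enveloped_integrable eH.
rewrite RintegralD //; last 2 first.
- exact: enveloped_integrable (envelopedZ a eG).
- exact: enveloped_integrable (envelopedZ b eH).
by rewrite !RintegralZl.
Qed.

Lemma moments0_lin G H (a b : R) : enveloped G -> enveloped H ->
  moments0 G -> moments0 H -> moments0 (fun s => a * G s + b * H s).
Proof.
move=> eG eH G0 H0 m; have [Gc Gs] := G0 m; have [Hc Hs] := H0 m.
have ec E (eE : enveloped E) := enveloped_cos (2 * pi * m%:~R) eE.
have es E (eE : enveloped E) := enveloped_sin (2 * pi * m%:~R) eE.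
split.
- rewrite [LHS](_ : _ = \int[mu]_s (a * (G s * cos (2 * pi * m%:~R * s)) +
      b * (H s * cos (2 * pi * m%:~R * s)))).
    by rewrite Rintegral_lin2 ?Gc ?Hc ?mulr0 ?addr0 //; exact: ec.
  by apply: eq_Rintegral => s _; ring.
- rewrite [LHS](_ : _ = \int[mu]_s (a * (G s * sin (2 * pi * m%:~R * s)) +
      b * (H s * sin (2 * pi * m%:~R * s)))).
    by rewrite Rintegral_lin2 ?Gs ?Hs ?mulr0 ?addr0 //; exact: es.
  by apply: eq_Rintegral => s _; ring.
Qed.

(** The product formulas express a moment of the modulated function by the moments of G at m + 1 and
    m - 1. *)
Lemma moments0_trig G : enveloped G -> moments0 G ->
  moments0 (fun s => G s * cos (2 * pi * s)) /\
  moments0 (fun s => G s * sin (2 * pi * s)).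
Proof.
move=> eG G0.
have D m s : 2 * pi * (m + 1)%:~R * s = 2 * pi * m%:~R * s + 2 * pi * s :> R.
  by rewrite intrD; ring.
have B m s : 2 * pi * (m - 1)%:~R * s = 2 * pi * m%:~R * s - 2 * pi * s :> R.
  by rewrite intrB; ring.
have ec m := enveloped_cos (2 * pi * m%:~R) eG.
have es m := enveloped_sin (2 * pi * m%:~R) eG.
split=> m; have [c1 s1] := G0 (m + 1); have [c2 s2] := G0 (m - 1); split.
- rewrite [LHS](_ : _ = \int[mu]_s (2^-1 * (G s * cos (2 * pi * (m + 1)%:~R * s)) +
     2^-1 * (G s * cos (2 * pi * (m - 1)%:~R * s)))).
    by rewrite Rintegral_lin2 // c1 c2 !mulr0 addr0.
  by apply: eq_Rintegral => s _; rewrite D B cosB cosD; field.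
- rewrite [LHS](_ : _ = \int[mu]_s (2^-1 * (G s * sin (2 * pi * (m + 1)%:~R * s)) +
     2^-1 * (G s * sin (2 * pi * (m - 1)%:~R * s)))).
    by rewrite Rintegral_lin2 // s1 s2 !mulr0 addr0.
  by apply: eq_Rintegral => s _; rewrite D B sinB sinD; field.
- rewrite [LHS](_ : _ = \int[mu]_s (2^-1 * (G s * sin (2 * pi * (m + 1)%:~R * s)) +
     (- 2^-1) * (G s * sin (2 * pi * (m - 1)%:~R * s)))).
    by rewrite Rintegral_lin2 // s1 s2 !mulr0 addr0.
  by apply: eq_Rintegral => s _; rewrite D B sinB sinD; field.
- rewrite [LHS](_ : _ = \int[mu]_s (2^-1 * (G s * cos (2 * pi * (m - 1)%:~R * s)) +
     (- 2^-1) * (G s * cos (2 * pi * (m + 1)%:~R * s)))).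
    by rewrite Rintegral_lin2 // c1 c2 !mulr0 addr0.
  by apply: eq_Rintegral => s _; rewrite D B cosB cosD; field.
Qed.

(* If [per G s0 > 0], the integral of [per G] against a high power of [peak],
   which exceeds 1 near [s0] and is at most 1 in absolute value elsewhere on a
   period, is positive; but it is a combination of Fourier coefficients. *)
Let peak (s0 dl s : R) := 1 + cos (2 * pi * (s - s0)) - cos (2 * pi * dl).

Let peak_continuous s0 dl : continuous (peak s0 dl).
Proof.
move=> s; apply: cvgB; last exact: cvg_cst.
apply: cvgD; first exact: cvg_cst.
apply: (cvg_continuous_comp (@continuous_cos R)); apply: cvgMl_tmp.
by apply: cvgB; [exact: cvg_id|exact: cvg_cst].
Qed.

Let peak_max s0 dl s : `|peak s0 dl s| <= 3.
Proof.
have := cos_max (2 * pi * (s - s0)); have := cos_max (2 * pi * dl).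
by rewrite /peak !ler_norml => /andP[? ?] /andP[? ?]; apply/andP; split; lra.
Qed.

Let enveloped_peak G s0 dl N : enveloped G ->
  enveloped (fun s => G s * peak s0 dl s ^+ N).
Proof.
move=> eG; apply: (envelopedM (M := 3 ^+ N) eG).
  move=> s; have := @exprn_continuous R N (peak s0 dl s).
  by move=> h; exact: (cvg_comp (peak s0 dl) _ (@peak_continuous s0 dl s) h).
by move=> s; rewrite normrX lerXn2r ?nnegrE // peak_max.
Qed.

(** [peak] is a trigonometric polynomial of degree 1, so each further factor stays within
    [moments0_trig]. *)
Let moments0_peak G s0 dl N : enveloped G -> moments0 G ->
  moments0 (fun s => G s * peak s0 dl s ^+ N).
Proof.
move=> eG G0; elim: N => [|N IH].
  by under [X in moments0 X]eq_fun do rewrite expr0 mulr1.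
have eN := enveloped_peak s0 dl N eG.
have [hc hs] := moments0_trig eN IH.
have ec := enveloped_cos (2 * pi) eN; have es := enveloped_sin (2 * pi) eN.
have h1 := moments0_lin (cos (2 * pi * s0)) (sin (2 * pi * s0)) ec es hc hs.
have e1 := envelopedD (envelopedZ (cos (2 * pi * s0)) ec)
  (envelopedZ (sin (2 * pi * s0)) es).
have := moments0_lin (1 - cos (2 * pi * dl)) 1 eN e1 IH h1.
rewrite [X in moments0 X -> _](_ : _ = (fun s => G s * peak s0 dl s ^+ N.+1)) //.
apply/funext => s; rewrite exprSr /peak mulrBr cosB; ring.
Qed.

Lemma per_eq0 G : enveloped G -> moments0 G -> forall s, per G s = 0.
Proof.
(* The hypotheses are invariant under change of sign, so the upper bound alone suffices. *)
suff h G' s0 : enveloped G' -> moments0 G' -> per G' s0 <= 0.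
  move=> eG G0 s; apply/eqP; rewrite eq_le h //=.
  have := h (fun x => - G x) s (envelopedN eG).
  have -> : per (fun x => - G x) s = - per G s.
    rewrite -mulN1r -zsumZ; last exact: per_summable.
    by rewrite /per; congr zsum; apply/funext => k; rewrite mulN1r.
  rewrite oppr_le0; apply.
  have := moments0_lin (-1) 0 eG eG G0 G0.
  by under [X in moments0 X -> _]eq_fun do rewrite mulN1r mul0r addr0.
move=> eG G0; rewrite leNgt; apply/negP => H0.
set h0 := per G' s0 in H0.
have [M hM] := enveloped_sum_bound eG.
have MH s : `|per G' s| <= M by apply: ler_norm_zsum; exact: hM.
have M0 : 0 <= M by apply: le_trans (MH 0).
have cH : continuous (per G') := per_continuous eG.
have /cvgrPdist_lt /(_ (h0 / 2)) := cH s0.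
rewrite divr_gt0 // => /(_ isT)[d1 /= d10 hd1].
(* Below d1, the periodization stays above h0 / 2 within dl of s0; with the bound 1 / 8, the angle 2
   pi dl stays where the cosine decreases. *)
pose dl := Order.min (d1 / 2) (1 / 8).
have dl0 : 0 < dl by rewrite lt_min !divr_gt0.
have dl8 : dl <= 1 / 8 by rewrite ge_min lexx orbT.
have dld1 : dl < d1.
  have : dl <= d1 / 2 by rewrite ge_min lexx.
  lra.
have pi0 := pi_gt0 R.
have Hd s : `|s - s0| <= dl -> h0 / 2 <= per G' s.
  move=> sd; have := hd1 s; rewrite /ball_ /= distrC.
  move=> /(_ (le_lt_trans sd dld1)); rewrite -/h0 ltr_norml => /andP[? ?]; lra.
have rg (x : R) : 0 <= x -> x <= 1 / 2 -> 2 * pi * x \in `[0, pi].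
  move=> x0 x2; rewrite in_itv /=; apply/andP; split.
    by rewrite !mulr_ge0 //; exact: ltW.
  by have := ler_wpM2l (ltW pi0) x2; lra.
have pl (x y : R) : x < y -> 2 * pi * x < 2 * pi * y.
  by move=> xy; rewrite ltr_pM2l // mulr_gt0.
have dl2 : dl <= 1 / 2 by lra.
have Rdl := rg dl (ltW dl0) dl2.
have Edl : pi * dl = 2 * pi * (dl / 2) by field.
(* The excess of [peak] over 1 within dl / 2 of s0; by Bernoulli its powers grow at least linearly
   there. *)
pose et := cos (pi * dl) - cos (2 * pi * dl).
have et0 : 0 < et.
  rewrite /et Edl subr_gt0 ltr_cos //; first by apply: pl; lra.
  by apply: rg; lra.
have cosN s : cos (2 * pi * (s - s0)) = cos (2 * pi * `|s - s0|).
  by rewrite -[LHS]cos_norm !normrM (ger0_norm (ltW pi0)) (ger0_norm (ler0n _ 2)).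
have far s : dl <= `|s - s0| -> `|s - s0| <= 1 / 2 -> `|peak s0 dl s| <= 1.
  move=> ds s2; have : cos (2 * pi * `|s - s0|) <= cos (2 * pi * dl).
    move: ds; rewrite le_eqVlt => /orP[/eqP <- //|ds].
    by apply: ltW; rewrite ltr_cos //; [exact: pl|exact: rg].
  rewrite /peak cosN; have := cos_geN1 (2 * pi * `|s - s0|).
  have := cos_le1 (2 * pi * dl).
  by rewrite ler_norml => *; apply/andP; split; lra.
have near1 s : `|s - s0| <= dl -> 1 <= peak s0 dl s.
  rewrite le_eqVlt /peak cosN => /orP[/eqP -> |ds]; first by lra.
  have : cos (2 * pi * dl) < cos (2 * pi * `|s - s0|).
    by rewrite ltr_cos //; [exact: pl|apply: rg => //; lra].
  lra.
have near2 s : `|s - s0| <= dl / 2 -> 1 + et <= peak s0 dl s.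
  rewrite le_eqVlt /peak cosN /et => /orP[/eqP -> |ds].
    by rewrite Edl; lra.
  have : cos (pi * dl) < cos (2 * pi * `|s - s0|).
    by rewrite Edl ltr_cos //; [exact: pl|apply: rg => //; lra|apply: rg; lra].
  lra.
have bern N : 1 + N%:R * et <= (1 + et) ^+ N.
  elim: N => [|N IH]; first by rewrite mul0r addr0 expr0.
  rewrite exprS -[N.+1]addn1 natrD.
  have := ler_wpM2l (_ : 0 <= 1 + et) IH.
  have : 0 <= N%:R * et * et by rewrite !mulr_ge0 // ltW.
  by move=> ? /(_ (ltW (addr_gt0 ltr01 et0))) ?; lra.
pose I : set R := `[s0 - 1 / 2, s0 - 1 / 2 + 1[%classic.
pose J : set R := `[s0 - dl / 2, s0 + dl / 2]%classic.
have mI : measurable I by exact: measurable_itv.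
have mJ : measurable J by exact: measurable_itv.
have muI : (mu I = 1)%E.
  rewrite /I lebesgue_measure_itv /= lte_fin ltrDl ltr01 -EFinB.
  by congr EFin; ring.
have JI : J `<=` I.
  by move=> s; rewrite /J /I /= !in_itv /= => /andP[? ?]; apply/andP; split; lra.
have muJ : (mu J = dl%:E)%E.
  rewrite /J lebesgue_measure_itv /= lte_fin -EFinB ifT; last by lra.
  by congr EFin; field.
have iJ (b : R) : mu.-integrable I (EFin \o (fun s => b * \1_J s)).
  exact: integrableS (integrable_indic_cc _ _ b).
have iM : mu.-integrable I (EFin \o (fun _ => M)).
  apply: measurable_bounded_integrable => //; first by rewrite [X in (X < _)%E]muI ltry.
  by exists `|M|; split; [exact: num_real|by move=> ? ? ? _ /=; exact: ltW].
(* The integral against the N-th power is 0, yet the integrand is at least h0 / 2 (1 + N et) on J,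
   of length dl, and at least - M on the rest of a period of length 1. Large N gives the
   contradiction. *)
have key N : h0 / 2 * (1 + N%:R * et) * dl - M <= 0.
  set b := h0 / 2 * (1 + N%:R * et).
  have b0 : 0 <= b by rewrite mulr_ge0 ?divr_ge0 ?addr_ge0 ?mulr_ge0 // ltW.
  have ePN : enveloped (fun s => G' s * peak s0 dl s ^+ N) by exact: enveloped_peak.
  have cpN : continuous (fun s => peak s0 dl s ^+ N).
    move=> s; have h := @exprn_continuous R N (peak s0 dl s).
    exact: (cvg_comp (peak s0 dl) _ (@peak_continuous s0 dl s) h).
  have <- : \int[mu]_(s in I) (per G' s * peak s0 dl s ^+ N) = 0.
    rewrite (integral_unfold (M := 3 ^+ N)) //.
    - have [+ _] := moments0_peak s0 dl N eG G0 0.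
      by under eq_Rintegral do rewrite mulr0 mul0r cos0 mulr1.
    - by move=> s; rewrite normrX lerXn2r ?nnegrE // peak_max.
    - move=> s k; congr (_ ^+ N); rewrite /peak; congr (1 + _ - _).
      rewrite -[RHS](@cosD2piZ _ _ (- k)); congr cos; rewrite rmorphN /=; ring.
  have -> : b * dl - M = \int[mu]_(s in I) (b * \1_J s - M).
    rewrite RintegralB //.
    rewrite Rintegral_cst // [X in fine X]muI /= mulr1; congr (_ - _).
    have iJ1 : mu.-integrable I (EFin \o (\1_J : R -> R)).
      by have := iJ 1; apply: eq_integrable => // s _ /=; rewrite mul1r.
    rewrite RintegralZl //; congr (_ * _).
    rewrite /Rintegral integral_indic //= setIidl // [X in fine X]muJ.
    by [].
  apply: le_Rintegral => //.
  - by apply: eq_integrable (integrableB _ (iJ b) iM).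
  - apply: measurable_bounded_integrable => //; first by rewrite [X in (X < _)%E]muI ltry.
      apply: measurable_funTS; apply: continuous_measurable_fun => s.
      by apply: cvgM; [exact: per_continuous|exact: cpN].
    exists (M * 3 ^+ N); split; first exact: num_real.
    move=> B hB s _ /=; apply: le_trans (ltW hB); rewrite normrM ler_pM //.
    by rewrite normrX lerXn2r ?nnegrE // peak_max.
  - move=> s; rewrite /I /= in_itv /= => /andP[s1 s2].
    have s12 : `|s - s0| <= 1 / 2 by rewrite ler_norml; apply/andP; split; lra.
    have [sJ|sJ] := boolP (s \in J).
      rewrite indicE sJ mulr1.
      move: sJ; rewrite inE /J /= in_itv /= => /andP[j1 j2].
      have sd : `|s - s0| <= dl / 2 by rewrite ler_norml; apply/andP; split; lra.
      have q2 := near2 s sd.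
      have q3 : 1 + N%:R * et <= peak s0 dl s ^+ N.
        apply: le_trans (bern N) _; rewrite lerXn2r ?nnegrE //; lra.
      have hs : h0 / 2 <= per G' s by apply: Hd; lra.
      have : b <= per G' s * peak s0 dl s ^+ N.
        rewrite /b ler_pM // ?divr_ge0 ?addr_ge0 ?mulr_ge0 //; exact: ltW.
      lra.
    rewrite indicE (negbTE sJ) mulr0 sub0r.
    have [sd|sd] := leP `|s - s0| dl.
      have hs : 0 <= per G' s by apply: le_trans (Hd s sd); rewrite divr_ge0 // ltW.
      have q : 0 <= peak s0 dl s ^+ N by rewrite exprn_ge0 // (le_trans _ (near1 s sd)).
      by apply: (@le_trans _ _ 0); [lra|rewrite mulr_ge0].
    have q := far s (ltW sd) s12.
    have : `|per G' s * peak s0 dl s ^+ N| <= M.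
      rewrite normrM -[M]mulr1 ler_pM // normrX exprn_ile1 //.
    by rewrite ler_norml => /andP[].
have [N hN] : exists N : nat, M / (h0 / 2 * et * dl) < N%:R.
  by exists (Num.truncn (M / (h0 / 2 * et * dl))).+1; exact: truncnS_gt.
have c0 : 0 < h0 / 2 * et * dl by rewrite !mulr_gt0 ?invr_gt0.
move: hN; rewrite ltr_pdivrMr // => hN.
have := key N; have : 0 < h0 / 2 * dl by rewrite !mulr_gt0 ?invr_gt0.
by lra.
Qed.

End periodization_uniqueness.

(** * The two-scale relation of the kernels *)

Section complex_valued.
Local Open Scope complex_scope.
Context {R : realType}.
Local Notation mu := (@lebesgue_measure R).
Local Notation Re := complex.Re.
Local Notation Im := complex.Im.
Implicit Types (G H : R -> R[i]) (u : int -> R[i]) (a b z w : R[i]).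

Lemma complexP z w : Re z = Re w -> Im z = Im w -> z = w.
Proof. by case: z; case: w => /= ? ? ? ? -> ->. Qed.

Lemma ReD z w : Re (z + w) = Re z + Re w.
Proof. by case: z; case: w. Qed.

Lemma ImD z w : Im (z + w) = Im z + Im w.
Proof. by case: z; case: w. Qed.

Lemma ReM z w : Re (z * w) = Re z * Re w - Im z * Im w.
Proof. by case: z; case: w. Qed.

Lemma ImM z w : Im (z * w) = Re z * Im w + Im z * Re w.
Proof. by case: z => ? ?; case: w. Qed.

Lemma ReJ z : Re z^*%R = Re z.
Proof. by case: z. Qed.

Lemma ImJ z : Im z^*%R = - Im z.
Proof. by case: z. Qed.

Lemma cisD (x y : R) : cis (x + y) = cis x * cis y.
Proof. by apply: complexP; rewrite /cis ?ReM ?ImM /= ?cosD ?sinD //; ring. Qed.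

Lemma cis0 : cis 0 = 1 :> R[i].
Proof. by rewrite /cis cos0 sin0. Qed.

Lemma cisJ (x : R) : (cis x)^*%R = cis (- x).
Proof. by rewrite /cis cosN sinN. Qed.

Lemma conjM z w : (z * w)^*%R = z^*%R * w^*%R.
Proof. by apply: complexP; rewrite ?(ReJ, ImJ, ReM, ImM); ring. Qed.

Lemma cis_pi : cis pi = -1 :> R[i].
Proof. by rewrite /cis cospi sinpi; apply: complexP => /=; rewrite ?oppr0. Qed.

Lemma cis_2piZ (k : int) : cis (2 * pi * k%:~R) = 1 :> R[i].
Proof. by rewrite /cis; have [-> ->] := @cos_sin_2pi_int R k. Qed.

Lemma cisNM (x : R) : cis (- x) * cis x = 1.
Proof. by rewrite -cisD addNr cis0. Qed.

Definition cenveloped G : Prop :=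
  enveloped (fun x => Re (G x)) /\ enveloped (fun x => Im (G x)).

Definition cint G : R[i] := (\int[mu]_x Re (G x)) +i* (\int[mu]_x Im (G x)).

Lemma cenvelopedM_lin a b G H : cenveloped G -> cenveloped H ->
  cenveloped (fun x => a * G x + b * H x).
Proof.
move=> [Gr Gi] [Hr Hi]; split.
- have := envelopedD (envelopedD (envelopedZ (Re a) Gr) (envelopedZ (- Im a) Gi))
    (envelopedD (envelopedZ (Re b) Hr) (envelopedZ (- Im b) Hi)).
  rewrite [X in enveloped X -> _](_ : _ = (fun x => Re (a * G x + b * H x))) //.
  by apply/funext => x; rewrite ReD !ReM; ring.
- have := envelopedD (envelopedD (envelopedZ (Re a) Gi) (envelopedZ (Im a) Gr))
    (envelopedD (envelopedZ (Re b) Hi) (envelopedZ (Im b) Hr)).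
  rewrite [X in enveloped X -> _](_ : _ = (fun x => Im (a * G x + b * H x))) //.
  by apply/funext => x; rewrite ImD !ImM; ring.
Qed.

Lemma cenveloped0 : cenveloped (fun=> 0).
Proof.
have h : enveloped (fun _ : R => 0 : R).
  split; first exact: cst_continuous.
  exists (fun=> 0); last by move=> x; rewrite normr0.
  by split => //; rewrite integral0 ltry.
by split.
Qed.

Lemma cenveloped_real (g : R -> R) : enveloped g -> cenveloped (fun x => (g x)%:C).
Proof. by move=> eg; split => //; exact: (cenveloped0.1). Qed.

Lemma cenveloped_cis G (l : R) : cenveloped G -> cenveloped (fun x => cis (l * x) * G x).
Proof.
move=> [Gr Gi]; split.
- have := envelopedD (enveloped_cos l Gr) (envelopedZ (-1) (enveloped_sin l Gi)).
  rewrite [X in enveloped X -> _](_ : _ = (fun x => Re (cis (l * x) * G x))) //.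
  by apply/funext => x; rewrite ReM /=; ring.
- have := envelopedD (enveloped_cos l Gi) (enveloped_sin l Gr).
  rewrite [X in enveloped X -> _](_ : _ = (fun x => Im (cis (l * x) * G x))) //.
  by apply/funext => x; rewrite ImM /=; ring.
Qed.

Lemma cenveloped_affine G (l m : R) : 0 < l -> cenveloped G ->
  cenveloped (fun x => G (l * x + m)).
Proof.
move=> l0 [Gr Gi]; split.
- exact: (@enveloped_affine _ (fun x => Re (G x)) l m l0 Gr).
- exact: (@enveloped_affine _ (fun x => Im (G x)) l m l0 Gi).
Qed.

Lemma cint_lin a b G H : cenveloped G -> cenveloped H ->
  cint (fun x => a * G x + b * H x) = a * cint G + b * cint H.
Proof.
move=> [Gr Gi] [Hr Hi]; apply: complexP; rewrite /cint /=.
- rewrite (_ : \int[mu]_x Re _ = \int[mu]_x (1 * (Re a * Re (G x) + - Im a * Im (G x)) +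
      1 * (Re b * Re (H x) + - Im b * Im (H x)))); last first.
    by apply: eq_Rintegral => x _; rewrite ReD !ReM; ring.
  rewrite Rintegral_lin2; last 2 first.
  - exact: envelopedD (envelopedZ _ Gr) (envelopedZ _ Gi).
  - exact: envelopedD (envelopedZ _ Hr) (envelopedZ _ Hi).
  by rewrite !Rintegral_lin2 // ReD !ReM /=; ring.
- rewrite (_ : \int[mu]_x Im _ = \int[mu]_x (1 * (Re a * Im (G x) + Im a * Re (G x)) +
      1 * (Re b * Im (H x) + Im b * Re (H x)))); last first.
    by apply: eq_Rintegral => x _; rewrite ImD !ImM; ring.
  rewrite Rintegral_lin2; last 2 first.
  - exact: envelopedD (envelopedZ _ Gi) (envelopedZ _ Gr).
  - exact: envelopedD (envelopedZ _ Hi) (envelopedZ _ Hr).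
  by rewrite !Rintegral_lin2 // ImD !ImM /=; ring.
Qed.

Lemma eq_cint G H : G =1 H -> cint G = cint H.
Proof. by move=> GH; congr cint; apply/funext. Qed.

Lemma cintZ a G : cenveloped G -> cint (fun x => a * G x) = a * cint G.
Proof.
move=> eG; have := cint_lin a 0 eG cenveloped0; rewrite [0 * cint _]mul0r addr0 => <-.
by apply: eq_cint => x; rewrite mulr0 addr0.
Qed.

Lemma cint_affine G (l m : R) : 0 < l -> cenveloped G ->
  cint (fun x => G (l * x + m)) = (l^-1)%:C * cint G.
Proof.
move=> l0 [Gr Gi]; rewrite /cint.
rewrite (Rintegral_affine m l0 (enveloped_integrable Gr)).
rewrite (Rintegral_affine m l0 (enveloped_integrable Gi)).
by apply: complexP; rewrite /= ?ReM ?ImM /=; ring.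
Qed.

Lemma fourierE (g : R -> R) y : enveloped g ->
  fourier g y = cint (fun x => cis (- (y * x)) * (g x)%:C).
Proof.
move=> eg; rewrite /fourier /cint; apply: complexP => /=.
  by apply: eq_Rintegral => x _; rewrite cosN; ring.
rewrite -mulN1r -RintegralZl //; last first.
  have := enveloped_integrable (enveloped_sin y eg).
  by apply: eq_integrable => // x _ /=; rewrite mulrC.
by apply: eq_Rintegral => x _; rewrite sinN; ring.
Qed.

Definition czsummable u : Prop :=
  zsummable (fun k => Re (u k)) /\ zsummable (fun k => Im (u k)).

Definition czsum u : R[i] := zsum (fun k => Re (u k)) +i* zsum (fun k => Im (u k)).

Lemma czsum_lin a b u (w : int -> R[i]) : czsummable u -> czsummable w ->
  czsummable (fun k => a * u k + b * w k) /\
  czsum (fun k => a * u k + b * w k) = a * czsum u + b * czsum w.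
Proof.
move=> [ur ui] [wr wi].
have eR : (fun k => Re (a * u k + b * w k)) =
    (fun k => (Re a * Re (u k) + - Im a * Im (u k)) +
              (Re b * Re (w k) + - Im b * Im (w k))).
  by apply/funext => k; rewrite ReD !ReM; ring.
have eI : (fun k => Im (a * u k + b * w k)) =
    (fun k => (Re a * Im (u k) + Im a * Re (u k)) +
              (Re b * Im (w k) + Im b * Re (w k))).
  by apply/funext => k; rewrite ImD !ImM; ring.
rewrite /czsummable /czsum eR eI; split.
  by split; apply: zsummableD; apply: zsummableD; apply: zsummableZ.
have s2 (g h : int -> R) c d : zsummable g -> zsummable h ->
    zsummable (fun k => c * g k + d * h k).
  by move=> sg sh; apply: zsummableD; exact: zsummableZ.
rewrite !zsumD; try exact: s2; try exact: zsummableZ.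
by rewrite !zsumZ //; apply: complexP; rewrite !(ReD, ImD, ReM, ImM) /=; ring.
Qed.

Definition cper G (s : R) : R[i] := czsum (fun k : int => G (s - k%:~R)).

(** The exponentials at m and - m combine into a cosine and a sine; the real and imaginary parts
    then fall under [per_eq0]. *)
Lemma cper_eq0 G : cenveloped G ->
  (forall m : int, cint (fun x => cis (- (2 * pi * m%:~R * x)) * G x) = 0) ->
  forall s, cper G s = 0.
Proof.
move=> eG G0 s; have [Gr Gi] := eG.
suff [h1 h2] : moments0 (fun x => Re (G x)) /\ moments0 (fun x => Im (G x)).
  by apply: complexP; [exact: (per_eq0 Gr h1 s)|exact: (per_eq0 Gi h2 s)].
have hc (m : int) : cint (fun x => (cos (2 * pi * m%:~R * x))%:C * G x) = 0.
  rewrite (_ : cint _ = cint (fun x => (2^-1)%:C * (cis ((- (2 * pi * m%:~R)) * x) * G x) +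
      (2^-1)%:C * (cis (- (2 * pi * (- m)%:~R) * x) * G x))).
    rewrite cint_lin; try exact: cenveloped_cis.
    have := G0 m; have := G0 (- m).
    under eq_cint do rewrite -mulNr.
    move=> ->; under eq_cint do rewrite -mulNr.
    by move=> ->; rewrite !mulr0 addr0.
  apply: eq_cint => x; rewrite -mulrDr rmorphN /= mulrN opprK mulNr /cis cosN sinN.
  by apply: complexP; rewrite /= !(ReM, ImM, ReD, ImD) /=; field.
have hs (m : int) : cint (fun x => (sin (2 * pi * m%:~R * x))%:C * G x) = 0.
  rewrite (_ : cint _ = cint (fun x => (0 +i* 2^-1) * (cis ((- (2 * pi * m%:~R)) * x) * G x) +
      (0 -i* 2^-1) * (cis (- (2 * pi * (- m)%:~R) * x) * G x))).
    rewrite cint_lin; try exact: cenveloped_cis.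
    have := G0 m; have := G0 (- m).
    under eq_cint do rewrite -mulNr.
    move=> ->; under eq_cint do rewrite -mulNr.
    by move=> ->; rewrite !mulr0 addr0.
  apply: eq_cint => x; rewrite rmorphN /= mulrN opprK mulNr /cis cosN sinN.
  by apply: complexP; rewrite /= !(ReM, ImM, ReD, ImD) /=; field.
split => m; have := hc m; have := hs m; rewrite /cint => -[s1 s2] [c1 c2]; split.
- by rewrite -[RHS]c1; apply: eq_Rintegral => x _; rewrite ReM /=; ring.
- by rewrite -[RHS]s1; apply: eq_Rintegral => x _; rewrite ReM /=; ring.
- by rewrite -[RHS]c2; apply: eq_Rintegral => x _; rewrite ImM /=; ring.
- by rewrite -[RHS]s2; apply: eq_Rintegral => x _; rewrite ImM /=; ring.
Qed.

End complex_valued.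

Section even_odd_sums.
Local Open Scope complex_scope.
Context {R : realType}.
Implicit Types u : int -> R.

(** The pairs 2 k, 2 k + 1 with |k| <= K fill -2 K, ..., 2 K + 1, one index beyond the symmetric
    range; the extra term vanishes in the limit by [zsummable_cvg0]. *)
Lemma sum_abs_le_even_odd K u :
  sum_abs_le K (fun k => u (2 * k) + u (2 * k + 1)) =
  sum_abs_le (2 * K) u + u (2 * K + 1)%N%:Z.
Proof.
elim: K => [|K IH]; first by rewrite muln0 !sum_abs_le0.
rewrite sum_abs_leS IH mulnS !sum_abs_leS.
rewrite (_ : 2 * K.+1%:Z = (2 * K).+2%:Z); last by lia.
rewrite (_ : (2 * K).+2%:Z + 1 = (2 + 2 * K + 1)%N%:Z); last by lia.
rewrite (_ : 2 * (- K.+1%:Z) = - (2 * K).+2%:Z); last by lia.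
rewrite (_ : - (2 * K).+2%:Z + 1 = - (2 * K).+1%:Z); last by lia.
rewrite (_ : (2 * K + 1)%N%:Z = (2 * K).+1%:Z); last by lia.
ring.
Qed.

Lemma zsummable_cvg0 u : zsummable u -> u K.+1%:Z @[K --> \oo] --> 0.
Proof.
move=> su; have sa : zsummable (fun k => `|u k|).
  by apply: zsummable_le su _ => k; rewrite normr_id.
have c := zsum_cvg sa.
have c1 : sum_abs_le K.+1 (fun k => `|u k|) @[K --> \oo] --> zsum (fun k => `|u k|).
  by have := c; rewrite -cvg_shiftS.
have c2 : sum_abs_le K.+1 (fun k => `|u k|) - sum_abs_le K (fun k => `|u k|)
    @[K --> \oo] --> 0.
  by rewrite -[X in _ --> X](subrr (zsum (fun k => `|u k|))); exact: cvgB.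
apply/cvgr0Pnorm_lt => e e0; move/cvgr0Pnorm_lt : c2 => /(_ e e0).
apply: filterS => K; apply: le_lt_trans; rewrite sum_abs_leS.
apply: le_trans (ler_norm _).
by have := normr_ge0 (u (- K.+1%:Z)); lra.
Qed.

Lemma zsum_even_odd u : zsummable u ->
  zsummable (fun k => u (2 * k) + u (2 * k + 1)) /\
  zsum (fun k => u (2 * k) + u (2 * k + 1)) = zsum u.
Proof.
move=> su; have [M hM] := su; split.
  exists M => K; apply: (@le_trans _ _ (sum_abs_le K (fun k => `|u (2 * k)| + `|u (2 * k + 1)|))).
    by apply: ler_sum_abs_le => k; exact: ler_normD.
  rewrite (sum_abs_le_even_odd K (fun k => `|u k|)).
  apply: le_trans (hM (2 * K).+1); rewrite sum_abs_leS addn1.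
  by have := normr_ge0 (u (- (2 * K).+1%:Z)); lra.
apply: zsum_unique; under eq_fun do rewrite sum_abs_le_even_odd.
rewrite -[zsum u]addr0; apply: cvgD.
  apply: (@cvg_comp _ _ _ (fun K => (2 * K)%N) (fun K => sum_abs_le K u) _ \oo);
    last exact: zsum_cvg.
  apply/cvgnyPge => N; exists N => // n /= Nn; lia.
have c := zsummable_cvg0 su.
under eq_fun do rewrite addn1.
apply: (@cvg_comp _ _ _ (fun K => (2 * K)%N) (fun K => u K.+1%:Z) _ \oo) c.
by apply/cvgnyPge => N; exists N => // n /= Nn; lia.
Qed.

End even_odd_sums.

(** * The Zak transform *)

Section theta.
Local Open Scope complex_scope.
Context {R : realType}.
Local Notation mu := (@lebesgue_measure R).
Local Notation Re := complex.Re.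
Local Notation Im := complex.Im.
Implicit Types (g : R -> R).

(** The Zak transform of g, at frequency h and position u. *)
Definition theta g (h u : R) : R[i] :=
  czsum (fun k : int => cis (h * k%:~R) * (g (u - k%:~R))%:C).

Lemma theta_summable g h u : enveloped g ->
  czsummable (fun k : int => cis (h * k%:~R) * (g (u - k%:~R))%:C).
Proof.
move=> eg; have sg := per_summable u eg; split; apply: zsummable_le sg _ => k.
  by rewrite ReM /= mulr0 subr0 normrM ler_piMl // cos_max.
by rewrite ImM /= mulr0 add0r normrM ler_piMl // sin_max.
Qed.

Lemma eq_czsum (u w : int -> R[i]) : u =1 w -> czsum u = czsum w.
Proof. by move=> uw; congr czsum; apply/funext. Qed.

Lemma czsumZ (a : R[i]) (u : int -> R[i]) : czsummable u ->
  czsum (fun k => a * u k) = a * czsum u.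
Proof.
move=> su; have [_ h] := czsum_lin a 0 su su.
transitivity (czsum (fun k => a * u k + 0 * u k)).
  by apply: eq_czsum => k; rewrite mul0r addr0.
by rewrite h mul0r addr0.
Qed.

Lemma czsum_even_odd (u : int -> R[i]) : czsummable u ->
  czsummable (fun k => u (2 * k) + u (2 * k + 1)) /\
  czsum (fun k => u (2 * k) + u (2 * k + 1)) = czsum u.
Proof.
move=> [ur ui]; have [sr er] := zsum_even_odd ur; have [si ei] := zsum_even_odd ui.
have eR : (fun k => Re (u (2 * k) + u (2 * k + 1))) =
   (fun k => Re (u (2 * k)) + Re (u (2 * k + 1))).
  by apply/funext => k; rewrite ReD.
have eI : (fun k => Im (u (2 * k) + u (2 * k + 1))) =
   (fun k => Im (u (2 * k)) + Im (u (2 * k + 1))).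
  by apply/funext => k; rewrite ImD.
by rewrite /czsummable /czsum eR eI er ei.
Qed.

Variables (phi psi : R -> R).
Hypothesis ephi : enveloped phi.
Hypothesis epsi : enveloped psi.

(* Uniqueness of periodizations, applied to the function of [s] whose
   periodization is [cis (- 2 z s)] times the difference of the two sides. *)
Lemma theta_two_scale (z : R) (a b : R[i]) :
  (forall m : int, (2^-1)%:C * (1 + cis (- (pi * m%:~R))) * fourier phi (z + pi * m%:~R) =
     a * fourier phi (2 * z + 2 * pi * m%:~R) +
     b * fourier psi (2 * z + 2 * pi * m%:~R)) ->
  forall s, theta phi z (2 * s) = a * theta phi (2 * z) s + b * theta psi (2 * z) s.
Proof.
move=> H s.
(* A and B carry the terms of even and odd index of [theta phi z (2 * s)]; the odd ones bring the
   factor [cis z]. *)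
pose A x := cis (- (2 * z) * x) * (phi (2 * x + 0))%:C.
pose B x := cis (- (2 * z) * x) * (phi (2 * x + -1))%:C.
pose C x := cis (- (2 * z) * x) * (phi x)%:C.
pose D x := cis (- (2 * z) * x) * (psi x)%:C.
have eA : cenveloped A.
  by apply: cenveloped_cis; apply: cenveloped_real; exact: enveloped_affine.
have eB : cenveloped B.
  by apply: cenveloped_cis; apply: cenveloped_real; exact: enveloped_affine.
have eC : cenveloped C by apply: cenveloped_cis; exact: cenveloped_real.
have eD : cenveloped D by apply: cenveloped_cis; exact: cenveloped_real.
pose G x := 1 * (1 * A x + cis z * B x) + (-1) * (a * C x + b * D x).
have eG : cenveloped G by do 2 apply: cenvelopedM_lin => //; apply: cenvelopedM_lin.
(* After x |-> 2 x, the m-th coefficients of A and B are half the transform of phi at z + pi m, with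
   an additional phase for B; C and D give transforms at 2 z + 2 pi m. The coefficient of G thus
   vanishes by H. *)
have G0 : forall m : int, cint (fun x => cis (- (2 * pi * m%:~R * x)) * G x) = 0.
  move=> m; pose w : R := - (2 * pi * m%:~R).
  have cA := cenveloped_cis w eA; have cB := cenveloped_cis w eB.
  have cC := cenveloped_cis w eC; have cD := cenveloped_cis w eD.
  rewrite (_ : cint _ = cint (fun x =>
     1 * (1 * (cis (w * x) * A x) + cis z * (cis (w * x) * B x)) +
     (-1) * (a * (cis (w * x) * C x) + b * (cis (w * x) * D x)))); last first.
    by apply: eq_cint => x; rewrite /G (_ : - (2 * pi * m%:~R * x) = w * x); [ring|rewrite /w; ring].
  rewrite cint_lin; [|exact: cenvelopedM_lin|exact: cenvelopedM_lin].
  rewrite !cint_lin //.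
  pose G0 x := cis (- ((z + pi * m%:~R) * x)) * (phi x)%:C.
  have eG0 : cenveloped G0.
    have := cenveloped_cis (- (z + pi * m%:~R)) (cenveloped_real ephi).
    by under eq_fun do rewrite mulNr.
  have -> : cint (fun x => cis (w * x) * A x) =
      (2^-1)%:C * fourier phi (z + pi * m%:~R).
    rewrite fourierE // -(cint_affine 0 _ eG0) //; apply: eq_cint => x.
    rewrite /A /G0 mulrA -cisD; congr (cis _ * _); rewrite /w; ring.
  have -> : cint (fun x => cis (w * x) * B x) =
      cis (- z) * cis (- (pi * m%:~R)) * ((2^-1)%:C * fourier phi (z + pi * m%:~R)).
    rewrite fourierE // -(cint_affine (-1) _ eG0) // -cintZ; last exact: cenveloped_affine.
    apply: eq_cint => x.
    rewrite /B /G0 !mulrA -!cisD; congr (cis _ * _); rewrite /w; ring.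
  have -> : cint (fun x => cis (w * x) * C x) = fourier phi (2 * z + 2 * pi * m%:~R).
    rewrite fourierE //; apply: eq_cint => x; rewrite /C mulrA -cisD.
    by congr (cis _ * _); rewrite /w; ring.
  have -> : cint (fun x => cis (w * x) * D x) = fourier psi (2 * z + 2 * pi * m%:~R).
    rewrite fourierE //; apply: eq_cint => x; rewrite /D mulrA -cisD.
    by congr (cis _ * _); rewrite /w; ring.
  rewrite -H; have cz := cisNM z.
  set X := fourier phi _; set c1 := cis (- (pi * _)).
  have -> : cis z * (cis (- z) * c1 * ((2^-1)%:C * X)) =
    (cis (- z) * cis z) * (c1 * ((2^-1)%:C * X)) by ring.
  rewrite cz; ring.
have := cper_eq0 eG G0 s.
pose u k := cis (z * k%:~R) * (phi (2 * s - k%:~R))%:C.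
have su : czsummable u by exact: theta_summable.
have [seo Eeo] := czsum_even_odd su.
pose p k := cis (2 * z * k%:~R) * (phi (s - k%:~R))%:C.
pose q k := cis (2 * z * k%:~R) * (psi (s - k%:~R))%:C.
have sp : czsummable p by exact: theta_summable.
have sq : czsummable q by exact: theta_summable.
have [spq Epq] := czsum_lin a b sp sq.
have [sT ET] := czsum_lin 1 (-1) seo spq.
have -> : cper G s = cis (- (2 * z) * s) * (theta phi z (2 * s) -
    (a * theta phi (2 * z) s + b * theta psi (2 * z) s)).
  rewrite /theta -[czsum (fun k => cis (z * _) * _)]/(czsum u) -Eeo.
  rewrite -[czsum (fun k => cis (2 * z * _) * (phi _)%:C)]/(czsum p).
  rewrite -[czsum (fun k => cis (2 * z * _) * (psi _)%:C)]/(czsum q) -Epq.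
  rewrite [X in _ * X](_ : _ = czsum (fun k =>
       1 * (u (2 * k) + u (2 * k + 1)) + -1 * (a * p k + b * q k))); last first.
    by rewrite ET mul1r mulN1r.
  rewrite -czsumZ //.
  apply: eq_czsum => k; rewrite /G /A /B /C /D /u /p /q.
  have e1 : - (2 * z) * (s - k%:~R) = - (2 * z) * s + 2 * z * k%:~R by ring.
  rewrite e1 cisD addr0.
  have -> : z * (2 * k)%:~R = 2 * z * k%:~R by rewrite intrM; ring.
  have -> : z * (2 * k + 1)%:~R = 2 * z * k%:~R + z by rewrite intrD intrM; ring.
  have -> : 2 * s - (2 * k)%:~R = 2 * (s - k%:~R) by rewrite intrM; ring.
  have -> : 2 * s - (2 * k + 1)%:~R = 2 * (s - k%:~R) - 1 by rewrite intrD intrM; ring.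
  rewrite cisD; ring.
move=> /(congr1 (fun c => cis (2 * z * s) * c)); rewrite mulr0 mulrA -cisD.
rewrite (_ : 2 * z * s + - (2 * z) * s = 0); last by ring.
by rewrite cis0 mul1r => /eqP; rewrite subr_eq0 => /eqP.
Qed.

End theta.

Section unit_interval.
Local Open Scope complex_scope.
Context {R : realType}.
Local Notation mu := (@lebesgue_measure R).
Local Notation Re := complex.Re.
Local Notation Im := complex.Im.

Lemma Rintegral_FTC2 (f F : R -> R) (a b : R) : a < b -> continuous f ->
  (forall x : R, is_derive x (1 : R) F (f x)) ->
  \int[mu]_(x in `[a, b]) f x = F b - F a.
Proof.
move=> ab cf dF.
have cF : continuous F.
  move=> x; apply/differentiable_continuous/derivable1_diffP.
  by have [] := dF x.
rewrite /Rintegral (continuous_FTC2 ab (F := F)) //.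
- exact: continuous_subspaceT.
- split.
  + by move=> x _; have [] := dF x.
  + by apply: cvg_at_right_filter; exact: cF.
  + by apply: cvg_at_left_filter; exact: cF.
- by move=> x _; rewrite derive1E; have [_ ->] := dF x.
Qed.

Lemma integrable_itv_co (f : R -> R) (a b : R) : continuous f ->
  mu.-integrable `[a, b[ (EFin \o f).
Proof.
move=> cf; apply: (@integrableS _ _ _ mu `[a, b]) => //.
  by apply: subset_itvl; rewrite bnd_simp.
apply: continuous_compact_integrable; first exact: segment_compact.
exact: continuous_subspaceT.
Qed.

Lemma is_derive_lin (a x : R) : is_derive x 1 (fun x : R => a * x) a.
Proof.
have h := @is_deriveZ R R R id a x 1 1 (is_derive_id x 1).
by apply: is_derive_eq; rewrite /GRing.scale /= mulr1.
Qed.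

Lemma is_derive_sin_lin (a x : R) :
  is_derive x 1 (fun x : R => sin (a * x)) (a * cos (a * x)).
Proof.
have h : is_derive x 1 (fun x : R => a * x) a by exact: is_derive_lin.
by have := is_derive1_comp (is_derive_sin (a * x)) h; rewrite mulrC.
Qed.

Lemma is_derive_cos_lin (a x : R) :
  is_derive x 1 (fun x : R => cos (a * x)) (- (a * sin (a * x))).
Proof.
have h : is_derive x 1 (fun x : R => a * x) a by exact: is_derive_lin.
by have := is_derive1_comp (is_derive_cos (a * x)) h; rewrite mulNr mulrC.
Qed.

Lemma Rintegral_trig_unit (j : int) :
  \int[mu]_(s in `[0, 1[) cos (2 * pi * j%:~R * s) = (j == 0)%:R /\
  \int[mu]_(s in `[0, 1[) sin (2 * pi * j%:~R * s) = 0.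
Proof.
set a : R := 2 * pi * j%:~R.
have [cj sj] := @cos_sin_2pi_int R j.
rewrite !Rintegral_itv_bndo_bndc; last 2 first.
- exact/integrable_itv_co/continuous_sin_lin.
- exact/integrable_itv_co/continuous_cos_lin.
have [j0|jn0] := eqVneq j 0.
  have a0 : a = 0 by rewrite /a j0 mulr0.
  split.
    under eq_Rintegral do rewrite a0 mul0r cos0.
    rewrite Rintegral_cst //= lebesgue_measure_itv /= lte_fin ltr01 -EFinB /=.
    by rewrite subr0 mulr1.
  under eq_Rintegral do rewrite a0 mul0r sin0.
  by rewrite Rintegral_cst // mul0r.
have an0 : a != 0.
  by rewrite /a !mulf_eq0 intr_eq0 (negPf jn0) pnatr_eq0 /= orbF gt_eqF ?pi_gt0.
have dsin (x : R) : is_derive x 1 (fun s : R => a^-1 * sin (a * s)) (cos (a * x)).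
  have h := @is_deriveZ R R R _ a^-1 x 1 _ (is_derive_sin_lin a x).
  by apply: is_derive_eq; rewrite /GRing.scale /= mulrA mulVf // mul1r.
have dcos (x : R) : is_derive x 1 (fun s : R => - a^-1 * cos (a * s)) (sin (a * x)).
  have h := @is_deriveZ R R R _ (- a^-1) x 1 _ (is_derive_cos_lin a x).
  by apply: is_derive_eq; rewrite /GRing.scale /= mulrNN mulrA mulVf // mul1r.
split.
  rewrite (Rintegral_FTC2 ltr01 (@continuous_cos_lin _ a) dsin).
  by rewrite mulr1 mulr0 sj sin0 subrr.
rewrite (Rintegral_FTC2 ltr01 (@continuous_sin_lin _ a) dcos).
by rewrite mulr1 mulr0 cj cos0 subrr.
Qed.

Lemma sum_abs_le_pick (K : nat) (f : int -> R) (k : int) :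
  sum_abs_le K (fun l => f l * (l == k)%:R) = f k * (`|k| <= K)%N%:R.
Proof.
rewrite -sum_abs_le_delta -sum_abs_leZ; apply: eq_sum_abs_le => l.
by have [->|] := eqVneq l k; rewrite ?mulr0.
Qed.

Lemma eq_sum_abs_le_in (K : nat) (f g : int -> R) :
  (forall k : int, (`|k| <= K)%N -> f k = g k) -> sum_abs_le K f = sum_abs_le K g.
Proof. by move=> fg; apply: eq_big_nat => i /andP[_ iK]; apply: fg; lia. Qed.

Definition csum_abs_le (K : nat) (u : int -> R[i]) : R[i] :=
  sum_abs_le K (fun k => Re (u k)) +i* sum_abs_le K (fun k => Im (u k)).

Lemma Re_csum_mul_conj K (u w : int -> R[i]) :
  Re (csum_abs_le K u * (csum_abs_le K w)^*) =
  sum_abs_le K (fun k => sum_abs_le K (fun l => Re (u k * (w l)^*))).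
Proof.
rewrite ReM ReJ ImJ /csum_abs_le /= mulrN opprK.
rewrite mulrC -sum_abs_leZ [X in _ + X]mulrC -sum_abs_leZ -sum_abs_leD.
apply: eq_sum_abs_le => k; rewrite mulrC -sum_abs_leZ [X in _ + X]mulrC -sum_abs_leZ.
by rewrite -sum_abs_leD; apply: eq_sum_abs_le => l; rewrite ReM ReJ ImJ mulrN opprK.
Qed.

(* Polarized Parseval identity for trigonometric polynomials. *)
Lemma Rintegral_csum_mul_conj (c : int) K (x y : int -> R[i]) : c != 0 ->
  let A z s := csum_abs_le K (fun k => z k * cis (2 * pi * (c * k)%:~R * s)) in
  \int[mu]_(s in `[0, 1[) Re (A x s * (A y s)^*) =
    sum_abs_le K (fun k => Re (x k * (y k)^*)) /\
  mu.-integrable `[0, 1[ (EFin \o (fun s => Re (A x s * (A y s)^*))).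
Proof.
move=> cn0 A.
pose h k l s : R := Re (x k * (y l)^*) * cos (2 * pi * (c * (k - l))%:~R * s) -
  Im (x k * (y l)^*) * sin (2 * pi * (c * (k - l))%:~R * s).
have AE : (fun s => Re (A x s * (A y s)^*)) =
    (fun s => sum_abs_le K (fun k => sum_abs_le K (fun l => h k l s))).
  apply/funext => s; rewrite Re_csum_mul_conj.
  apply: eq_sum_abs_le => k; apply: eq_sum_abs_le => l.
  have -> : x k * cis (2 * pi * (c * k)%:~R * s) * (y l * cis (2 * pi * (c * l)%:~R * s))^* =
      x k * (y l)^* * cis (2 * pi * (c * (k - l))%:~R * s).
    rewrite conjM cisJ mulrACA -cisD; congr (_ * cis _).
    by rewrite !intrM intrB; ring.
  by rewrite [LHS]ReM.
have mI : measurable (`[0, 1[%classic : set (measurableTypeR R)) by [].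
have ic a b : mu.-integrable `[0, 1[ (EFin \o (fun s : R => a * cos (b * s))).
  by apply: integrable_itv_co => s; apply: cvgMl_tmp; exact: continuous_cos_lin.
have is_ a b : mu.-integrable `[0, 1[ (EFin \o (fun s : R => a * sin (b * s))).
  by apply: integrable_itv_co => s; apply: cvgMl_tmp; exact: continuous_sin_lin.
have ih k l : mu.-integrable `[0, 1[ (EFin \o h k l).
  have := integrableB mI (ic (Re (x k * (y l)^*)) (2 * pi * (c * (k - l))%:~R))
    (is_ (Im (x k * (y l)^*)) (2 * pi * (c * (k - l))%:~R)).
  by apply: eq_integrable.
have hl k := Rintegral_sum_abs_le K mI (ih k).
have [E I] := Rintegral_sum_abs_le K mI (fun k => (hl k).2).
rewrite AE; split => //; rewrite E.
apply: eq_sum_abs_le_in => k kK; rewrite (hl k).1.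
transitivity (sum_abs_le K (fun l => Re (x k * (y l)^*) * (l == k)%:R)); last first.
  by rewrite (sum_abs_le_pick K (fun l => Re (x k * (y l)^*))) kK mulr1.
apply: eq_sum_abs_le => l.
have [tc ts] := Rintegral_trig_unit (c * (k - l)).
rewrite RintegralB // !RintegralZl //; last 2 first.
- by have := is_ 1 (2 * pi * (c * (k - l))%:~R); apply: eq_integrable => // s _ /=; rewrite mul1r.
- by have := ic 1 (2 * pi * (c * (k - l))%:~R); apply: eq_integrable => // s _ /=; rewrite mul1r.
rewrite tc ts mulr0 subr0 mulf_eq0 (negPf cn0) /= subr_eq0.
by rewrite eq_sym.
Qed.

Lemma theta_trunc_bound (g : R -> R) (u : R) : enveloped g ->
  exists B, forall K h,
    `|Re (csum_abs_le K (fun k => cis (h * k%:~R) * (g (u - k%:~R))%:C))| <= B /\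
    `|Im (csum_abs_le K (fun k => cis (h * k%:~R) * (g (u - k%:~R))%:C))| <= B.
Proof.
move=> eg; have [M hM] := enveloped_sum_bound eg; exists M => K h.
split; apply: le_trans (ler_norm_sum_abs_le _ _) _; apply: le_trans (hM u K);
  apply: ler_sum_abs_le => k.
- by rewrite ReM /= mulr0 subr0 normrM ler_piMl // cos_max.
- by rewrite ImM /= mulr0 add0r normrM ler_piMl // sin_max.
Qed.

Lemma theta_trunc_cvg (g : R -> R) (h u : R) : enveloped g ->
  let A K := csum_abs_le K (fun k => cis (h * k%:~R) * (g (u - k%:~R))%:C) in
  Re (A K) @[K --> \oo] --> Re (theta g h u) /\
  Im (A K) @[K --> \oo] --> Im (theta g h u).
Proof.
by move=> eg A; have [sr si] := theta_summable h u eg; split; exact: zsum_cvg.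
Qed.

(** Parseval's identity in the frequency, where [theta] is a Fourier series with coefficients g (u -
    k); its truncations are uniformly bounded, so the polynomial case passes to the limit. The
    parameters c and d allow for the frequencies z, z + pi and 2 z. *)
Lemma Rintegral_theta_mul_conj (g : R -> R) (c : int) (d u v : R) : enveloped g ->
  c != 0 ->
  let f s := Re (theta g (2 * pi * c%:~R * s + d) u *
                 (theta g (2 * pi * c%:~R * s + d) v)^*) in
  \int[mu]_(s in `[0, 1[) f s = zsum (fun k => g (u - k%:~R) * g (v - k%:~R)) /\
  mu.-integrable `[0, 1[ (EFin \o f).
Proof.
move=> eg cn0 f.
pose x w k : R[i] := cis (d * k%:~R) * (g (w - k%:~R))%:C.
pose A K w s := csum_abs_le K (fun k => x w k * cis (2 * pi * (c * k)%:~R * s)).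
have AE K w s : A K w s = csum_abs_le K (fun k =>
    cis ((2 * pi * c%:~R * s + d) * k%:~R) * (g (w - k%:~R))%:C).
  rewrite /A; congr csum_abs_le; apply/funext => k.
  rewrite /x mulrAC -cisD; congr (cis _ * _); rewrite intrM; ring.
have [Bu hBu] := theta_trunc_bound u eg; have [Bv hBv] := theta_trunc_bound v eg.
have fE s : Re (A K u s * (A K v s)^*) @[K --> \oo] --> f s.
  have [ur ui] := theta_trunc_cvg (2 * pi * c%:~R * s + d) u eg.
  have [vr vi] := theta_trunc_cvg (2 * pi * c%:~R * s + d) v eg.
  rewrite /f ReM ReJ ImJ mulrN opprK.
  under eq_fun do rewrite ReM ReJ ImJ mulrN opprK !AE.
  by apply: cvgD; apply: cvgM.
have h1 K s : `[0, 1[%classic s -> `|Re (A K u s * (A K v s)^*)| <= Bu * Bv + Bu * Bv.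
  move=> _; rewrite ReM ReJ ImJ mulrN opprK !AE.
  set h := _ * s + d; have [a1 a2] := hBu K h; have [b1 b2] := hBv K h.
  by rewrite (le_trans (ler_normD _ _)) // !normrM lerD // ler_pM.
have iB : mu.-integrable `[0, 1[ (EFin \o (fun _ : R => Bu * Bv + Bu * Bv)).
  by apply: integrable_itv_co; exact: cst_continuous.
have P K := Rintegral_csum_mul_conj K (x u) (x v) cn0.
pose D : set (measurableTypeR R) := `[0, 1[%classic.
have mA K : measurable_fun D (fun s => Re (A K u s * (A K v s)^*)).
  by have [_ /(measurable_int mu) /measurable_EFinP] := P K.
have mD : measurable D by exact: measurable_itv.
split; last exact: (@Rdominated_integrable _ _ _ mu D mD _ f _ mA (fun s _ => fE s) iB h1).
have c1 := @Rdominated_cvg _ _ _ mu D mD _ f _ mA (fun s _ => fE s) iB h1.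
rewrite -(cvg_lim (@Rhausdorff R) c1).
apply: (cvg_lim (@Rhausdorff R)).
have -> : (fun K => \int[mu]_(s in `[0, 1[) Re (A K u s * (A K v s)^*)) =
    (fun K => sum_abs_le K (fun k => g (u - k%:~R) * g (v - k%:~R))).
  apply/funext => K; rewrite (P K).1; apply: eq_sum_abs_le => k.
  rewrite /x conjM cisJ mulrACA -cisD subrr cis0 mul1r.
  by rewrite ReM /=; ring.
have [M hM] := enveloped_sum_bound eg; have [_ [Psi [P0 Pd _] gP]] := eg.
apply: zsum_cvg; apply: (zsummable_le (zsummableZ (Psi 0) (per_summable v eg))) => k.
rewrite !normrM ler_wpM2r // [leRHS]ger0_norm ?P0 //.
by apply: le_trans (gP _) _; exact: Pd.
Qed.

End unit_interval.

(** * The quadrature mirror identity and the two-scale relation *)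

Section quadrature_mirror.
Local Open Scope complex_scope.
Context {R : realType}.
Local Notation mu := (@lebesgue_measure R).
Local Notation Re := complex.Re.
Local Notation Im := complex.Im.

Lemma sum_abs_le_split (K : nat) (F : int -> R) :
  sum_abs_le K F = \sum_(0 <= n < K.+1) F n%:Z + \sum_(0 <= n < K) F (Negz n).
Proof.
elim: K => [|K IH]; first by rewrite sum_abs_le0 big_nat1 big_nil addr0.
rewrite sum_abs_leS IH [in RHS]big_nat_recr //= [in X in _ = _ + X]big_nat_recr //=.
by rewrite -NegzE -!addrA; congr (_ + _); rewrite addrCA addrA.
Qed.

Lemma nneseries_cvg (a : nat -> R) : (forall n, 0 <= a n) ->
  (\sum_(n <oo) (a n)%:E)%E \is a fin_num ->
  \sum_(0 <= n < K) a n @[K --> \oo] --> fine (\sum_(n <oo) (a n)%:E)%E.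
Proof.
move=> a0 af.
apply: (@fine_cvg R nat \oo _ (fun K => (\sum_(0 <= n < K) a n)%:E)).
rewrite fineK //.
have := @is_cvg_nneseries R (fun n => (a n)%:E) xpredT 0 (fun n _ _ => a0 n).
by under eq_fun do rewrite sumEFin; apply.
Qed.

(** Links the unordered sum of [f_wavelet] to symmetric sums: Z is cut into its nonnegative and
    negative halves, each indexed by nat. *)
Lemma esum_zsum (F : int -> R) (s : R) : (forall k, 0 <= F k) ->
  (\esum_(k in [set: int]) (F k)%:E = s%:E)%E -> zsummable F /\ zsum F = s.
Proof.
move=> F0; rewrite (esumID [set k : int | 0 <= k]); last by move=> k _; rewrite lee_fin.
have bp : set_bij [set: nat] ([set: int] `&` [set k : int | 0 <= k]) Posz.
  split=> //; first by move=> m n _ _ [].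
  by move=> [n|n] [_ h] //; exists n.
have bn : set_bij [set: nat] ([set: int] `&` ~` [set k : int | 0 <= k]) Negz.
  split=> //; first by move=> m n _ _ [].
  by move=> [n|n] [_ h]; [case: h | exists n].
rewrite (reindex_esum _ _ _ _ bp) (reindex_esum _ _ _ _ bn).
rewrite -!nneseries_esumT; [|by move=> n; rewrite lee_fin..].
set p := limn _; set q := limn _ => pq.
have p0 : (0 <= p)%E by apply: nneseries_ge0 => n _ _; rewrite lee_fin.
have q0 : (0 <= q)%E by apply: nneseries_ge0 => n _ _; rewrite lee_fin.
have [pf qf] : p \is a fin_num /\ q \is a fin_num.
  have : (p + q)%E \is a fin_num by rewrite pq.
  by rewrite fin_numD => /andP[].
have cp := nneseries_cvg (fun n => F0 n%:Z) pf.
have cq := nneseries_cvg (fun n => F0 (Negz n)) qf.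
have c : sum_abs_le K F @[K --> \oo] --> s.
  have -> : s = fine p + fine q by rewrite -fineD // pq.
  under eq_fun do rewrite sum_abs_le_split.
  by apply: cvgD => //; move: cp; rewrite -cvg_shiftS.
split; last exact: zsum_unique.
exists s => K; under eq_sum_abs_le do rewrite ger0_norm //.
rewrite -(cvg_lim (@Rhausdorff R) c).
apply: nondecreasing_cvgn_le; first exact: sum_abs_le_nd.
by apply/cvg_ex; exists s.
Qed.

Lemma aeI (P Q : R -> Prop) : {ae mu, forall x, P x} -> {ae mu, forall x, Q x} ->
  {ae mu, forall x, P x /\ Q x}.
Proof.
move=> hP hQ.
exact: (@filterI _ _ (ae_filter_ringOfSetsType mu) _ _ hP hQ).
Qed.

Lemma aeS (P Q : R -> Prop) : (forall x, P x -> Q x) -> {ae mu, forall x, P x} ->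
  {ae mu, forall x, Q x}.
Proof. by move=> PQ hP; exact: (@filterS _ _ (ae_filter_ringOfSetsType mu) _ _ PQ hP). Qed.

Lemma ae_forall_int (Q : int -> R -> Prop) :
  (forall k, {ae mu, forall x, Q k x}) -> {ae mu, forall x, forall k, Q k x}.
Proof.
move=> h; have : {ae mu, forall x, forall n : nat, Q n%:Z x /\ Q (Negz n) x}.
  by apply: ae_foralln => n; exact: aeI (h n%:Z) (h (Negz n)).
by apply: aeS => x hx [] n; have [] := hx n.
Qed.

Lemma ae_eq_Rintegral (D : set (measurableTypeR R)) (f g : R -> R) :
  measurable D -> mu.-integrable D (EFin \o f) -> mu.-integrable D (EFin \o g) ->
  {ae mu, forall x, D x -> f x = g x} ->
  \int[mu]_(x in D) f x = \int[mu]_(x in D) g x.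
Proof.
move=> mD /(measurable_int mu) mf /(measurable_int mu) mg fg.
congr fine; apply: ae_eq_integral => //.
by apply: filterS fg => x fgx Dx; rewrite /= fgx.
Qed.

Lemma theta_periodic (g : R -> R) (h u : R) : theta g (h + 2 * pi) u = theta g h u.
Proof.
apply: eq_czsum => k; congr (_ * _).
by rewrite mulrDl cisD cis_2piZ mulr1.
Qed.

Lemma mask_periodic (m0 : R -> R[i]) : (forall y, m0 (y + 2 * pi) = m0 y) ->
  forall (k : int) y, m0 (y + 2 * pi * k%:~R) = m0 y.
Proof.
move=> m0p; suff h (n : nat) y : m0 (y + 2 * pi * n%:R) = m0 y.
  case=> n y; first exact: h.
  rewrite -(h n.+1) NegzE intrN -addrA; congr m0.
  by rewrite -[n.+1%:~R]/(n.+1%:R : R); ring.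
elim: n y => [|n IH] y; first by rewrite mulr0 addr0.
by rewrite -[n.+1%:R]natr1 mulrDr mulr1 addrA m0p IH.
Qed.

Lemma sqnormcM (z w : R[i]) : sqnormc (z * w) = sqnormc z * sqnormc w.
Proof. by rewrite /sqnormc ReM ImM; ring. Qed.

Lemma sqnormc_ge0 (z : R[i]) : 0 <= sqnormc z.
Proof. by rewrite addr_ge0 ?sqr_ge0. Qed.

Lemma mulJc (z : R[i]) : z^*%R * z = (sqnormc z)%:C.
Proof. by apply: complexP; rewrite ?(ReM, ImM) ReJ ImJ /sqnormc /=; ring. Qed.

Section kernel_identity.
Variables (phi psi : R -> R).
Hypothesis ephi : enveloped phi.
Hypothesis epsi : enveloped psi.

Definition partition_one (y : R) : Prop :=
  zsummable (fun k => sqnormc (fourier phi (y + 2 * pi * k%:~R))) /\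
  zsum (fun k => sqnormc (fourier phi (y + 2 * pi * k%:~R))) = 1.

Definition two_scale_at (m0 : R -> R[i]) (z : R) : Prop :=
  forall m : int, let y := z + pi * m%:~R in
    fourier phi (2 * y) = m0 y * fourier phi y /\
    fourier psi (2 * y) = (m0 (y + pi))^*%R * cis (- y) * fourier phi y.

(** Gathers the almost-everywhere hypotheses at all the points z + pi m together. Countably many
    null sets are removed, so almost every z qualifies, and afterwards one argues at a single z. *)
Definition regular_frequency (m0 : R -> R[i]) (z : R) : Prop :=
  [/\ two_scale_at m0 z,
      partition_one (2 * z), partition_one z & partition_one (z + pi)].

Lemma ae_regular_frequency m0 : refinement_mask phi m0 ->
  {ae mu, forall y, fourier psi y =
      (m0 (y / 2 + pi))^*%R * cis (- (y / 2)) * fourier phi (y / 2)} ->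
  {ae mu, forall y : R,
        (\esum_(k in [set: int])
           (sqnormc (fourier phi (y + 2 * pi * k%:~R)))%:E = 1)%E} ->
  {ae mu, forall z, regular_frequency m0 z}.
Proof.
move=> [_ href] hpsi hsum.
have hp : {ae mu, forall y, partition_one y}.
  by apply: aeS hsum => y; apply: esum_zsum => k; exact: sqnormc_ge0.
have two0 : (0 < 2 :> R) by [].
have h1 : {ae mu, forall z, two_scale_at m0 z}.
  apply: ae_forall_int => m.
  have := ae_affine (2 * pi * m%:~R) two0 (aeI href hpsi).
  apply: aeS => z.
  rewrite (_ : 2 * z + 2 * pi * m%:~R = 2 * (z + pi * m%:~R)); last by ring.
  by rewrite mulrAC mulfV ?mul1r // => -[].
have h2 := ae_affine 0 two0 hp.
have h3 := ae_affine pi (@ltr01 R) hp.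
apply: aeS (aeI (aeI h1 h2) (aeI hp h3)) => z [[a b] [e g]].
rewrite addr0 in b; rewrite mul1r in g; exact: And4.
Qed.

(** Split the partition of unity at 2 z by parity of k. The refinement equation takes |m0 z|^2 out
    of the even terms and |m0 (z + pi)|^2 out of the odd ones, leaving the partitions of unity at z
    and z + pi. *)
Lemma quadrature_mirror m0 z : (forall y, m0 (y + 2 * pi) = m0 y) ->
  regular_frequency m0 z -> sqnormc (m0 z) + sqnormc (m0 (z + pi)) = 1.
Proof.
move=> m0p [hr [s2 <-] [s0 e0] [s1 e1]].
have [se <-] := zsum_even_odd s2.
have m0k := mask_periodic m0p.
rewrite -[sqnormc (m0 z)]mulr1 -[in LHS]e0 -[sqnormc (m0 (z + pi))]mulr1.
rewrite -[X in _ + _ * X]e1 -!zsumZ // -zsumD; last 2 first.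
- exact: zsummableZ.
- exact: zsummableZ.
congr zsum; apply/funext => k; rewrite -!sqnormcM.
have [h _] := hr (2 * k); have [h' _] := hr (2 * k + 1).
congr (sqnormc _ + sqnormc _).
- transitivity (fourier phi (2 * (z + pi * (2 * k)%:~R))).
    by rewrite h intrM mulrCA mulrA m0k.
  by congr fourier; ring.
- transitivity (fourier phi (2 * (z + pi * (2 * k + 1)%:~R))).
    rewrite h' (_ : z + pi * (2 * k + 1)%:~R = z + pi + 2 * pi * k%:~R) ?m0k //.
    by rewrite !(intrD, intrM); ring.
  by congr fourier; rewrite !(intrD, intrM); ring.
Qed.

(** The coefficients required by [theta_two_scale] are the conjugate low-pass mask and the mask
    shifted by pi; they invert the relations defining the transforms of phi and psi at 2 z. *)
Lemma theta_transform m0 z s : (forall y, m0 (y + 2 * pi) = m0 y) ->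
  two_scale_at m0 z -> sqnormc (m0 z) + sqnormc (m0 (z + pi)) = 1 ->
  theta phi z (2 * s) = (m0 z)^*%R * theta phi (2 * z) s +
    m0 (z + pi) * cis z * theta psi (2 * z) s.
Proof.
move=> m0p hr q.
have m0k := mask_periodic m0p.
apply: theta_two_scale => // m; have [h1 h2] := hr m.
rewrite (_ : 2 * z + 2 * pi * m%:~R = 2 * (z + pi * m%:~R)); last by ring.
rewrite h1 h2 {h1 h2}; set F := fourier _ _.
(* For even m the quadrature mirror identity makes the two sides equal; for odd m the masks exchange
   their roles and both sides vanish. *)
have [k [ek|ek]] : exists k : int, m = 2 * k \/ m = 2 * k + 1.
  by exists (m %/ 2)%Z; lia.
- have e1 : m0 (z + pi * m%:~R) = m0 z by rewrite ek intrM mulrCA mulrA m0k.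
  have e2 : m0 (z + pi * m%:~R + pi) = m0 (z + pi).
    by rewrite ek intrM mulrCA mulrA addrAC m0k.
  have e3 : cis (- (z + pi * m%:~R)) = cis (- z) :> R[i].
    rewrite opprD cisD (_ : - (pi * m%:~R) = 2 * pi * (- k)%:~R).
      by rewrite cis_2piZ mulr1.
    by rewrite ek intrM intrN; ring.
  have e4 : cis (- (pi * m%:~R)) = 1 :> R[i].
    rewrite (_ : - (pi * m%:~R) = 2 * pi * (- k)%:~R) ?cis_2piZ //.
    by rewrite ek intrM intrN; ring.
  rewrite e1 e2 e3 e4.
  transitivity (((m0 z)^*%R * m0 z + (m0 (z + pi))^*%R * m0 (z + pi) * (cis (- z) * cis z)) * F).
    rewrite !mulJc cisNM mulr1; congr (_ * _); apply: complexP.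
      by rewrite ReM ReD ReD /= q; field.
    by rewrite ImM ImD ImD /=; ring.
  ring.
- have e1 : m0 (z + pi * m%:~R) = m0 (z + pi).
    rewrite ek intrD intrM mulrDr mulr1 (_ : z + _ = (z + pi) + 2 * pi * k%:~R) ?m0k //; ring.
  have e2 : m0 (z + pi * m%:~R + pi) = m0 z.
    rewrite ek intrD intrM mulrDr mulr1.
    rewrite (_ : z + _ + _ = z + 2 * pi * (k + 1)%:~R) ?m0k //.
    by rewrite intrD; ring.
  have e3 : cis (- (z + pi * m%:~R)) = - cis (- z) :> R[i].
    rewrite opprD cisD (_ : - (pi * m%:~R) = pi + 2 * pi * (- k - 1)%:~R).
      by rewrite cisD cis_2piZ mulr1 cis_pi mulrN1.
    by rewrite ek !(intrM, intrD, intrN); ring.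
  have e4 : cis (- (pi * m%:~R)) = -1 :> R[i].
    rewrite (_ : - (pi * m%:~R) = pi + 2 * pi * (- k - 1)%:~R).
      by rewrite cisD cis_2piZ mulr1 cis_pi.
    by rewrite ek !(intrM, intrD, intrN); ring.
  rewrite e1 e2 e3 e4 subrr mulr0 mul0r.
  transitivity (((m0 z)^*%R * m0 (z + pi) * (1 - cis (- z) * cis z)) * F).
    by rewrite cisNM subrr mulr0 mul0r.
  ring.
Qed.

Lemma conjD (z w : R[i]) : (z + w)^*%R = z^*%R + w^*%R.
Proof. by apply: complexP; rewrite ?(ReD, ImD, ReJ, ImJ) //; ring. Qed.

Lemma conjK (z : R[i]) : (z^*%R)^*%R = z.
Proof. by apply: complexP; rewrite ?(ReJ, ImJ) // opprK. Qed.

Lemma conjN (z : R[i]) : (- z)^*%R = - z^*%R.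
Proof. by case: z => a b; apply: complexP; rewrite ?(ReJ, ImJ). Qed.

(* The pair of masks is a unitary matrix at almost every frequency. *)
Lemma unitary_mix (a b w U V U' V' : R[i]) : sqnormc a + sqnormc b = 1 ->
  w^*%R * w = 1 ->
  (a^*%R * U + b * w * V) * (a^*%R * U' + b * w * V')^*%R +
  (b^*%R * U - a * w * V) * (b^*%R * U' - a * w * V')^*%R =
  U * U'^*%R + V * V'^*%R.
Proof.
move=> ab ww; rewrite !(conjD, conjN, conjM, conjK).
transitivity ((a^*%R * a + b^*%R * b) * (U * U'^*%R + w^*%R * w * (V * V'^*%R))).
  ring.
rewrite ww mul1r !mulJc (_ : _ + _ = 1) ?mul1r //.
by apply: complexP; rewrite ?(ReD, ImD) //= addr0.
Qed.

(** [theta_transform] at z and at z + pi applies the two rows of one unitary matrix to the same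
    pair, because [theta] has period 2 pi in the frequency. The terms [+ 0] match the offset d of
    [Rintegral_theta_mul_conj]. *)
Lemma theta_parseval m0 z s t : (forall y, m0 (y + 2 * pi) = m0 y) ->
  regular_frequency m0 z ->
  Re (theta phi (z + 0) (2 * s) * (theta phi (z + 0) (2 * t))^*%R) +
  Re (theta phi (z + pi) (2 * s) * (theta phi (z + pi) (2 * t))^*%R) =
  Re (theta phi (2 * z + 0) s * (theta phi (2 * z + 0) t)^*%R) +
  Re (theta psi (2 * z + 0) s * (theta psi (2 * z + 0) t)^*%R).
Proof.
move=> m0p hz; have q := quadrature_mirror m0p hz; have [h0 _ _ _] := hz.
have m2p : m0 (z + pi + pi) = m0 z by rewrite -addrA -[pi + pi]mulr2n -mulr_natl m0p.
have q1 : sqnormc (m0 (z + pi)) + sqnormc (m0 (z + pi + pi)) = 1 by rewrite m2p addrC.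
have h1 : two_scale_at m0 (z + pi).
  move=> m; have := h0 (m + 1).
  by rewrite (_ : z + pi * (m + 1)%:~R = z + pi + pi * m%:~R) // intrD; ring.
rewrite !addr0 -!ReD (theta_transform s m0p h0 q) (theta_transform t m0p h0 q).
rewrite (theta_transform s m0p h1 q1) (theta_transform t m0p h1 q1) m2p.
rewrite (_ : 2 * (z + pi) = 2 * z + 2 * pi); last by ring.
rewrite !theta_periodic cisD cis_pi mulrN1 !mulrN !mulNr unitary_mix //.
by rewrite cisJ cisNM.
Qed.

(** Integrate [theta_parseval] at z = 2 pi x over x in [0, 1[. The exceptional null set disappears,
    so the identity holds for all s and t; the two phi terms on the left have equal integrals, hence
    the factor 2. *)
Lemma kernel_two_scale m0 s t : refinement_mask phi m0 ->
  {ae mu, forall y, fourier psi y =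
      (m0 (y / 2 + pi))^*%R * cis (- (y / 2)) * fourier phi (y / 2)} ->
  {ae mu, forall y : R,
        (\esum_(k in [set: int])
           (sqnormc (fourier phi (y + 2 * pi * k%:~R)))%:E = 1)%E} ->
  2 * zsum (fun k => phi (2 * s - k%:~R) * phi (2 * t - k%:~R)) =
  zsum (fun k => phi (s - k%:~R) * phi (t - k%:~R)) +
  zsum (fun k => psi (s - k%:~R) * psi (t - k%:~R)).
Proof.
move=> rm hpsi hsum; have [[m0p _ _ _] _] := rm.
have hreg := ae_regular_frequency rm hpsi hsum.
have [E1 I1] := @Rintegral_theta_mul_conj R phi 1 0 (2 * s) (2 * t) ephi isT.
have [E2 I2] := @Rintegral_theta_mul_conj R phi 1 pi (2 * s) (2 * t) ephi isT.
have [E3 I3] := @Rintegral_theta_mul_conj R phi 2 0 s t ephi isT.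
have [E4 I4] := @Rintegral_theta_mul_conj R psi 2 0 s t epsi isT.
pose D : set (measurableTypeR R) := `[0, 1[%classic.
have mD : measurable D by exact: measurable_itv.
have EL := RintegralD mD I1 I2; have ER := RintegralD mD I3 I4.
apply: (@etrans _ _ _ _ _ (etrans ER (congr2 +%R E3 E4))).
have -> : forall x : R, 2 * x = x + x by move=> x; rewrite mulr_natl mulr2n.
apply: (etrans (esym (etrans EL (congr2 +%R E1 E2)))).
apply: (ae_eq_Rintegral mD).
- exact: (integrableD mD I1 I2).
- exact: (integrableD mD I3 I4).
have p0 : 0 < 2 * pi :> R by rewrite mulr_gt0 ?pi_gt0.
apply: aeS (ae_affine 0 p0 hreg) => x; rewrite addr0 => hx _.
rewrite mulr1 (_ : 2 * pi * 2%:~R * x = 2 * (2 * pi * x)); last by ring.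
exact: theta_parseval.
Qed.

End kernel_identity.
End quadrature_mirror.

(** * Normalization of the scaling function *)

Section reproducing_kernel.
Local Open Scope complex_scope.
Context {R : realType}.
Local Notation mu := (@lebesgue_measure R).

(* One of the distances from [s] and from [t] to an integer is at least
   |s - t| / 2. *)
Lemma envelope_kernel_bound (Psi : R -> R) : envelope Psi ->
  exists2 M, 0 <= M & forall g : R -> R, (forall x, `|g x| <= Psi `|x|) ->
    forall K s t, sum_abs_le K (fun k => `|g (s - k%:~R) * g (t - k%:~R)|) <=
      M * Psi (`|s - t| / 2).
Proof.
move=> eP; have [M hM] := envelope_lattice eP; have [P0 Pd _] := eP.
have M0 : 0 <= M.
  by apply: le_trans (hM 0 0%N); apply: sum_abs_le_ge0 => k; exact: P0.
exists (2 * M); first by rewrite mulr_ge0.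
move=> g gP K s t.
have h k : `|g (s - k%:~R) * g (t - k%:~R)| <=
    Psi (`|s - t| / 2) * (Psi `|s - k%:~R| + Psi `|t - k%:~R|).
  rewrite normrM; apply: (@le_trans _ _ (Psi `|s - k%:~R| * Psi `|t - k%:~R|)).
    by apply: ler_pM.
  have st : `|s - t| <= `|s - k%:~R| + `|t - k%:~R|.
    by have := ler_normB (s - k%:~R) (t - k%:~R); rewrite opprB addrA subrK.
  have p1 := P0 _ (normr_ge0 (s - k%:~R)); have p2 := P0 _ (normr_ge0 (t - k%:~R)).
  have st0 : 0 <= `|s - t| / 2 by rewrite divr_ge0.
  have p3 := P0 _ st0.
  have [a|a] := leP (`|s - t| / 2) `|s - k%:~R|.
    have q := Pd _ _ st0 a; apply: (@le_trans _ _ (Psi (`|s - t| / 2) * Psi `|t - k%:~R|)).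
      exact: ler_wpM2r.
    by rewrite ler_wpM2l // lerDr.
  have b : `|s - t| / 2 <= `|t - k%:~R| by lra.
  have q := Pd _ _ st0 b; rewrite mulrC.
  apply: (@le_trans _ _ (Psi (`|s - t| / 2) * Psi `|s - k%:~R|)).
    exact: ler_wpM2r.
  by rewrite ler_wpM2l // lerDl.
apply: le_trans (ler_sum_abs_le K h) _.
rewrite sum_abs_leZ sum_abs_leD mulrC ler_wpM2r ?P0 ?divr_ge0 //.
by have := hM s K; have := hM t K; lra.
Qed.

(** For orthonormal translates, the kernel of the orthogonal projection onto their closed span. *)
Definition kern (g : R -> R) (s t : R) : R :=
  zsum (fun k => g (s - k%:~R) * g (t - k%:~R)).

Lemma kern_summable (g : R -> R) s t : enveloped g ->
  zsummable (fun k => g (s - k%:~R) * g (t - k%:~R)).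
Proof.
move=> [_ [Psi eP gP]]; have [M _ hM] := envelope_kernel_bound eP.
by exists (M * Psi (`|s - t| / 2)) => K; exact: hM.
Qed.

Lemma envelope_shift (Psi : R -> R) (s : R) : envelope Psi ->
  mu.-integrable setT (EFin \o (fun t => Psi (`|s - t| / 2))).
Proof.
move=> eP; have h2 : 0 < 2^-1 :> R by rewrite invr_gt0.
have := integrable_affine (- s / 2) h2 (envelope_integrable eP).
apply: eq_integrable => // t _ /=.
rewrite (_ : 2^-1 * t + - s / 2 = (t - s) / 2); last by ring.
by rewrite normrM distrC [`|2^-1|]gtr0_norm.
Qed.

Lemma lebesgue_dominated (u : nat -> R -> R) (f g : R -> R) :
  (forall n, measurable_fun [set: R] (u n)) ->
  (forall t, u n t @[n --> \oo] --> f t) ->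
  mu.-integrable setT (EFin \o g) -> (forall n t, `|u n t| <= g t) ->
  mu.-integrable setT (EFin \o f) /\
  \int[mu]_t u n t @[n --> \oo] --> \int[mu]_t f t.
Proof.
move=> mu_ uf ig ug; split.
  by apply: (@Rdominated_integrable _ _ _ mu setT measurableT u f g) => //.
by apply: (@Rdominated_cvg _ _ _ mu setT measurableT u f g) => //.
Qed.

Lemma kern_Rintegral (g : R -> R) s : enveloped g ->
  mu.-integrable setT (EFin \o kern g s) /\
  \int[mu]_t kern g s t = per g s * \int[mu]_x g x.
Proof.
move=> eg; have [cg [Psi eP gP]] := eg; have [M M0 hM] := envelope_kernel_bound eP.
pose u K t := sum_abs_le K (fun k => g (s - k%:~R) * g (t - k%:~R)).
have ig k : mu.-integrable setT (EFin \o (fun t => g (s - k%:~R) * g (t - k%:~R))).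
  have := enveloped_integrable (enveloped_affine (- k%:~R) ltr01 eg).
  move=> /(integrableZl measurableT (g (s - k%:~R))).
  by apply: eq_integrable => // t _ /=; rewrite mul1r.
have mu_ K : measurable_fun [set: R] (u K).
  by have [_ /(measurable_int mu) /measurable_EFinP] := Rintegral_sum_abs_le K measurableT ig.
have cu t : u K t @[K --> \oo] --> kern g s t.
  by apply: zsum_cvg; exact: kern_summable.
have iB : mu.-integrable setT (EFin \o (fun t => M * Psi (`|s - t| / 2))).
  have := integrableZl measurableT M (envelope_shift s eP).
  by apply: eq_integrable.
have uB K t : `|u K t| <= M * Psi (`|s - t| / 2).
  by apply: le_trans (ler_norm_sum_abs_le _ _) _; exact: hM.
have [iK c1] := lebesgue_dominated mu_ cu iB uB.
split => //.
rewrite -(cvg_lim (@Rhausdorff R) c1).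
apply: (cvg_lim (@Rhausdorff R)).
have uE : (fun K => \int[mu]_t u K t) =
    (fun K => sum_abs_le K (fun k => g (s - k%:~R)) * \int[mu]_x g x).
  apply/funext => K; have [-> _] := Rintegral_sum_abs_le K measurableT ig.
  rewrite mulrC -sum_abs_leZ; apply: eq_sum_abs_le => k.
  have := Rintegral_affine (- k%:~R) ltr01 (enveloped_integrable eg).
  rewrite invr1 mul1r mulrC => <-; rewrite -RintegralZl //.
    by apply: eq_Rintegral => t _; rewrite mul1r.
  exact: enveloped_integrable (enveloped_affine (- k%:~R) ltr01 eg).
rewrite uE; apply: cvgMr_tmp; apply: zsum_cvg; exact: per_summable.
Qed.

Lemma ae_exists_itv (Q : R -> Prop) (a b : R) : {ae mu, forall x, Q x} -> a < b ->
  exists2 y, a < y < b & Q y.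
Proof.
move=> [N [mN N0 QN]] ab; apply: contrapT => hn.
have : (mu `]a, b[%classic <= mu N)%E.
  apply: le_measure; rewrite ?inE //.
  move=> y /=; rewrite in_itv /= => y0; apply: QN => /= Qy.
  by apply: hn; exists y.
by rewrite N0 lebesgue_measure_itv /= lte_fin ab -EFinB lee_fin subr_le0 leNgt ab.
Qed.

(** Lets an almost-everywhere identity be used in the limit at 0. *)
Lemma ae_dense_seq (Q : R -> Prop) : {ae mu, forall x, Q x} ->
  exists2 y : nat -> R, y n @[n --> \oo] --> 0 & forall n, Q (y n).
Proof.
move=> hQ; have h n : exists y, 0 < y < n.+1%:R^-1 /\ Q y.
  have e0 : 0 < n.+1%:R^-1 :> R by rewrite invr_gt0.
  by have [y ? ?] := ae_exists_itv hQ e0; exists y.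
have [y hy] := choice h; exists y => [|n]; last by have [] := hy n.
apply: (squeeze_cvgr _ (cvg_cst 0) (@cvg_harmonic R)).
by apply: nearW => n; have [/andP[a b] _] := hy n; rewrite /= !ltW.
Qed.

End reproducing_kernel.

Section normalization.
Local Open Scope complex_scope.
Context {R : realType}.
Local Notation mu := (@lebesgue_measure R).
Local Notation Re := complex.Re.
Local Notation Im := complex.Im.

Lemma fourier_cvg (g : R -> R) (y : nat -> R) : enveloped g ->
  y n @[n --> \oo] --> 0 ->
  Re (fourier g (y n)) @[n --> \oo] --> \int[mu]_x g x /\
  Im (fourier g (y n)) @[n --> \oo] --> 0.
Proof.
move=> eg y0; have ig := enveloped_integrable eg.
have in_ : mu.-integrable setT (EFin \o (fun x => `|g x|)) by exact: integrable_norm ig.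
have yx x : y n * x @[n --> \oo] --> 0.
  by rewrite -(mul0r x); apply: cvgMr_tmp.
have [cg _] := eg.
have [_ c1] : mu.-integrable setT (EFin \o g) /\
    \int[mu]_x (cos (y n * x) * g x) @[n --> \oo] --> \int[mu]_x g x.
  apply: (lebesgue_dominated _ _ in_) => [n|x|n x].
  - apply: continuous_measurable_fun => x; apply: cvgM; last exact: cg.
    exact: continuous_cos_lin.
  - rewrite -[X in _ --> X]mul1r -(cos0 R); apply: cvgMr_tmp.
    by apply: (cvg_continuous_comp (@continuous_cos R)).
  - by rewrite normrM ler_piMl // cos_max.
have [_ c2] : mu.-integrable setT (EFin \o (fun _ : R => 0 : R)) /\
    \int[mu]_x (sin (y n * x) * g x) @[n --> \oo] --> \int[mu]_x (0 : R).
  apply: (lebesgue_dominated _ _ in_) => [n|x|n x].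
  - apply: continuous_measurable_fun => x; apply: cvgM; last exact: cg.
    exact: continuous_sin_lin.
  - rewrite -(mul0r (g x)) -(sin0 R); apply: cvgMr_tmp.
    by apply: (cvg_continuous_comp (@continuous_sin R)).
  - by rewrite normrM ler_piMl // sin_max.
split; first exact: c1.
by rewrite -oppr0; apply: cvgN; move: c2; rewrite Rintegral_cst // mul0r.
Qed.

Lemma theta_cvg (g : R -> R) (y : nat -> R) u : enveloped g ->
  y n @[n --> \oo] --> 0 ->
  Re (theta g (y n) u) @[n --> \oo] --> per g u /\
  Im (theta g (y n) u) @[n --> \oo] --> 0.
Proof.
move=> eg y0; have [M hM] := per_summable u eg.
have sh : zsummable (fun k => `|g (u - k%:~R)|).
  by exists M => K; under eq_sum_abs_le do rewrite normr_id.
have yx x : y n * x @[n --> \oo] --> 0.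
  by rewrite -(mul0r x); apply: cvgMr_tmp.
split.
- apply: (@zsum_dominated_cvg _ nat \oo _ _ _ _ sh).
    by apply: nearW => n k; rewrite ReM /= mulr0 subr0 normrM ler_piMl // cos_max.
  move=> k; rewrite (_ : (fun n => _) = (fun n => cos (y n * k%:~R) * g (u - k%:~R))).
    rewrite -[X in _ --> X]mul1r -(cos0 R); apply: cvgMr_tmp.
    by apply: (cvg_continuous_comp (@continuous_cos R)).
  by apply/funext => n; rewrite ReM /= mulr0 subr0.
- have <- : zsum (fun _ : int => 0) = 0 :> R.
    by apply: zsum_unique; under eq_fun do rewrite /sum_abs_le big1 //; exact: cvg_cst.
  apply: (@zsum_dominated_cvg _ nat \oo _ _ _ _ sh).
    by apply: nearW => n k; rewrite ImM /= mulr0 add0r normrM ler_piMl // sin_max.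
  move=> k; rewrite (_ : (fun n => _) = (fun n => sin (y n * k%:~R) * g (u - k%:~R))).
    rewrite -(mul0r (g (u - k%:~R))) -(sin0 R); apply: cvgMr_tmp.
    by apply: (cvg_continuous_comp (@continuous_sin R)).
  by apply/funext => n; rewrite ImM /= mulr0 add0r.
Qed.

(** Up to a phase of modulus 1, the Zak transform is a periodization, so its Fourier coefficients in
    u are values of the Fourier transform of g. *)
Lemma theta_cper (g : R -> R) z u : enveloped g ->
  cis (- z * u) * theta g z u = cper (fun x => cis (- z * x) * (g x)%:C) u.
Proof.
move=> eg; rewrite /theta -czsumZ; last exact: theta_summable.
apply: eq_czsum => k; rewrite mulrA -cisD; congr (cis _ * _); ring.
Qed.

Lemma cper_coefficient (G : R -> R[i]) (m : int) : cenveloped G ->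
  let E u := cper G u * cis (- (2 * pi * m%:~R * u)) in
  let c := cint (fun x => cis (- (2 * pi * m%:~R * x)) * G x) in
  \int[mu]_(u in `[0, 1[) Re (E u) = Re c /\
  \int[mu]_(u in `[0, 1[) Im (E u) = Im c.
Proof.
move=> [Gr Gi] E c.
have pc x (k : int) : cos (2 * pi * m%:~R * (x - k%:~R)) = cos (2 * pi * m%:~R * x) :> R.
  rewrite (_ : 2 * pi * m%:~R * (x - k%:~R) = 2 * pi * m%:~R * x + 2 * pi * (- (m * k))%:~R).
    by rewrite cosD2piZ.
  by rewrite intrN intrM; ring.
have ps x (k : int) : sin (2 * pi * m%:~R * (x - k%:~R)) = sin (2 * pi * m%:~R * x) :> R.
  rewrite (_ : 2 * pi * m%:~R * (x - k%:~R) = 2 * pi * m%:~R * x + 2 * pi * (- (m * k))%:~R).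
    by rewrite sinD2piZ.
  by rewrite intrN intrM; ring.
have cc : continuous (fun x : R => cos (2 * pi * m%:~R * x)) by exact: continuous_cos_lin.
have cs : continuous (fun x : R => sin (2 * pi * m%:~R * x)) by exact: continuous_sin_lin.
have uc H : enveloped H -> \int[mu]_(s in `[0, 1[) (per H s * cos (2 * pi * m%:~R * s)) =
    \int[mu]_x (H x * cos (2 * pi * m%:~R * x)).
  move=> eH; rewrite -(integral_unfold (M := 1) 0 eH cc) ?add0r // => x.
  exact: cos_max.
have us H : enveloped H -> \int[mu]_(s in `[0, 1[) (per H s * sin (2 * pi * m%:~R * s)) =
    \int[mu]_x (H x * sin (2 * pi * m%:~R * x)).
  move=> eH; rewrite -(integral_unfold (M := 1) 0 eH cs) ?add0r // => x.
  exact: sin_max.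
have ic H (eH : enveloped H) : mu.-integrable `[0, 1[
    (EFin \o (fun s => per H s * cos (2 * pi * m%:~R * s))).
  by apply: integrable_itv_co => s; apply: cvgM; [exact: per_continuous|exact: cc].
have is_ H (eH : enveloped H) : mu.-integrable `[0, 1[
    (EFin \o (fun s => per H s * sin (2 * pi * m%:~R * s))).
  by apply: integrable_itv_co => s; apply: cvgM; [exact: per_continuous|exact: cs].
have ec (H : R -> R) (eH : enveloped H) := enveloped_integrable (enveloped_cos (2 * pi * m%:~R) eH).
have es (H : R -> R) (eH : enveloped H) := enveloped_integrable (enveloped_sin (2 * pi * m%:~R) eH).
have mI : measurable (`[0, 1[%classic : set (measurableTypeR R)) by exact: measurable_itv.
split.
- transitivity (\int[mu]_(u in `[0, 1[) (per (fun x => Re (G x)) u * cos (2 * pi * m%:~R * u) +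
      per (fun x => Im (G x)) u * sin (2 * pi * m%:~R * u))).
    by apply: eq_Rintegral => u _; rewrite /E ReM /cis /= cosN sinN mulrN opprK.
  rewrite (RintegralD mI (ic _ Gr) (is_ _ Gi)) uc // us //.
  rewrite -(RintegralD measurableT (ec _ Gr) (es _ Gi)).
  by apply: eq_Rintegral => u _; rewrite ReM /cis /= cosN sinN; ring.
- transitivity (\int[mu]_(u in `[0, 1[) (per (fun x => Im (G x)) u * cos (2 * pi * m%:~R * u) -
      per (fun x => Re (G x)) u * sin (2 * pi * m%:~R * u))).
    by apply: eq_Rintegral => u _; rewrite /E ImM -[Re (cper G u)]/(per (fun x => Re (G x)) u)
      -[Im (cper G u)]/(per (fun x => Im (G x)) u) /cis /= cosN sinN mulrN; ring.
  rewrite (RintegralB mI (ic _ Gi) (is_ _ Gr)) uc // us //.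
  rewrite -(RintegralB measurableT (ec _ Gi) (es _ Gr)).
  by apply: eq_Rintegral => u _; rewrite ImM /cis /= cosN sinN; ring.
Qed.

Lemma sqnormcMJ (z : R[i]) : sqnormc z = Re (z * z^*%R).
Proof. by rewrite ReM ReJ ImJ /sqnormc; ring. Qed.

Lemma cper_continuous (G : R -> R[i]) : cenveloped G ->
  continuous (fun u => Re (cper G u)) /\ continuous (fun u => Im (cper G u)).
Proof.
move=> [Gr Gi]; split.
  exact: (@per_continuous R (fun x => Re (G x)) Gr).
exact: (@per_continuous R (fun x => Im (G x)) Gi).
 Qed.

Lemma continuous_csum_cis (K : nat) (c : int -> R[i]) :
  let A u := csum_abs_le K (fun m => c m * cis (2 * pi * m%:~R * u)) in
  continuous (fun u => Re (A u)) /\ continuous (fun u => Im (A u)).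
Proof.
have h (f : int -> R -> R) : (forall m, continuous (f m)) ->
    continuous (fun u => sum_abs_le K (fun m => f m u)).
  by move=> cf u; apply: cvg_sum_abs_le => k; exact: cf.
move=> A; split; apply: h => m u.
- rewrite (_ : (fun v => _) = (fun v => Re (c m) * cos (2 * pi * m%:~R * v) -
    Im (c m) * sin (2 * pi * m%:~R * v))); last by apply/funext => v; rewrite ReM.
  by apply: cvgB; apply: cvgMl_tmp; [exact: continuous_cos_lin|exact: continuous_sin_lin].
- rewrite (_ : (fun v => _) = (fun v => Re (c m) * sin (2 * pi * m%:~R * v) +
    Im (c m) * cos (2 * pi * m%:~R * v))); last by apply/funext => v; rewrite ImM.
  by apply: cvgD; apply: cvgMl_tmp; [exact: continuous_sin_lin|exact: continuous_cos_lin].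
Qed.

(** Expand the integral of |cper G - A|^2 >= 0, with A the truncated Fourier series: the cross term
    and the square of A both integrate to N. *)
Lemma bessel (G : R -> R[i]) (K : nat) : cenveloped G ->
  sum_abs_le K (fun m => sqnormc (cint (fun x => cis (- (2 * pi * m%:~R * x)) * G x))) <=
  \int[mu]_(u in `[0, 1[) sqnormc (cper G u).
Proof.
move=> eG; pose c m := cint (fun x => cis (- (2 * pi * m%:~R * x)) * G x).
pose A u := csum_abs_le K (fun m => c m * cis (2 * pi * m%:~R * u)).
have [cAr cAi] := continuous_csum_cis K c.
have [cPr cPi] := cper_continuous eG.
pose D : set (measurableTypeR R) := `[0, 1[%classic.
have mD : measurable D by exact: measurable_itv.
pose N := sum_abs_le K (fun m => sqnormc (c m)).
have EAA : \int[mu]_(u in D) sqnormc (A u) = N.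
  have [E _] := @Rintegral_csum_mul_conj R 1 K c c isT.
  rewrite /N; transitivity (sum_abs_le K (fun m => Re (c m * (c m)^*%R))).
    rewrite -E; apply: eq_Rintegral => u _; rewrite sqnormcMJ /A.
    by congr (Re (csum_abs_le K _ * (csum_abs_le K _)^*%R)); apply/funext => m; rewrite mul1r.
  by apply: eq_sum_abs_le => m; rewrite sqnormcMJ.
pose X u := Re (cper G u) * Re (A u) + Im (cper G u) * Im (A u).
have cX : continuous X.
  by move=> u; apply: cvgD; apply: cvgM; [exact: cPr|exact: cAr|exact: cPi|exact: cAi].
have iPm (f : R -> R) : continuous f -> mu.-integrable D (EFin \o f).
  by move=> cf; exact: integrable_itv_co.
have EX : \int[mu]_(u in D) X u = N.
  pose E m u := cper G u * cis (- (2 * pi * m%:~R * u)).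
  pose x m u := Re (c m) * Re (E m u) + Im (c m) * Im (E m u).
  have cE m : continuous (fun u => Re (E m u)) /\ continuous (fun u => Im (E m u)).
    split => u.
    - rewrite (_ : (fun v => _) = (fun v => Re (cper G v) * cos (2 * pi * m%:~R * v) +
         Im (cper G v) * sin (2 * pi * m%:~R * v))).
        by apply: cvgD; apply: cvgM; [exact: cPr|exact: continuous_cos_lin|
          exact: cPi|exact: continuous_sin_lin].
      by apply/funext => v; rewrite ReM /cis /= cosN sinN; ring.
    - rewrite (_ : (fun v => _) = (fun v => Im (cper G v) * cos (2 * pi * m%:~R * v) -
         Re (cper G v) * sin (2 * pi * m%:~R * v))).
        by apply: cvgB; apply: cvgM; [exact: cPi|exact: continuous_cos_lin|
          exact: cPr|exact: continuous_sin_lin].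
      by apply/funext => v; rewrite ImM /cis /= cosN sinN; ring.
  have i1 m : mu.-integrable D (EFin \o (fun u => Re (c m) * Re (E m u))).
    by apply: iPm => u; apply: cvgMl_tmp; exact: (cE m).1.
  have i2 m : mu.-integrable D (EFin \o (fun u => Im (c m) * Im (E m u))).
    by apply: iPm => u; apply: cvgMl_tmp; exact: (cE m).2.
  have ix m : mu.-integrable D (EFin \o x m).
    by apply: iPm => u; apply: cvgD; apply: cvgMl_tmp; [exact: (cE m).1|exact: (cE m).2].
  have [Es _] := Rintegral_sum_abs_le K mD ix.
  transitivity (\int[mu]_(u in D) sum_abs_le K (fun m => x m u)).
    apply: eq_Rintegral => u _; rewrite /X /A /csum_abs_le /=.
    rewrite -!sum_abs_leZ -sum_abs_leD; apply: eq_sum_abs_le => m.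
    by rewrite /x /E !(ReM, ImM) /cis /= cosN sinN; ring.
  rewrite Es; apply: eq_sum_abs_le => m.
  rewrite (RintegralD mD (i1 m) (i2 m)) RintegralZl //; last exact: iPm (cE m).1.
  rewrite RintegralZl //; last exact: iPm (cE m).2.
  by have [-> ->] := cper_coefficient m eG; rewrite -!expr2.
have cP2 : continuous (fun u => sqnormc (cper G u)).
  by move=> u; apply: cvgD; apply: cvgM; [exact: cPr|exact: cPr|exact: cPi|exact: cPi].
have cA2 : continuous (fun u => sqnormc (A u)).
  by move=> u; apply: cvgD; apply: cvgM; [exact: cAr|exact: cAr|exact: cAi|exact: cAi].
have : 0 <= \int[mu]_(u in D) (sqnormc (cper G u) + sqnormc (A u) - 2 * X u).
  apply: Rintegral_ge0 => u _; rewrite /X /sqnormc.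
  have -> : forall a b c d : R, a ^+ 2 + b ^+ 2 + (c ^+ 2 + d ^+ 2) - 2 * (a * c + b * d) =
    (a - c) ^+ 2 + (b - d) ^+ 2 by move=> *; ring.
  by rewrite addr_ge0 ?sqr_ge0.
have iPA : mu.-integrable D (EFin \o (fun u => sqnormc (cper G u) + sqnormc (A u))).
  by apply: iPm => u; apply: cvgD; [exact: cP2|exact: cA2].
have iX2 : mu.-integrable D (EFin \o (fun u => 2 * X u)).
  by apply: iPm => u; apply: cvgMl_tmp; exact: cX.
rewrite (RintegralB mD iPA iX2) (RintegralD mD (iPm _ cP2) (iPm _ cA2)).
rewrite (RintegralZl _ mD (iPm _ cX)) EAA EX; rewrite -/D -/N; lra.
Qed.

Lemma sum_abs_le_zsum (F : int -> R) K : (forall k, 0 <= F k) -> zsummable F ->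
  sum_abs_le K F <= zsum F.
Proof.
move=> F0 sF; have c := zsum_cvg sF.
rewrite -(cvg_lim (@Rhausdorff R) c).
apply: nondecreasing_cvgn_le; first exact: sum_abs_le_nd.
by apply/cvg_ex; eexists; exact: c.
Qed.

Lemma sqnormc_fourier_cvg (g : R -> R) (y : nat -> R) : enveloped g ->
  y n @[n --> \oo] --> 0 ->
  sqnormc (fourier g (y n)) @[n --> \oo] --> (\int[mu]_x g x) ^+ 2.
Proof.
move=> eg y0; have [cr ci] := fourier_cvg eg y0.
rewrite -[X in _ --> X]addr0 -[X in _ --> _ + X](mulr0 0).
by apply: cvgD; apply: cvgM.
Qed.

Variables (phi psi : R -> R) (m0 : R -> R[i]).
Hypothesis ephi : enveloped phi.
Hypothesis epsi : enveloped psi.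
Hypothesis mask : refinement_mask phi m0.
Hypothesis hpsi : {ae mu, forall y, fourier psi y =
      (m0 (y / 2 + pi))^*%R * cis (- (y / 2)) * fourier phi (y / 2)}.
Hypothesis hsum : {ae mu, forall y : R,
        (\esum_(k in [set: int])
           (sqnormc (fourier phi (y + 2 * pi * k%:~R)))%:E = 1)%E}.
Hypothesis phi0 : fourier phi 0 != 0.

Let hreg := ae_regular_frequency mask hpsi hsum.
Let m0p : forall y, m0 (y + 2 * pi) = m0 y.
Proof. by case: mask => -[]. Qed.

Let twice (y : nat -> R) : y n @[n --> \oo] --> 0 -> 2 * y n @[n --> \oo] --> 0.
Proof. by move=> y0; rewrite -(mulr0 2); apply: cvgMl_tmp. Qed.

(* At almost every [z], |phi^ z|^2 - |phi^ (2 z)|^2 = |psi^ (2 z)|^2; let [z] tend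
   to 0. *)
Lemma mwavelet_Rintegral : \int[mu]_x psi x = 0.
Proof.
have [y y0 hy] := ae_dense_seq hreg.
have c1 := sqnormc_fourier_cvg ephi y0.
have c2 := sqnormc_fourier_cvg ephi (twice y0).
have c3 := sqnormc_fourier_cvg epsi (twice y0).
have E n : sqnormc (fourier phi (y n)) - sqnormc (fourier phi (2 * y n)) =
    sqnormc (fourier psi (2 * y n)).
  have [h _ _ _] := hy n; have q := quadrature_mirror m0p (hy n).
  have := h 0; rewrite mulr0 addr0 => -[-> ->].
  rewrite !sqnormcM (_ : sqnormc (cis _) = 1); last first.
    by rewrite sqnormcMJ cisJ -cisD subrr cis0.
  rewrite (_ : sqnormc (_^*%R) = sqnormc (m0 (y n + pi))); last first.
    by rewrite /sqnormc ReJ ImJ sqrrN.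
  have -> : sqnormc (m0 (y n)) = 1 - sqnormc (m0 (y n + pi)) by rewrite -q addrK.
  ring.
have c4 : sqnormc (fourier phi (y n)) - sqnormc (fourier phi (2 * y n)) @[n --> \oo] --> 0.
  by rewrite -[X in _ --> X](subrr ((\int[mu]_x phi x) ^+ 2)); exact: cvgB.
have e4 : (fun n => sqnormc (fourier phi (y n)) - sqnormc (fourier phi (2 * y n))) =
    (fun n => sqnormc (fourier psi (2 * y n))) by apply/funext.
have : (\int[mu]_x psi x) ^+ 2 = 0.
  rewrite -(cvg_lim (@Rhausdorff R) c3) -e4; exact: (cvg_lim (@Rhausdorff R) c4).
by move=> /eqP; rewrite sqrf_eq0 => /eqP.
Qed.

Lemma fwavelet_Rintegral_neq0 : \int[mu]_x phi x != 0.
Proof.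
apply: contra phi0 => /eqP i0; apply/eqP; rewrite /fourier.
have -> : (fun x : R => cos (0 * x) * phi x) = phi.
  by apply/funext => x; rewrite mul0r cos0 mul1r.
have -> : (fun x : R => sin (0 * x) * phi x) = (fun=> 0).
  by apply/funext => x; rewrite mul0r sin0 mul0r.
by rewrite i0 Rintegral_cst // mul0r; apply: complexP => /=; rewrite ?oppr0.
Qed.

(* Integrate the two-scale relation of the kernels in [t]; the wavelet term
   vanishes. *)
Let per_two s : per phi (2 * s) = per phi s.
Proof.
have [i1 e1] := kern_Rintegral (2 * s) ephi.
have [i2 e2] := kern_Rintegral s ephi.
have [i3 e3] := kern_Rintegral s epsi.
have two0 : 0 < 2 :> R by [].
have e4 := Rintegral_affine 0 two0 i1; have i4 := integrable_affine 0 two0 i1.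
have h : (fun t => 2 * kern phi (2 * s) (2 * t + 0)) =
    (fun t => kern phi s t + kern psi s t).
  by apply/funext => t; rewrite addr0; exact: (kernel_two_scale ephi epsi s t mask hpsi hsum).
have : \int[mu]_t (2 * kern phi (2 * s) (2 * t + 0)) =
    \int[mu]_t (kern phi s t + kern psi s t) by rewrite h.
rewrite (RintegralD measurableT i2 i3) (RintegralZl _ measurableT i4) e4 e1 e2 e3.
rewrite mwavelet_Rintegral mulr0 addr0 mulrA mulfV // mul1r.
by move=> /(mulIf fwavelet_Rintegral_neq0).
Qed.

(** Invariance under doubling carries s to 2^-n s, and the periodization is continuous at 0. *)
Let per_cst s : per phi s = per phi 0.
Proof.
have h n : per phi s = per phi (2 ^- n * s).
  elim: n => [|n IH]; first by rewrite expr0 invr1 mul1r.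
  rewrite IH -[RHS]per_two; congr per.
  by rewrite exprS invfM !mulrA mulfV // mul1r.
have c : 2 ^- n * s @[n --> \oo] --> 0.
  rewrite -(mul0r s); apply: cvgMr_tmp.
  under eq_fun do rewrite -exprVn.
  by apply: cvg_expr; rewrite gtr0_norm ?invf_lt1 ?invr_gt0 // ltr1n.
have c1 : per phi (2 ^- n * s) @[n --> \oo] --> per phi 0.
  exact: (cvg_continuous_comp (@per_continuous R phi ephi) c).
have e : (fun n => per phi (2 ^- n * s)) = (fun=> per phi s).
  by apply/funext => n; rewrite -h.
rewrite -(cvg_lim (@Rhausdorff R) c1) e.
by apply/esym/(cvg_lim (@Rhausdorff R)); exact: cvg_cst.
Qed.

(** A constant periodization equals its mean over a period, which unfolds to the integral on the
    line. *)
Lemma fwavelet_per s : per phi s = \int[mu]_x phi x.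
Proof.
have ct : continuous (cst 1 : R -> R) by exact: cst_continuous.
have : \int[mu]_(s in `[0, 0 + 1[) (per phi s * (cst 1 : R -> R) s) =
   \int[mu]_x (phi x * (cst 1 : R -> R) x).
  by apply: (integral_unfold (M := 1)) => // x; rewrite normr1.
rewrite add0r => e; transitivity (\int[mu]_x (phi x * (cst 1 : R -> R) x)); last first.
  by apply: eq_Rintegral => x _; rewrite mulr1.
rewrite -e (_ : (fun s => _) = cst (per phi s)); last first.
  by apply/funext => u /=; rewrite mulr1 per_cst [in RHS]per_cst.
by rewrite Rintegral_cst //= lebesgue_measure_itv /= lte_fin ltr01 -EFinB subr0 mulr1.
Qed.

(* The upper bound is the term 0 of the partition of unity; the lower bound is
   Bessel's inequality for [theta phi z], whose sum of squares is 1, as [z]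
   tends to 0. *)
Lemma fwavelet_Rintegral_sqr : (\int[mu]_x phi x) ^+ 2 = 1.
Proof.
have [y y0 hy] := ae_dense_seq hreg.
have c1 := sqnormc_fourier_cvg ephi y0.
apply/eqP; rewrite eq_le; apply/andP; split.
  rewrite -(cvg_lim (@Rhausdorff R) c1); apply: limr_le; first by apply/cvg_ex; eexists; exact: c1.
  apply: nearW => n; have [_ _ [sN eN] _] := hy n.
  have := sum_abs_le_zsum 0 (fun k => sqnormc_ge0 _) sN.
  by rewrite eN sum_abs_le0 mulr0 addr0.
have eth n u : sqnormc (cper (fun x => cis (- y n * x) * (phi x)%:C) u) =
    sqnormc (theta phi (y n) u).
  rewrite -theta_cper // sqnormcM (_ : sqnormc (cis _) = 1) ?mul1r //.
  by rewrite sqnormcMJ cisJ -cisD subrr cis0.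
have eG n : cenveloped (fun x => cis (- y n * x) * (phi x)%:C).
  by apply: cenveloped_cis; exact: cenveloped_real.
have b2 n K : sum_abs_le K (fun k => sqnormc (fourier phi (y n + 2 * pi * k%:~R))) <=
    \int[mu]_(u in `[0, 1[) sqnormc (theta phi (y n) u).
  have := bessel K (eG n).
  rewrite (@eq_Rintegral _ _ _ mu _ (fun u => sqnormc (theta phi (y n) u))); last first.
    by move=> u _; rewrite eth.
  apply: le_trans; rewrite le_eqVlt; apply/orP; left; apply/eqP.
  apply: eq_sum_abs_le => m.
  rewrite fourierE //; congr sqnormc; apply: eq_cint => x.
  by rewrite mulrA -cisD; congr (cis _ * _); ring.
have b1 n : 1 <= \int[mu]_(u in `[0, 1[) sqnormc (theta phi (y n) u).
  have [_ _ [sN eN] _] := hy n; have c := zsum_cvg sN.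
  rewrite -[leLHS]eN -(cvg_lim (@Rhausdorff R) c); apply: limr_le.
    by apply/cvg_ex; eexists; exact: c.
  exact: nearW.
have [B hB] := enveloped_sum_bound ephi.
pose D : set (measurableTypeR R) := `[0, 1[%classic.
have mD : measurable D by exact: measurable_itv.
(* A bound uniform in n, so that the integrals of |theta|^2, all at least 1, converge to the
   integral of the constant (per phi)^2. *)
have bth n u : `|sqnormc (theta phi (y n) u)| <= B ^+ 2 + B ^+ 2.
  have [sr si] := theta_summable (y n) u ephi.
  have hb (v : int -> R) : (forall k, `|v k| <= `|phi (u - k%:~R)|) -> `|zsum v| <= B.
    move=> vp; apply: ler_norm_zsum => K; apply: le_trans (hB u K).
    exact: ler_sum_abs_le.
  have h1 : `|Re (theta phi (y n) u)| <= B.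
    by apply: hb => k; rewrite ReM /= mulr0 subr0 normrM ler_piMl // cos_max.
  have h2 : `|Im (theta phi (y n) u)| <= B.
    by apply: hb => k; rewrite ImM /= mulr0 add0r normrM ler_piMl // sin_max.
  have B0 : 0 <= B := le_trans (normr_ge0 _) h1.
  rewrite ger0_norm ?sqnormc_ge0 // /sqnormc lerD //.
    by rewrite -[leLHS]real_normK ?num_real // lerXn2r ?nnegrE.
  by rewrite -[leLHS]real_normK ?num_real // lerXn2r ?nnegrE.
have iB : mu.-integrable D (EFin \o (fun _ : R => B ^+ 2 + B ^+ 2)).
  by apply: integrable_itv_co; exact: cst_continuous.
have cth u : D u -> sqnormc (theta phi (y n) u) @[n --> \oo] --> (\int[mu]_x phi x) ^+ 2.
  move=> _; have [cr ci] := theta_cvg u ephi y0; rewrite fwavelet_per in cr.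
  rewrite -[X in _ --> X]addr0 -[X in _ --> _ + X](mulr0 0).
  by apply: cvgD; apply: cvgM.
have mth n : measurable_fun D (fun u => sqnormc (theta phi (y n) u)).
  have -> : (fun u => sqnormc (theta phi (y n) u)) =
      (fun u => sqnormc (cper (fun x => cis (- y n * x) * (phi x)%:C) u)).
    by apply/funext => u; rewrite eth.
  apply: measurable_funTS; apply: continuous_measurable_fun => u.
  have [c2 c3] := cper_continuous (eG n).
  by apply: cvgD; apply: cvgM; [exact: c2|exact: c2|exact: c3|exact: c3].
have c2 := @Rdominated_cvg _ _ _ mu D mD _ _ _ mth cth iB (fun n u _ => bth n u).
rewrite Rintegral_cst //= lebesgue_measure_itv /= lte_fin ltr01 -EFinB subr0 mulr1 in c2.
rewrite -(cvg_lim (@Rhausdorff R) c2); apply: limr_ge.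
  by apply/cvg_ex; eexists; exact: c2.
exact: nearW.
Qed.

End normalization.

(** * Mean-square integrals *)

Section mean_value.
Context {R : realType}.
Local Notation mu := (@lebesgue_measure R).

Lemma integral_mean_value (h : R -> R) (x y : R) : continuous h -> x < y ->
  exists2 u, x <= u <= y & h u * (y - x) = \int[mu]_(s in `]x, y]) h s.
Proof.
move=> ch xy; have cw a b : {within `[a, b], continuous h} by exact: continuous_subspaceT.
have mI : measurable (`]x, y]%classic : set (measurableTypeR R)) by exact: measurable_itv.
have ih : mu.-integrable `]x, y] (EFin \o h).
  apply: (@integrableS _ _ _ mu `[x, y]) => //.
    by apply: subset_itvr; rewrite bnd_simp.
  by apply: continuous_compact_integrable => //; exact: segment_compact.
have ic (r : R) : mu.-integrable `]x, y] (EFin \o (fun _ : R => r)).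
  apply: (@integrableS _ _ _ mu `[x, y]) => //.
    by apply: subset_itvr; rewrite bnd_simp.
  apply: continuous_compact_integrable; first exact: segment_compact.
  by apply: continuous_subspaceT => ?; exact: cvg_cst.
have cE r : \int[mu]_(s in `]x, y]) (r : R) = r * (y - x).
  by rewrite Rintegral_cst //= lebesgue_measure_itv /= lte_fin xy -EFinB.
have [p pI pm] := EVT_min (ltW xy) (cw x y); have [q qI qm] := EVT_max (ltW xy) (cw x y).
set J := \int[mu]_(s in `]x, y]) h s.
have yx : 0 < y - x by rewrite subr_gt0.
have inI s : `]x, y]%classic s -> s \in `[x, y]%R.
  by rewrite /= !in_itv /= => /andP[/ltW -> ->].
have J1 : h p <= J / (y - x).
  rewrite ler_pdivlMr // -cE; apply: (le_Rintegral mI (ic _) ih) => s /inI; exact: pm.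
have J2 : J / (y - x) <= h q.
  rewrite ler_pdivrMr // -cE; apply: (le_Rintegral mI ih (ic _)) => s /inI; exact: qm.
move: pI qI; rewrite !in_itv /= => /andP[xp py] /andP[xq qy].
suff [u uI hu] : exists2 u, x <= u <= y & h u = J / (y - x).
  by exists u => //; rewrite hu mulfVK ?gt_eqF.
have [pq|qp] := leP p q.
  have [|u] := IVT pq (cw p q) (v := J / (y - x)).
    by rewrite ge_min J1 le_max J2 orbT.
  rewrite in_itv /= => /andP[pu uq] hu; exists u => //.
  by rewrite (le_trans xp) // (le_trans uq).
have [|u] := IVT (ltW qp) (cw q p) (v := J / (y - x)).
  by rewrite ge_min J1 le_max J2 !orbT.
rewrite in_itv /= => /andP[pu uq] hu; exists u => //.
by rewrite (le_trans xq) // (le_trans uq).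
Qed.

(* The tags are given by the mean value theorem. *)
Lemma exact_riemann_sum (h : R -> R) (a b delta : R) : continuous h -> a < b ->
  0 < delta ->
  exists N (s u : nat -> R), [/\ s 0%N = a, s N = b,
    (forall i, (i < N)%N -> s i <= u i <= s i.+1 /\ s i.+1 - s i < delta) &
    \sum_(i < N) h (u i) * (s i.+1 - s i) = \int[mu]_(x in `]a, b]) h x].
Proof.
move=> ch ab d0; have ba : 0 < b - a by rewrite subr_gt0.
pose N := (Num.truncn ((b - a) / delta)).+1.
have hN : (b - a) / N%:R < delta.
  by rewrite ltr_pdivrMr // mulrC -ltr_pdivrMr // /N truncnS_gt.
pose s i : R := a + i%:R * ((b - a) / N%:R).
have st i : s i.+1 - s i = (b - a) / N%:R by rewrite /s -natr1; ring.
have lt_s i : s i < s i.+1 by rewrite -subr_gt0 st divr_gt0.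
have hu i : exists u, s i <= u <= s i.+1 /\
    h u * (s i.+1 - s i) = \int[mu]_(x in `]s i, s i.+1]) h x.
  by have [u ? ?] := integral_mean_value ch (lt_s i); exists u.
have [u uP] := choice hu.
have sN : s N = b by rewrite /s mulrCA mulfV ?mulr1 ?pnatr_eq0 // addrC subrK.
exists N, s, u; split => //.
- by rewrite /s mul0r addr0.
- by move=> i _; have [? _] := uP i; split => //; rewrite st.
under eq_bigr do rewrite (uP _).2.
have as_ i : a <= s i.
  elim: i => [|i IH]; first by rewrite /s mul0r addr0.
  exact: le_trans IH (ltW (lt_s i)).
suff H n : \sum_(i < n) \int[mu]_(x in `]s i, s i.+1]) h x = \int[mu]_(x in `]a, s n]) h x.
  by rewrite H sN.
elim: n => [|n IH].
  rewrite big_ord0 /s mul0r addr0 set_itv_ge ?Rintegral_set0 //.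
  by rewrite bnd_simp ltxx.
rewrite big_ord_recr /= IH.
have ih : mu.-integrable `]a, s n.+1] (EFin \o h).
  apply: (@integrableS _ _ _ mu `[a, s n.+1]) => //.
    by apply: subset_itvr; rewrite bnd_simp.
  apply: continuous_compact_integrable; first exact: segment_compact.
  exact: continuous_subspaceT.
rewrite -(@Rintegral_itvB _ h (BRight a) (BRight (s n.+1)) (s n) ih) ?bnd_simp //.
  by rewrite addrC subrK.
exact: ltW.
Qed.

End mean_value.

(** * Testing against bounded random variables *)

Section pairing.
Context {R : realType} {d : measure_display} {Omega : measurableType d}.
Variable P : probability Omega R.
Implicit Types Y Z : Omega -> R.

Definition L1_rv Y : Prop := P.-integrable setT (EFin \o Y).

Definition nrm1 Y : R := \int[P]_w `|Y w|.

Definition pairing Y Z : R := \int[P]_w (Y w * Z w).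

Definition unit_rv Z : Prop := measurable_fun setT Z /\ forall w, `|Z w| <= 1.

Lemma L1_rv_measurable Y : L1_rv Y -> measurable_fun setT Y.
Proof. by move=> /(measurable_int P) /measurable_EFinP. Qed.

Lemma L1_rvM Y Z : L1_rv Y -> unit_rv Z -> L1_rv (fun w => Y w * Z w).
Proof.
move=> iY [mZ Z1]; have mY := L1_rv_measurable iY.
apply: le_integrable iY => //.
  by apply/measurable_EFinP; exact: measurable_funM.
by move=> w _ /=; rewrite lee_fin normrM ler_piMr.
Qed.

Lemma L1_rvD Y Z : L1_rv Y -> L1_rv Z -> L1_rv (fun w => Y w + Z w).
Proof. by move=> iY iZ; have := integrableD measurableT iY iZ. Qed.

Lemma L1_rvB Y Z : L1_rv Y -> L1_rv Z -> L1_rv (fun w => Y w - Z w).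
Proof. by move=> iY iZ; have := integrableB measurableT iY iZ. Qed.

Lemma L1_rvZ (a : R) Y : L1_rv Y -> L1_rv (fun w => a * Y w).
Proof. by move=> iY; have := integrableZl measurableT a iY. Qed.

Lemma L1_rv_sum (I : Type) (r : seq I) (F : I -> Omega -> R) :
  (forall i, L1_rv (F i)) -> L1_rv (fun w => \sum_(i <- r) F i w).
Proof.
move=> iF; elim: r => [|i r IH].
  rewrite /L1_rv (_ : _ \o _ = cst 0%E); first exact: integrable0.
  by apply/funext => w /=; rewrite big_nil.
rewrite /L1_rv (_ : _ \o _ = EFin \o (fun w => F i w + \sum_(j <- r) F j w)).
  exact: L1_rvD.
by apply/funext => w /=; rewrite big_cons.
Qed.

Lemma pairingD Y Y' Z : L1_rv Y -> L1_rv Y' -> unit_rv Z ->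
  pairing (fun w => Y w + Y' w) Z = pairing Y Z + pairing Y' Z.
Proof.
move=> iY iY' uZ; rewrite /pairing -(RintegralD measurableT (L1_rvM iY uZ) (L1_rvM iY' uZ)).
by apply: eq_Rintegral => w _; rewrite mulrDl.
Qed.

Lemma pairingB Y Y' Z : L1_rv Y -> L1_rv Y' -> unit_rv Z ->
  pairing (fun w => Y w - Y' w) Z = pairing Y Z - pairing Y' Z.
Proof.
move=> iY iY' uZ; rewrite /pairing -(RintegralB measurableT (L1_rvM iY uZ) (L1_rvM iY' uZ)).
by apply: eq_Rintegral => w _; rewrite mulrBl.
Qed.

Lemma pairingZ (a : R) Y Z : L1_rv Y -> unit_rv Z ->
  pairing (fun w => a * Y w) Z = a * pairing Y Z.
Proof.
move=> iY uZ; rewrite /pairing -(RintegralZl _ measurableT (L1_rvM iY uZ)).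
by apply: eq_Rintegral => w _; rewrite mulrA.
Qed.

Lemma pairing_sum (I : Type) (r : seq I) (F : I -> Omega -> R) Z :
  (forall i, L1_rv (F i)) -> unit_rv Z ->
  pairing (fun w => \sum_(i <- r) F i w) Z = \sum_(i <- r) pairing (F i) Z.
Proof.
move=> iF uZ; elim: r => [|i r IH].
  rewrite big_nil /pairing; under eq_Rintegral do rewrite big_nil mul0r.
  by rewrite Rintegral_cst // mul0r.
rewrite big_cons -IH -pairingD //; last exact: L1_rv_sum.
by congr pairing; apply/funext => w; rewrite big_cons.
Qed.

Lemma nrm1_ge0 Y : 0 <= nrm1 Y.
Proof. exact: Rintegral_ge0. Qed.

Lemma nrm1E Y : L1_rv Y -> (nrm1 Y)%:E = 'E_P[fun w => `|Y w|%R]%E.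
Proof.
move=> iY; rewrite unlock fineK //.
by apply: integrable_fin_num => //; exact: integrable_norm iY.
Qed.

Lemma pairing_le_nrm1 Y Z : L1_rv Y -> unit_rv Z -> `|pairing Y Z| <= nrm1 Y.
Proof.
move=> iY uZ; have iYZ := L1_rvM iY uZ.
apply: le_trans (le_normr_Rintegral measurableT iYZ) _.
apply: le_Rintegral => //; first exact: integrable_norm iYZ.
  exact: integrable_norm iY.
by move=> w _; rewrite normrM ler_piMr //; exact: uZ.2.
Qed.

Lemma unit_rv_sgr Y : measurable_fun setT Y -> unit_rv (fun w => Num.sg (Y w)).
Proof.
move=> mY; split.
  have -> : (fun w => Num.sg (Y w)) = (fun w => ((0 < Y w)%R%:R : R) - ((Y w < 0)%R%:R : R)).
    by apply/funext => w; case: sgrP; rewrite ?subr0 ?sub0r.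
  apply: measurable_funB.
    have -> : (fun w => ((0 < Y w)%R%:R : R)) =
      (fun w => \1_(Y @^-1` `]0, +oo[%classic : set Omega) w : R).
      apply/funext => w; rewrite indicE; congr (nat_of_bool _)%:R.
      by apply/idP/idP; rewrite inE /= in_itv /= andbT.
    by apply: measurable_indic; rewrite -[X in measurable X]setTI; apply: mY.
  have -> : (fun w => ((Y w < 0)%R%:R : R)) =
      (fun w => \1_(Y @^-1` `]-oo, 0[%classic : set Omega) w : R).
    apply/funext => w; rewrite indicE; congr (nat_of_bool _)%:R.
    by apply/idP/idP; rewrite inE /= in_itv.
  by apply: measurable_indic; rewrite -[X in measurable X]setTI; apply: mY.
by move=> w; rewrite normr_sg; case: (_ != 0).
Qed.

Lemma nrm1_sgr Y : nrm1 Y = pairing Y (fun w => Num.sg (Y w)).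
Proof. by apply: eq_Rintegral => w _; rewrite normrEsg mulrC. Qed.

(** Q comes from |x| <= x^2 / (2 e) + e / 2. It yields the integrability of Y - Z and, after
    integration, the bound e / 2 + e / 2. *)
Lemma ms_dist2_L1 Y Z (e : R) : L1_rv Y -> measurable_fun setT Z -> 0 < e ->
  (ms_dist2 P Y Z < (e ^+ 2)%:E)%E -> L1_rv Z /\ nrm1 (fun w => Y w - Z w) <= e.
Proof.
move=> iY mZ e0 dYZ; have mY := L1_rv_measurable iY.
pose Q w := (2 * e)^-1 * (Y w - Z w) ^+ 2 + e / 2.
have mD : measurable_fun setT (fun w => Y w - Z w) by exact: measurable_funB.
have mD2 : measurable_fun setT (fun w => (Y w - Z w) ^+ 2) by exact: measurable_funX.
have iD2 : L1_rv (fun w => (Y w - Z w) ^+ 2).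
  apply/integrableP; split; first exact/measurable_EFinP.
  apply: (@lt_trans _ _ (e ^+ 2)%:E); last exact: ltry.
  apply: le_lt_trans dYZ; rewrite /ms_dist2 unlock.
  by under eq_integral do rewrite /= ger0_norm ?sqr_ge0 //.
have i1 : L1_rv (fun _ => e / 2) by exact: finite_measure_integrable_cst.
have iQ : L1_rv Q by apply: L1_rvD => //; exact: L1_rvZ.
have DQ w : `|Y w - Z w| <= Q w.
  rewrite /Q -[X in (2 * e)^-1 * X]real_normK ?num_real //.
  set r := `|_|; rewrite -subr_ge0.
  have -> : (2 * e)^-1 * r ^+ 2 + e / 2 - r = (2 * e)^-1 * (r - e) ^+ 2.
    by field; rewrite gt_eqF.
  by rewrite mulr_ge0 ?sqr_ge0 // invr_ge0 mulr_ge0 // ltW.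
have iD : L1_rv (fun w => Y w - Z w).
  apply: le_integrable iQ => //; first exact/measurable_EFinP.
  by move=> w _ /=; rewrite lee_fin (le_trans (DQ w)) // ler_norm.
split.
  rewrite (_ : Z = (fun w => Y w - (Y w - Z w))); first exact: L1_rvB.
  by apply/funext => w; rewrite opprB addrC subrK.
apply: (@le_trans _ _ (\int[P]_w Q w)).
  apply: le_Rintegral => //; exact: integrable_norm iD.
rewrite /Q (RintegralD measurableT (L1_rvZ _ iD2) i1) (RintegralZl _ measurableT iD2).
have -> : \int[P]_(_ in setT) (e / 2) = e / 2.
  by rewrite (Rintegral_cst P measurableT) [X in fine X](@probability_setT _ _ _ P) mulr1.
have : \int[P]_w (Y w - Z w) ^+ 2 <= e ^+ 2.
  rewrite -lee_fin fineK; last exact: integrable_fin_num.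
  by rewrite ltW //; move: dYZ; rewrite /ms_dist2 unlock.
set q := \int[P]_w _ => qe; apply: (@le_trans _ _ ((2 * e)^-1 * e ^+ 2 + e / 2)).
  by rewrite lerD2r ler_wpM2l // invr_ge0 mulr_ge0 // ltW.
by rewrite (_ : _ + _ = e) //; field; rewrite gt_eqF.
Qed.

End pairing.

Section mean_square_pairing.
Context {R : realType} {d : measure_display} {Omega : measurableType d}.
Variable P : probability Omega R.
Local Notation mu := (@lebesgue_measure R).
Variable Y : R -> Omega -> R.
Hypothesis iY : forall t, L1_rv P (Y t).
Hypothesis cY : forall Z, unit_rv Z -> continuous (fun t => pairing P (Y t) Z).

Lemma eq0_of_small (x : R) : (forall e, 0 < e -> `|x| <= e) -> x = 0.
Proof.
move=> h; apply/eqP; rewrite -normr_le0; apply/ler_addgt0Pl => e e0.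
by rewrite addr0 h.
Qed.

(** The tags of the Riemann sum may be chosen for the given Z: with those of [exact_riemann_sum] the
    numerical sum equals its integral, so the only error is the mean-square one. *)
Lemma ms_integral_on_approx a b I e : a < b -> 0 < e -> ms_integral_on P Y a b I ->
  L1_rv P I /\ forall Z, unit_rv Z ->
    `|pairing P I Z - \int[mu]_(t in `]a, b]) pairing P (Y t) Z| <= e.
Proof.
move=> ab e0 [mI hI]; have e2 : 0 < e ^+ 2 by rewrite exprn_gt0.
have [delta d0 hd] := hI _ e2.
have L1S N (s u : nat -> R) : L1_rv P (fun w => \sum_(i < N) Y (u i) w * (s i.+1 - s i)).
  apply: L1_rv_sum => i; under eq_fun do rewrite mulrC; exact: L1_rvZ.
have key Z : unit_rv Z -> L1_rv P I /\
    `|pairing P I Z - \int[mu]_(t in `]a, b]) pairing P (Y t) Z| <= e.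
  move=> uZ; have [N [s [u [s0 sN hs E]]]] := exact_riemann_sum (cY uZ) ab d0.
  have := hd N s u s0 sN hs => /(ms_dist2_L1 (L1S N s u) mI e0)[iI SI].
  split => //; rewrite -E.
  have -> : \sum_(i < N) pairing P (Y (u i)) Z * (s i.+1 - s i) =
      pairing P (fun w => \sum_(i < N) Y (u i) w * (s i.+1 - s i)) Z.
    rewrite pairing_sum // => [|i].
      apply: eq_bigr => i _; rewrite mulrC -pairingZ //.
      by congr pairing; apply/funext => w; rewrite mulrC.
    by under eq_fun do rewrite mulrC; exact: L1_rvZ.
  rewrite distrC -pairingB //; apply: le_trans SI.
  by apply: pairing_le_nrm1 => //; exact: L1_rvB.
split; last by move=> Z /key[].
(* Integrability of I does not depend on Z; the zero variable serves to obtain it. *)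
have u0 : unit_rv (fun _ : Omega => 0 : R).
  by split=> [|w]; [exact: measurable_cst|rewrite normr0].
by have [] := key _ u0.
Qed.

Lemma ms_integral_pairing xi :
  (forall Z, unit_rv Z -> mu.-integrable setT (EFin \o (fun t => pairing P (Y t) Z))) ->
  ms_integral P Y xi ->
  L1_rv P xi /\ forall Z, unit_rv Z -> pairing P xi Z = \int[mu]_t pairing P (Y t) Z.
Proof.
move=> ipY [mxi [I [hI lI]]].
(* The extra - 1 on the left makes the interval nondegenerate for n = 0 and puts every t with |t| <=
   n inside the half-open interval. *)
have hn n : exists ab : R * R, [/\ ab.1 <= - n%:R - 1, n%:R <= ab.2 &
    (ms_dist2 P (I ab.1 ab.2) xi < ((n.+1%:R^-1 : R) ^+ 2)%:E)%E].
  have e0 : 0 < (n.+1%:R^-1 : R) ^+ 2 by rewrite exprn_gt0 // invr_gt0.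
  have [[A B] /= [FA GB] AB] := lI _ e0.
  have FA' : (-oo : set_system R) (A `&` [set x | x <= - n%:R - 1]).
    by apply: filterI => //; exact: nbhs_ninfty_le.
  have GB' : (+oo : set_system R) (B `&` [set x | n%:R <= x]).
    by apply: filterI => //; exact: nbhs_pinfty_ge.
  have [a [Aa an]] := filter_ex FA'; have [b [Bb nb]] := filter_ex GB'.
  by exists (a, b); split => //; exact: (AB (a, b)).
have [ab abP] := choice hn.
have ltab n : (ab n).1 < (ab n).2.
  have [h1 h2 _] := abP n; have := ler0n R n; lra.
have hIn n := hI _ _ (ltW (ltab n)).
have LI n : L1_rv P (I (ab n).1 (ab n).2).
  by have [] := ms_integral_on_approx (ltab n) ltr01 (hIn n).
have e0 n : 0 < n.+1%:R^-1 :> R by rewrite invr_gt0.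
have hd n : L1_rv P xi /\ nrm1 P (fun w => I (ab n).1 (ab n).2 w - xi w) <= n.+1%:R^-1.
  by have [_ _ hh] := abP n; exact: ms_dist2_L1 (LI n) mxi (e0 n) hh.
have ixi := (hd 0).1; split => // Z uZ.
pose h t := pairing P (Y t) Z.
have E n : pairing P (I (ab n).1 (ab n).2) Z = \int[mu]_(t in `](ab n).1, (ab n).2]) h t.
  apply/eqP; rewrite -subr_eq0; apply/eqP/eq0_of_small => e epos.
  by have [_] := ms_integral_on_approx (ltab n) epos (hIn n); apply.
have c1 : pairing P (I (ab n).1 (ab n).2) Z @[n --> \oo] --> pairing P xi Z.
  apply/cvgrPdist_le => e epos; near=> n.
  rewrite distrC -pairingB //.
  apply: le_trans (pairing_le_nrm1 (L1_rvB (LI n) ixi) uZ) _.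
  apply: le_trans (hd n).2 _.
  near: n; have := @cvg_harmonic R => /cvgr0Pnorm_le /(_ _ epos).
  by apply: filterS => n; rewrite /= ger0_norm.
have c2 : \int[mu]_t (h t * \1_(`](ab n).1, (ab n).2]%classic : set R) t) @[n --> \oo] -->
    \int[mu]_t h t.
  have ih : mu.-integrable setT (EFin \o (fun t => `|h t|)) by exact: integrable_norm (ipY _ uZ).
  have ch : continuous h := cY uZ.
  apply: (proj2 (@lebesgue_dominated R (fun n t => h t * \1_(`](ab n).1, (ab n).2]%classic : set R) t)
    h (fun t => `|h t|) _ _ ih _)).
  - move=> n; apply: measurable_funM; first exact: continuous_measurable_fun.
    by apply: measurable_indic; exact: measurable_itv.
  - move=> t; apply: cvg_near_cst; near=> n.
    rewrite indicE mem_set ?mulr1 //= in_itv /=; have [h1 h2 _] := abP n.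
    have tn : `|t| <= n%:R by near: n; exact: nbhs_infty_ger.
    by have := ler_norm t; have := ler_norm (- t); rewrite normrN => *; apply/andP; split; lra.
  - move=> n t; rewrite normrM ler_piMr // indicE.
    by case: (_ \in _); rewrite ?normr1 ?normr0.
have e12 : (fun n => pairing P (I (ab n).1 (ab n).2) Z) =
    (fun n => \int[mu]_t (h t * \1_(`](ab n).1, (ab n).2]%classic : set R) t)).
  apply/funext => n; rewrite E Rintegral_mkcond; apply: eq_Rintegral => t _.
  by rewrite patchE indicE; case: ifPn => _; rewrite ?mulr1 ?mulr0.
by rewrite e12 in c1; exact: (cvg_unique (@Rhausdorff R) c1 c2).
Unshelve. all: by end_near. Qed.

End mean_square_pairing.

(** * Convergence of the approximants in mean *)

Section weight.
Context {R : realType}.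
Local Notation mu := (@lebesgue_measure R).

Lemma assumption_S_envelope (Phi g : R -> R) : assumption_S Phi g -> envelope Phi.
Proof. by case. Qed.

(** A failure at x would persist near x by continuity. A nearby y farther from 0, at which the
    almost-everywhere bound holds, then contradicts the monotonicity of Phi. *)
Lemma assumption_S_le (Phi g : R -> R) : assumption_S Phi g -> continuous g ->
  forall x, `|g x| <= Phi `|x|.
Proof.
move=> [P0 Pd hg _] cg x; rewrite leNgt; apply/negP => gx.
have /= : \forall y \near x, Phi `|x| < `|g y|.
  have cn : `|g y| @[y --> x] --> `|g x| by apply: cvg_norm; exact: cg.
  by apply: (cvgr_gt _ cn).
move=> /nbhs_ballP[e /= e0 he].
have [y /andP[y1 y2] Qy] : exists2 y, (`|x - y| < e) && (`|x| <= `|y|) & `|g y| <= Phi `|y|.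
  have [x0|x0] := leP 0 x.
    have [|y /andP[xy yx] Qy] := ae_exists_itv (a := x) (b := x + e) hg; first by rewrite ltrDl.
    exists y => //; rewrite ltr0_norm ?subr_lt0 // !ger0_norm ?(ltW xy) ?andbT //; first lra.
    by rewrite (le_trans x0) // ltW.
  have [|y /andP[xy yx] Qy] := ae_exists_itv (a := x - e) (b := x) hg; first by rewrite gtrBl.
  exists y => //; rewrite gtr0_norm ?subr_gt0 // !ltr0_norm ?lerN2 ?(ltW yx) ?andbT //; first lra.
  exact: lt_trans yx x0.
have := he y y1; rewrite /= ltNge (le_trans Qy) //.
exact: Pd.
Qed.

Variables (c Phi : R -> R).
Hypothesis c_even : forall x, c (- x) = c x.
Hypothesis c_nd : forall x y, 0 <= x -> x <= y -> c x <= c y.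
Hypothesis c_gt1 : 1 < c 0.
Hypothesis c_doubling : exists (A : R -> R) (x0 : R),
     (forall a, 0 < a -> 0 < A a) /\
     (forall x a, x0 <= x -> 0 < a -> c (a * x) <= c x * A a).
Hypothesis ePhi : envelope Phi.
Hypothesis ic : (\int[mu]_x (c x * Phi `|x|)%:E < +oo)%E.

Lemma weight_norm x : c `|x| = c x.
Proof. by have [//|] := ger0P x. Qed.

Lemma weight_le x y : `|x| <= `|y| -> c x <= c y.
Proof. by rewrite -[c x]weight_norm -[c y]weight_norm; exact: c_nd. Qed.

Lemma weight_ge1 x : 1 <= c x.
Proof. by apply: le_trans (ltW c_gt1) _; apply: weight_le; rewrite normr0. Qed.

Lemma weight_ge0 x : 0 <= c x.
Proof. exact: le_trans ler01 (weight_ge1 x). Qed.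

Lemma measurable_weight : measurable_fun [set: R] c.
Proof.
have -> : c = (fun x => c (Order.max x 0)) \o (fun x => `|x|).
  by apply/funext => x /=; rewrite max_l // weight_norm.
apply: measurableT_comp; last exact: normr_measurable.
apply: nondecreasing_measurable => // x y xy.
by apply: c_nd; [rewrite le_max lexx orbT|rewrite ge_max !le_max xy lexx !orbT].
Qed.

Let mPhi := measurable_envelope ePhi.
Let Phi0 x : 0 <= x -> 0 <= Phi x.
Proof. by case: ePhi => h _ _; exact: h. Qed.

(** The growth condition covers |x| >= |x0| only; smaller x are absorbed by the constant c (a x0),
    as c is at least 1. *)
Lemma weight_scale (a : R) : 0 < a -> exists2 k, 0 <= k &
  forall x, c (a * x) <= k * c x.
Proof.
move=> a0; case: c_doubling => A [x0 [A0 hA]].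
exists (A a + c (a * x0)); first by rewrite addr_ge0 ?weight_ge0 // ltW // A0.
move=> x; have [h|h] := leP `|x0| `|x|.
  have h1 : c (a * `|x|) <= c `|x| * A a by apply: hA => //; exact: le_trans (ler_norm _) h.
  rewrite -(weight_norm (a * x)) normrM (gtr0_norm a0) (le_trans h1) // weight_norm mulrC.
  by rewrite ler_wpM2r ?weight_ge0 // lerDl weight_ge0.
apply: (@le_trans _ _ (c (a * x0))).
  by apply: weight_le; rewrite !normrM ler_wpM2l // ltW.
rewrite mulrDl ler_wpDl ?mulr_ge0 ?weight_ge0 //; first by rewrite ltW // A0.
by rewrite ler_peMr ?weight_ge0 ?weight_ge1.
Qed.

(** The larger of |a x| and |b| dominates: the value is at most c (2 a x) or c (2 b). Uniformity in
    e is for the dilations e = 2^-n of [increment_dilate_cvg0]. *)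
Lemma weight_affine (a b : R) : 0 < a -> exists2 k, 0 <= k &
  forall x e, 0 <= e <= 1 -> c (a * e * x + b) <= k * c x.
Proof.
move=> a0; have a20 : 0 < 2 * a by rewrite mulr_gt0.
have [k k0 hk] := weight_scale a20.
exists (k + c (2 * b)); first by rewrite addr_ge0 ?weight_ge0.
move=> x e /andP[e0 e1].
have nx : `|a * e * x| <= `|a * x|.
  by rewrite !normrM (gtr0_norm a0) (ger0_norm e0) ler_wpM2r // ler_piMr // ltW.
have nn := ler_normD (a * e * x) b.
have [h|h] := leP `|b| `|a * x|.
  apply: (@le_trans _ _ (c (2 * a * x))).
    have e2 : `|2 * a * x| = 2 * `|a * x| by rewrite -mulrA [LHS]normrM gtr0_norm.
    by apply: weight_le; rewrite e2; lra.
  by rewrite (le_trans (hk x)) // ler_wpM2r ?weight_ge0 // lerDl weight_ge0.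
apply: (@le_trans _ _ (c (2 * b))).
  have e2 : `|2 * b| = 2 * `|b| by rewrite [LHS]normrM gtr0_norm.
  by apply: weight_le; rewrite e2; lra.
rewrite [leRHS]mulrDl ler_wpDl ?mulr_ge0 ?weight_ge0 //.
by rewrite ler_peMr ?weight_ge0 ?weight_ge1.
Qed.

Lemma weight_integrable : mu.-integrable setT (EFin \o (fun x => c x * Phi `|x|)).
Proof.
apply/integrableP; split.
  by apply/measurable_EFinP; apply: measurable_funM => //; exact: measurable_weight.
apply: le_lt_trans ic; rewrite le_eqVlt; apply/orP; left; apply/eqP.
by apply: eq_integral => x _ /=; rewrite ger0_norm // mulr_ge0 ?weight_ge0 ?Phi0.
Qed.

(** Substitute x = r (s - t): [weight_affine] bounds c s by a multiple of c x, and c t <= c t c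
    x. *)
Lemma weight_dilate_integrable (t r C : R) (rho : R -> R) : 0 < r -> 0 <= C ->
  measurable_fun [set: R] rho -> (forall s, 0 <= rho s <= C * (c s + c t)) ->
  mu.-integrable setT (EFin \o (fun s => rho s * Phi (r * `|s - t|))).
Proof.
move=> r0 C0 mrho hrho; have ri : 0 < r^-1 by rewrite invr_gt0.
have [k k0 hk] := weight_affine t ri.
have iG : mu.-integrable setT (EFin \o (fun x => (C * (k + c t)) * (c x * Phi `|x|))).
  by have := integrableZl measurableT (C * (k + c t)) weight_integrable; apply: eq_integrable.
have := integrable_affine (- (r * t)) r0 iG.
apply: le_integrable => //.
  apply/measurable_EFinP; apply: measurable_funM => //.
  have -> : (fun s => Phi (r * `|s - t|)) = (fun x => Phi `|x|) \o (fun s => r * s + - (r * t)).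
    by apply/funext => s /=; rewrite -mulrBr normrM (gtr0_norm r0).
  apply: measurableT_comp => //; apply: continuous_measurable_fun => s.
  by apply: cvgD; [apply: cvgMl_tmp; exact: cvg_id|exact: cvg_cst].
move=> s _ /=; rewrite lee_fin; have /andP[p0 p1] := hrho s.
have e1 : `|r * s + - (r * t)| = r * `|s - t| by rewrite -mulrBr normrM (gtr0_norm r0).
have q0 : 0 <= Phi (r * `|s - t|) by rewrite Phi0 // mulr_ge0 // ltW.
rewrite e1; set q := Phi _ in q0 *.
rewrite !ger0_norm ?mulr_ge0 ?addr_ge0 ?weight_ge0 //.
rewrite mulrA ler_wpM2r // (le_trans p1) // -mulrA ler_wpM2l //.
have := hk (r * s + - (r * t)) 1; rewrite ler01 lexx => /(_ isT).
rewrite mulr1 mulrDr mulrN !mulrA mulVf ?gt_eqF // !mul1r subrK => h.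
rewrite mulrDl lerD // ler_peMr ?weight_ge0 ?weight_ge1 //.
Qed.

End weight.

(** * The wavelet kernel as an approximate identity *)

Section approximate_identity.
Context {R : realType}.
Local Notation mu := (@lebesgue_measure R).
Variables (phi psi Phi : R -> R) (M : R).
Hypothesis ePhi : envelope Phi.
Hypothesis cphi : continuous phi.
Hypothesis cpsi : continuous psi.
Hypothesis phiP : forall x, `|phi x| <= Phi `|x|.
Hypothesis psiP : forall x, `|psi x| <= Phi `|x|.
Hypothesis hM : forall g : R -> R, (forall x, `|g x| <= Phi `|x|) ->
    forall K s t, sum_abs_le K (fun k => `|g (s - k%:~R) * g (t - k%:~R)|) <=
      M * Phi (`|s - t| / 2).
Hypothesis two_scale : forall s t, 2 * kern phi (2 * s) (2 * t) = kern phi s t + kern psi s t.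
Hypothesis per_phi : forall s, per phi s = \int[mu]_x phi x.
Hypothesis phi_sqr : (\int[mu]_x phi x) ^+ 2 = 1.

Let Phi0 x : 0 <= x -> 0 <= Phi x.
Proof. by case: ePhi => h _ _; exact: h. Qed.

Let ephi : enveloped phi. Proof. by split => //; exists Phi. Qed.
Let epsi : enveloped psi. Proof. by split => //; exists Phi. Qed.

(** One common K for all the scales: only the indices (n; K, ..., K) are ever compared with X. *)
Definition trunc_kern (n K : nat) (s t : R) : R :=
  sum_abs_le K (fun k => phi (s - k%:~R) * phi (t - k%:~R)) +
  \sum_(j < n) 2 ^+ j *
    sum_abs_le K (fun k => psi (2 ^+ j * s - k%:~R) * psi (2 ^+ j * t - k%:~R)).

Lemma kern_telescope n s t : 2 ^+ n * kern phi (2 ^+ n * s) (2 ^+ n * t) =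
  kern phi s t + \sum_(j < n) 2 ^+ j * kern psi (2 ^+ j * s) (2 ^+ j * t).
Proof.
elim: n => [|n IH]; first by rewrite big_ord0 addr0 expr0 !mul1r.
rewrite big_ord_recr /= addrA -IH -mulrDr -two_scale exprS.
by rewrite !mulrA [2 ^+ n * 2]mulrC.
Qed.

Lemma trunc_kern_cvg n s t :
  trunc_kern n K s t @[K --> \oo] --> 2 ^+ n * kern phi (2 ^+ n * s) (2 ^+ n * t).
Proof.
rewrite kern_telescope; apply: cvgD.
  by apply: zsum_cvg; exact: kern_summable.
elim: n => [|n IH].
  by under eq_fun do rewrite big_ord0; rewrite big_ord0; exact: cvg_cst.
under eq_fun do rewrite big_ord_recr /=; rewrite big_ord_recr /=.
by apply: cvgD => //; apply: cvgMl_tmp; apply: zsum_cvg; exact: kern_summable.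
Qed.

(** The sum of the bounds of the separate scales. Its integral in s is proportional to n + 1, so it
    serves only for the limit in K at fixed n. *)
Definition kern_majorant (n : nat) (s t : R) : R :=
  M * Phi (2^-1 * `|s - t|) + \sum_(j < n) 2 ^+ j * (M * Phi (2 ^+ j / 2 * `|s - t|)).

Let pow2_gt0 n : 0 < 2 ^+ n :> R. Proof. by rewrite exprn_gt0. Qed.

Let kern_boundE g n K s t : (forall x, `|g x| <= Phi `|x|) ->
  sum_abs_le K (fun k => `|g (2 ^+ n * s - k%:~R) * g (2 ^+ n * t - k%:~R)|) <=
    M * Phi (2 ^+ n / 2 * `|s - t|).
Proof.
move=> gP; apply: le_trans (hM gP K _ _) _.
by rewrite -mulrBr normrM (gtr0_norm (pow2_gt0 n)) mulrAC.
Qed.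

Lemma trunc_kern_le n K s t : `|trunc_kern n K s t| <= kern_majorant n s t.
Proof.
apply: le_trans (ler_normD _ _) _; apply: lerD.
  apply: le_trans (ler_norm_sum_abs_le _ _) _.
  by have := kern_boundE 0 K s t phiP; rewrite expr0 !mul1r.
apply: le_trans (ler_norm_sum _ _ _) _; apply: ler_sum => j _.
rewrite normrM (gtr0_norm (pow2_gt0 j)) ler_wpM2l ?(ltW (pow2_gt0 j)) //.
apply: le_trans (ler_norm_sum_abs_le _ _) _; exact: kern_boundE.
Qed.

(** The integral in s of this bound, unlike that of [kern_majorant], does not depend on n. *)
Lemma kern_le n s t : `|2 ^+ n * kern phi (2 ^+ n * s) (2 ^+ n * t)| <=
  2 ^+ n * (M * Phi (2 ^+ n / 2 * `|s - t|)).
Proof.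
rewrite normrM (gtr0_norm (pow2_gt0 n)) ler_wpM2l ?(ltW (pow2_gt0 n)) //.
apply: ler_norm_zsum => K; exact: kern_boundE.
Qed.

Lemma continuous_sum_ord n (F : nat -> R -> R) : (forall j, continuous (F j)) ->
  continuous (fun s => \sum_(j < n) F j s).
Proof.
move=> cF s; elim: n => [|n IH].
  by rewrite (_ : (fun x : R => _) = cst 0); [exact: cvg_cst|apply/funext => x; rewrite big_ord0].
rewrite (_ : (fun x : R => _) = (fun x => \sum_(j < n) F j x + F n x)).
  by rewrite /continuous_at; apply: cvgD; [exact: IH|exact: cF].
by apply/funext => x; rewrite big_ord_recr.
Qed.

Lemma trunc_kern_continuous n K t : continuous (fun s => trunc_kern n K s t).
Proof.
have ca (g : R -> R) (a b : R) : continuous g -> continuous (fun s : R => g (a * s - b)).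
  move=> cg s; apply: (cvg_continuous_comp cg).
  by apply: cvgB; [apply: cvgMl_tmp; exact: cvg_id|exact: cvg_cst].
move=> s; apply: cvgD.
  apply: cvg_sum_abs_le => k; apply: cvgMr_tmp.
  have := ca phi 1 k%:~R cphi s; rewrite /continuous_at mul1r.
  by under eq_fun do rewrite mul1r.
apply: (@continuous_sum_ord n (fun j s => 2 ^+ j *
    sum_abs_le K (fun k => psi (2 ^+ j * s - k%:~R) * psi (2 ^+ j * t - k%:~R)))).
move=> j {}s; apply: cvgMl_tmp; apply: cvg_sum_abs_le => k.
by apply: cvgMr_tmp; exact: (ca psi).
Qed.

Section weighted.
Variables (t : R) (rho : R -> R).
Hypothesis rho0 : forall s, 0 <= rho s.
Hypothesis mrho : measurable_fun [set: R] rho.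
Hypothesis irho : forall r, 0 < r ->
  mu.-integrable setT (EFin \o (fun s => rho s * Phi (r * `|s - t|))).

Lemma kern_majorant_integrable n :
  mu.-integrable setT (EFin \o (fun s => rho s * kern_majorant n s t)).
Proof.
have h2 : 0 < 2^-1 :> R by rewrite invr_gt0.
have hj (j : nat) : 0 < 2 ^+ j / 2 :> R by rewrite divr_gt0.
elim: n => [|n IH].
  have := integrableZl measurableT M (irho h2).
  apply: eq_integrable => // s _ /=; rewrite /kern_majorant big_ord0 addr0 -EFinM.
  by congr EFin; ring.
have := integrableD measurableT IH (integrableZl measurableT (2 ^+ n * M) (irho (hj n))).
apply: eq_integrable => // s _ /=; rewrite /kern_majorant big_ord_recr /= -EFinM -EFinD.
by congr EFin; ring.
Qed.

Lemma trunc_kern_Rintegral_cvg n :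
  mu.-integrable setT (EFin \o (fun s => rho s * `|2 ^+ n * kern phi (2 ^+ n * s) (2 ^+ n * t)|)) /\
  \int[mu]_s (rho s * `|trunc_kern n K s t|) @[K --> \oo] -->
  \int[mu]_s (rho s * `|2 ^+ n * kern phi (2 ^+ n * s) (2 ^+ n * t)|).
Proof.
apply: (lebesgue_dominated _ _ (kern_majorant_integrable n)) => [K|s|K s].
- apply: measurable_funM => //; apply: measurableT_comp; first exact: normr_measurable.
  by apply: continuous_measurable_fun; exact: trunc_kern_continuous.
- by apply: cvgMl_tmp; apply: cvg_norm; exact: trunc_kern_cvg.
- rewrite normrM (ger0_norm (rho0 s)) normr_id ler_wpM2l //; exact: trunc_kern_le.
Qed.

Lemma trunc_kern_integrable n K :
  mu.-integrable setT (EFin \o (fun s => rho s * trunc_kern n K s t)).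
Proof.
apply: le_integrable (kern_majorant_integrable n) => //.
  apply/measurable_EFinP; apply: measurable_funM => //.
  by apply: continuous_measurable_fun; exact: trunc_kern_continuous.
move=> s _ /=; rewrite lee_fin !normrM ler_wpM2l //.
by apply: le_trans (trunc_kern_le n K s t) _; exact: ler_norm.
Qed.

Lemma kern_Rintegral_le n : \int[mu]_s (rho s * `|2 ^+ n * kern phi (2 ^+ n * s) (2 ^+ n * t)|) <=
  2 * M * \int[mu]_u (rho (2 / 2 ^+ n * u + t) * Phi `|u|).
Proof.
have r0 : 0 < 2 ^+ n / 2 :> R by rewrite divr_gt0.
pose F s := rho s * Phi (2 ^+ n / 2 * `|s - t|).
have iF := irho r0.
have b0 : 0 < 2 / 2 ^+ n :> R by rewrite divr_gt0.
have FE u : F (2 / 2 ^+ n * u + t) = rho (2 / 2 ^+ n * u + t) * Phi `|u|.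
  rewrite /F addrK normrM (gtr0_norm b0) mulrA.
  by rewrite (_ : 2 ^+ n / 2 * (2 / 2 ^+ n) = 1) ?mul1r //; field; rewrite gt_eqF.
have := Rintegral_affine t b0 iF; rewrite -/F => E.
have -> : \int[mu]_u (rho (2 / 2 ^+ n * u + t) * Phi `|u|) = (2 / 2 ^+ n)^-1 * \int[mu]_s F s.
  by rewrite -E; apply: eq_Rintegral => u _; rewrite -FE.
apply: (@le_trans _ _ (\int[mu]_s (2 ^+ n * M * F s))).
  apply: le_Rintegral => //.
  - by have [] := trunc_kern_Rintegral_cvg n.
  - by have := integrableZl measurableT (2 ^+ n * M) iF; apply: eq_integrable.
  - move=> s _; rewrite /F [leRHS](_ : _ = rho s * (2 ^+ n * (M * Phi (2 ^+ n / 2 * `|s - t|)))).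
      by rewrite ler_wpM2l // kern_le.
    by ring.
rewrite RintegralZl // le_eqVlt; apply/orP; left; apply/eqP.
by field; rewrite gt_eqF.
Qed.

End weighted.

(** After rescaling, the integral is the periodization of phi times the integral of phi, that is the
    square of the latter. *)
Lemma kern_Rintegral1 n t :
  \int[mu]_s (2 ^+ n * kern phi (2 ^+ n * s) (2 ^+ n * t)) = 1.
Proof.
have [iK EK] := kern_Rintegral (2 ^+ n * t) ephi.
have ksym s : kern phi (2 ^+ n * s) (2 ^+ n * t) = kern phi (2 ^+ n * t) (2 ^+ n * s + 0).
  by rewrite addr0; congr zsum; apply/funext => k; rewrite mulrC.
under eq_Rintegral do rewrite ksym.
rewrite (RintegralZl _ measurableT (integrable_affine 0 (pow2_gt0 n) iK)).
rewrite (Rintegral_affine 0 (pow2_gt0 n) iK) EK per_phi mulrA mulfV ?gt_eqF // mul1r.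
by rewrite -expr2.
Qed.

Lemma trunc_kern_Rintegral1_cvg n t :
  \int[mu]_s trunc_kern n K s t @[K --> \oo] --> (1 : R).
Proof.
have i1 (r : R) : 0 < r ->
    mu.-integrable setT (EFin \o (fun s => (fun _ : R => 1 : R) s * Phi (r * `|s - t|))).
  move=> r0; have := integrable_affine (- (r * t)) r0 (envelope_integrable ePhi).
  apply: eq_integrable => // s _ /=; rewrite mul1r -mulrBr normrM (gtr0_norm r0) //.
rewrite -(kern_Rintegral1 n t).
have iB := kern_majorant_integrable i1 n.
apply: (proj2 (@lebesgue_dominated R (fun K s => trunc_kern n K s t)
  (fun s => 2 ^+ n * kern phi (2 ^+ n * s) (2 ^+ n * t)) _ _ _ iB _)).
- by move=> K; apply: continuous_measurable_fun; exact: trunc_kern_continuous.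
- by move=> s; exact: trunc_kern_cvg.
- by move=> K s; rewrite mul1r; exact: trunc_kern_le.
Qed.

End approximate_identity.

(** * The process and its approximants in mean *)

Section process.
Context {R : realType} {d : measure_display} {Omega : measurableType d}.
Variables (P : probability Omega R) (v : R -> R) (X : R -> Omega -> R).
Local Notation mu := (@lebesgue_measure R).
Hypothesis Hv : orlicz_N_function v.
Hypothesis HX : subphi_process P v X.
Hypothesis cX : tau_continuous P v X.
Variables (c Phi : R -> R).
Hypothesis c_even : forall x, c (- x) = c x.
Hypothesis c_nd : forall x y, 0 <= x -> x <= y -> c x <= c y.
Hypothesis c_gt1 : 1 < c 0.
Hypothesis c_doubling : exists (A : R -> R) (x0 : R),
     (forall a, 0 < a -> 0 < A a) /\
     (forall x a, x0 <= x -> 0 < a -> c (a * x) <= c x * A a).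
Hypothesis ePhi : envelope Phi.
Hypothesis ic : (\int[mu]_x (c x * Phi `|x|)%:E < +oo)%E.
Hypothesis tau_c : forall t, (tau P v (X t) <= (c t)%:E)%E.

Let C := 2 * expR (v 1).
Let C0 : 0 <= C. Proof. by rewrite mulr_ge0 // expR_ge0. Qed.

Lemma process_L1 t : L1_rv P (X t).
Proof. by case: HX => /(_ t) [_ iX _ _] _. Qed.

Lemma process_nrm1_le t : nrm1 P (X t) <= C * c t.
Proof.
have mX := L1_rv_measurable (process_L1 t).
rewrite -lee_fin (nrm1E (process_L1 t)) EFinM.
apply: le_trans (expectation_norm_le_tau P Hv mX) _.
by rewrite lee_wpmul2l // lee_fin.
Qed.

Definition increment_L1 (t s : R) : R := nrm1 P (fun w => X s w - X t w).

Lemma increment_L1_ge0 t s : 0 <= increment_L1 t s.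
Proof. exact: nrm1_ge0. Qed.

Lemma nrm1_triangle Y Z : L1_rv P Y -> L1_rv P Z ->
  nrm1 P (fun w => Y w + Z w) <= nrm1 P Y + nrm1 P Z.
Proof.
move=> iY iZ; rewrite /nrm1 -RintegralD //; last 2 first.
- exact: integrable_norm iY.
- exact: integrable_norm iZ.
apply: le_Rintegral => //.
- exact: integrable_norm (L1_rvD iY iZ).
- exact: (integrableD measurableT (integrable_norm iY) (integrable_norm iZ)).
- by move=> w _; exact: ler_normD.
Qed.

Lemma nrm1B Y Z : nrm1 P (fun w => Y w - Z w) = nrm1 P (fun w => Z w - Y w).
Proof. by apply: eq_Rintegral => w _; rewrite distrC. Qed.

Lemma increment_L1_le t s : increment_L1 t s <= C * (c s + c t).
Proof.
have h := nrm1_triangle (process_L1 s) (L1_rvZ (-1) (process_L1 t)).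
rewrite (_ : increment_L1 t s = nrm1 P (fun w => X s w + -1 * X t w)); last first.
  by apply: eq_Rintegral => w _; rewrite mulN1r.
apply: le_trans h _; rewrite mulrDr lerD ?process_nrm1_le //.
rewrite (_ : nrm1 _ _ = nrm1 P (X t)) ?process_nrm1_le //.
by apply: eq_Rintegral => w _; rewrite mulN1r normrN.
Qed.

Lemma increment_L1_cvg0 t : increment_L1 t s @[s --> t] --> 0.
Proof.
have /fine_cvgP[tf tc] := cX t.
have tc' : C * fine (tau P v (fun w => X s w - X t w)%R) @[s --> t] --> 0.
  by rewrite -(mulr0 C); apply: cvgMl_tmp.
apply: (squeeze_cvgr _ (cvg_cst 0) tc').
apply: filterS tf => s fs; rewrite increment_L1_ge0 /=.
rewrite -lee_fin (nrm1E (L1_rvB (process_L1 s) (process_L1 t))) EFinM fineK //.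
apply: (expectation_norm_le_tau P Hv).
by apply: measurable_funB; apply: L1_rv_measurable; exact: process_L1.
Qed.

Lemma increment_L1_continuous t : continuous (increment_L1 t).
Proof.
move=> s0; apply/cvgrPdist_le => e e0.
have := increment_L1_cvg0 s0 => /cvgr0Pnorm_le /(_ e e0).
apply: filterS => s; apply: le_trans.
have D a b := L1_rvB (process_L1 a) (process_L1 b).
have h a b : increment_L1 t a <= increment_L1 b a + increment_L1 t b.
  have := nrm1_triangle (D a b) (D b t).
  rewrite (_ : nrm1 P _ = increment_L1 t a) //.
  by apply: eq_Rintegral => w _; rewrite addrA subrK.
rewrite [leRHS]ger0_norm ?increment_L1_ge0 // ler_norml.
have h1 := h s s0; have h2 := h s0 s.
have e1 : increment_L1 s s0 = increment_L1 s0 s by rewrite /increment_L1 nrm1B.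
by rewrite e1 in h2; apply/andP; split; lra.
Qed.

Lemma pairing_increment Z t s : unit_rv Z ->
  `|pairing P (X s) Z - pairing P (X t) Z| <= increment_L1 t s.
Proof.
move=> uZ; rewrite -pairingB //; [|exact: process_L1|exact: process_L1].
by apply: pairing_le_nrm1 => //; apply: L1_rvB; exact: process_L1.
Qed.

Lemma pairing_process_continuous Z : unit_rv Z -> continuous (fun t => pairing P (X t) Z).
Proof.
move=> uZ t; apply/cvgrPdist_le => e e0.
have := increment_L1_cvg0 t => /cvgr0Pnorm_le /(_ e e0); apply: filterS => s.
rewrite ger0_norm ?increment_L1_ge0 //; apply: le_trans.
by rewrite distrC; exact: pairing_increment.
Qed.

Lemma pairing_process_le Z t : unit_rv Z -> `|pairing P (X t) Z| <= C * c t.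
Proof.
by move=> uZ; apply: le_trans (pairing_le_nrm1 (process_L1 t) uZ) (process_nrm1_le t).
Qed.

Lemma increment_dilate_integrable t r : 0 < r ->
  mu.-integrable setT (EFin \o (fun s => increment_L1 t s * Phi (r * `|s - t|))).
Proof.
move=> r0; apply: (weight_dilate_integrable c_even c_nd c_gt1 c_doubling ePhi ic r0 C0).
  by apply: continuous_measurable_fun; exact: increment_L1_continuous.
by move=> s; rewrite increment_L1_ge0 increment_L1_le.
Qed.

Section coefficient.
Variable g : R -> R.
Hypothesis cg : continuous g.
Hypothesis gP : forall x, `|g x| <= Phi `|x|.

Lemma dilate_continuous j k : continuous (dilate g j k).
Proof.
move=> s; apply: cvgMl_tmp; apply: (cvg_continuous_comp cg).
by apply: cvgB; [apply: cvgMl_tmp; exact: cvg_id|exact: cvg_cst].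
Qed.

Lemma dilateM j k s t : dilate g j k t * dilate g j k s =
  2 ^+ j * (g (2 ^+ j * s - k%:~R) * g (2 ^+ j * t - k%:~R)).
Proof.
rewrite /dilate mulrACA -powRD; last by rewrite pnatr_eq0 implybT.
by rewrite -splitr powR_mulrn // [g _ * g _]mulrC.
Qed.

(** [dilate g j k] is centred at k / 2^j with decay Phi (2^j |s - k / 2^j|), so
    [weight_dilate_integrable] applies at that centre. *)
Lemma pairing_dilate_integrable j k Z : unit_rv Z ->
  mu.-integrable setT (EFin \o (fun t => pairing P (X t) Z * dilate g j k t)).
Proof.
move=> uZ; have r0 : 0 < 2 ^+ j :> R by rewrite exprn_gt0.
have iW : mu.-integrable setT (EFin \o (fun s => (C * c s) * Phi (2 ^+ j * `|s - k%:~R / 2 ^+ j|))).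
  apply: (weight_dilate_integrable c_even c_nd c_gt1 c_doubling ePhi ic r0 C0).
    by apply: measurable_funM => //; exact: measurable_weight c_even c_nd.
  move=> s; rewrite mulr_ge0 ?(weight_ge0 c_even c_nd c_gt1) //= ler_wpM2l // lerDl.
  exact: (weight_ge0 c_even c_nd c_gt1).
have := integrableZl measurableT (2 `^ (j%:R / 2)) iW.
apply: le_integrable => //.
  apply/measurable_EFinP; apply: continuous_measurable_fun => s; apply: cvgM.
    exact: pairing_process_continuous.
  exact: dilate_continuous.
move=> s _ /=; rewrite lee_fin; apply: le_trans (ler_norm _).
rewrite normrM mulrCA; apply: ler_pM => //; first exact: pairing_process_le.
rewrite /dilate normrM ger0_norm ?powR_ge0 // ler_wpM2l ?powR_ge0 //.
apply: le_trans (gP _) _; rewrite le_eqVlt; apply/orP; left; apply/eqP; congr Phi.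
rewrite -[X in X * `|_ - _ / _|](gtr0_norm r0) -normrM; congr `|_|.
by field; rewrite gt_eqF.
Qed.

Lemma coefficient_pairing j k zeta :
  ms_integral P (fun t w => X t w * dilate g j k t) zeta ->
  L1_rv P zeta /\ forall Z, unit_rv Z ->
    pairing P zeta Z = \int[mu]_t (pairing P (X t) Z * dilate g j k t).
Proof.
have iY t : L1_rv P (fun w => X t w * dilate g j k t).
  by under eq_fun do rewrite mulrC; apply: L1_rvZ; exact: process_L1.
have pE t Z : unit_rv Z -> pairing P (fun w => X t w * dilate g j k t) Z =
    pairing P (X t) Z * dilate g j k t.
  move=> uZ; rewrite mulrC -pairingZ //; last exact: process_L1.
  by apply: eq_Rintegral => w _; congr (_ * _); rewrite mulrC.
move=> hz.
have [||i h] := @ms_integral_pairing _ _ _ P _ iY _ _ _ hz.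
- move=> Z uZ; under eq_fun do rewrite pE //.
  by move=> s; apply: cvgM; [exact: pairing_process_continuous|exact: dilate_continuous].
- move=> Z uZ; rewrite (_ : (fun t => _) = (fun t => pairing P (X t) Z * dilate g j k t)).
    exact: pairing_dilate_integrable.
  by apply/funext => t; rewrite pE.
split => // Z uZ; rewrite h //; apply: eq_Rintegral => t _; exact: pE.
Qed.

End coefficient.

Variables (phi psi : R -> R) (M : R) (xi : int -> Omega -> R) (eta : nat -> int -> Omega -> R).
Hypothesis cphi : continuous phi.
Hypothesis cpsi : continuous psi.
Hypothesis phiP : forall x, `|phi x| <= Phi `|x|.
Hypothesis psiP : forall x, `|psi x| <= Phi `|x|.
Hypothesis hM : forall g : R -> R, (forall x, `|g x| <= Phi `|x|) ->
    forall K s t, sum_abs_le K (fun k => `|g (s - k%:~R) * g (t - k%:~R)|) <=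
      M * Phi (`|s - t| / 2).
Hypothesis two_scale : forall s t, 2 * kern phi (2 * s) (2 * t) = kern phi s t + kern psi s t.
Hypothesis per_phi : forall s, per phi s = \int[mu]_x phi x.
Hypothesis phi_sqr : (\int[mu]_x phi x) ^+ 2 = 1.
Hypothesis hxi : forall k, ms_integral P (fun t w => X t w * dilate phi 0 k t) (xi k).
Hypothesis heta : forall j k,
  ms_integral P (fun t w => X t w * dilate psi j k t) (eta j k).

Let pxi k := coefficient_pairing cphi phiP (hxi k).
Let peta j k := coefficient_pairing cpsi psiP (heta j k).

Lemma L1_rv_sum_abs_le K (F : int -> Omega -> R) : (forall k, L1_rv P (F k)) ->
  L1_rv P (fun w => sum_abs_le K (fun k => F k w)).
Proof. by move=> iF; apply: L1_rv_sum => i; exact: iF. Qed.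

Lemma pairing_sum_abs_le K (F : int -> Omega -> R) Z : (forall k, L1_rv P (F k)) ->
  unit_rv Z ->
  pairing P (fun w => sum_abs_le K (fun k => F k w)) Z = sum_abs_le K (fun k => pairing P (F k) Z).
Proof. by move=> iF uZ; rewrite /sum_abs_le pairing_sum // => i; exact: iF. Qed.

Let ixi k t : L1_rv P (fun w => xi k w * dilate phi 0 k t).
Proof. by under eq_fun do rewrite mulrC; apply: L1_rvZ; exact: (pxi k).1. Qed.

Let ieta j k t : L1_rv P (fun w => eta j k w * dilate psi j k t).
Proof. by under eq_fun do rewrite mulrC; apply: L1_rvZ; exact: (peta j k).1. Qed.

Lemma approximant_L1 k t : L1_rv P (approximant phi psi xi eta k t).
Proof.
apply: L1_rvD; first exact: L1_rv_sum_abs_le.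
by apply: L1_rv_sum => j; exact: L1_rv_sum_abs_le.
Qed.

(** Every coefficient is replaced by its pairing and the finite sums enter the integral; [dilateM]
    turns the two factors 2^(j/2) into the 2^j of the kernel. *)
Lemma pairing_approximant n K t Z : unit_rv Z ->
  mu.-integrable setT (EFin \o (fun s => pairing P (X s) Z * trunc_kern phi psi n K s t)) /\
  pairing P (approximant phi psi xi eta (TruncIndex n K (fun=> K)) t) Z =
    \int[mu]_s (pairing P (X s) Z * trunc_kern phi psi n K s t).
Proof.
move=> uZ; pose x s := pairing P (X s) Z.
have coef (g : R -> R) (cg : continuous g) (gP : forall y, `|g y| <= Phi `|y|) j
    (z : int -> Omega -> R)
    (hz : forall k, ms_integral P (fun t w => X t w * dilate g j k t) (z k)) :
    mu.-integrable setT (EFin \o (fun s => x s * (2 ^+ j *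
      sum_abs_le K (fun k => g (2 ^+ j * s - k%:~R) * g (2 ^+ j * t - k%:~R))))) /\
    pairing P (fun w => sum_abs_le K (fun k => z k w * dilate g j k t)) Z =
    \int[mu]_s (x s * (2 ^+ j *
      sum_abs_le K (fun k => g (2 ^+ j * s - k%:~R) * g (2 ^+ j * t - k%:~R)))).
  have ih k : mu.-integrable setT (EFin \o (fun s => dilate g j k t * (x s * dilate g j k s))).
    by have := integrableZl measurableT (dilate g j k t) (pairing_dilate_integrable cg gP j k uZ).
  have [E I] := Rintegral_sum_abs_le K measurableT ih.
  have fE : (fun s => sum_abs_le K (fun k => dilate g j k t * (x s * dilate g j k s))) =
      (fun s => x s * (2 ^+ j *
      sum_abs_le K (fun k => g (2 ^+ j * s - k%:~R) * g (2 ^+ j * t - k%:~R)))).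
    apply/funext => s; rewrite -!sum_abs_leZ; apply: eq_sum_abs_le => k.
    by rewrite -dilateM; ring.
  rewrite -fE; split => //; rewrite E pairing_sum_abs_le //; last first.
    move=> k; under eq_fun do rewrite mulrC.
    by apply: L1_rvZ; have [] := coefficient_pairing cg gP (hz k).
  apply: eq_sum_abs_le => k; have [iz hk] := coefficient_pairing cg gP (hz k).
  rewrite (RintegralZl _ measurableT (pairing_dilate_integrable cg gP j k uZ)) -hk // -pairingZ //.
  by congr pairing; apply/funext => w; rewrite mulrC.
have [i1 e1] := coef phi cphi phiP 0%N xi hxi.
have cj j := coef psi cpsi psiP j (eta j) (heta j).
pose S j s := 2 ^+ j * sum_abs_le K (fun k => psi (2 ^+ j * s - k%:~R) * psi (2 ^+ j * t - k%:~R)).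
have [iS eS] : mu.-integrable setT (EFin \o (fun s => x s * \sum_(j < n) S j s)) /\
    pairing P (fun w => \sum_(j < n) sum_abs_le K (fun k => eta j k w * dilate psi j k t)) Z =
    \int[mu]_s (x s * \sum_(j < n) S j s).
  elim: n => [|n [IH1 IH2]].
    have -> : (fun s => x s * \sum_(j < 0) S j s) = cst 0.
      by apply/funext => s; rewrite big_ord0 mulr0.
    split; first exact: integrable0.
    rewrite Rintegral_cst // mul0r pairing_sum ?big_ord0 //.
    by move=> i; exact: L1_rv_sum_abs_le.
  have [ij ej] := cj n.
  have fE : (fun s => x s * \sum_(j < n.+1) S j s) =
      (fun s => x s * \sum_(j < n) S j s + x s * S n s).
    by apply/funext => s; rewrite big_ord_recr /= mulrDr.
  rewrite fE; split; first exact: (integrableD measurableT IH1 ij).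
  rewrite (RintegralD measurableT IH1 ij) -IH2 -ej -pairingD //.
  - by congr pairing; apply/funext => w; rewrite big_ord_recr.
  - by apply: L1_rv_sum => i; exact: L1_rv_sum_abs_le.
  - exact: L1_rv_sum_abs_le.
have fE : (fun s => x s * trunc_kern phi psi n K s t) = (fun s =>
    x s * (2 ^+ 0 * sum_abs_le K (fun k => phi (2 ^+ 0 * s - k%:~R) * phi (2 ^+ 0 * t - k%:~R)))
    + x s * \sum_(j < n) S j s).
  apply/funext => s; rewrite /trunc_kern mulrDr; congr (_ * _ + _).
  by rewrite expr0 mul1r; apply: eq_sum_abs_le => k; rewrite !mul1r.
rewrite fE; split; first exact: (integrableD measurableT i1 iS).
rewrite (RintegralD measurableT i1 iS) -e1 -eS -pairingD //.
- exact: L1_rv_sum_abs_le.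
- by apply: L1_rv_sum => i; exact: L1_rv_sum_abs_le.
Qed.

Let Phi0 x : 0 <= x -> 0 <= Phi x.
Proof. by case: ePhi => h _ _; exact: h. Qed.

Let unit_weight t (r : R) : 0 < r ->
  mu.-integrable setT (EFin \o (fun s => (fun _ : R => 1 : R) s * Phi (r * `|s - t|))).
Proof.
move=> r0; have := integrable_affine (- (r * t)) r0 (envelope_integrable ePhi).
by apply: eq_integrable => // s _ /=; rewrite mul1r -mulrBr normrM (gtr0_norm r0).
Qed.

(* Pair the difference with its own sign. *)
Lemma nrm1_approximant_le n K t :
  nrm1 P (fun w => approximant phi psi xi eta (TruncIndex n K (fun=> K)) t w - X t w) <=
  \int[mu]_s (increment_L1 t s * `|trunc_kern phi psi n K s t|) +
  C * c t * `|\int[mu]_s trunc_kern phi psi n K s t - 1|.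
Proof.
set V := (fun w => _); have iV : L1_rv P V.
  by apply: L1_rvB; [exact: approximant_L1|exact: process_L1].
have uZ : unit_rv (fun w => Num.sg (V w)) := unit_rv_sgr (L1_rv_measurable iV).
rewrite nrm1_sgr; set Z := (fun w => Num.sg (V w)) in uZ *.
have [i1 e1] := pairing_approximant n K t uZ.
rewrite pairingB //; [|exact: approximant_L1|exact: process_L1].
rewrite e1; set x := pairing P (X t) Z.
have mone : measurable_fun [set: R] (fun _ : R => 1 : R) by exact: measurable_cst.
have i2 : mu.-integrable setT (EFin \o (fun s => trunc_kern phi psi n K s t)).
  have := trunc_kern_integrable cphi cpsi phiP psiP hM mone (@unit_weight t) n K.
  by apply: eq_integrable => // s _ /=; rewrite mul1r.
have i3 : mu.-integrable setT (EFin \o (fun s => x * trunc_kern phi psi n K s t)).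
  by have := integrableZl measurableT x i2.
have i4 : mu.-integrable setT (EFin \o (fun s =>
    (pairing P (X s) Z - x) * trunc_kern phi psi n K s t)).
  have := integrableB measurableT i1 i3.
  by apply: eq_integrable => // s _ /=; rewrite mulrBl.
(* Split off the value at t: the increment is integrated against the kernel, and the value itself is
   multiplied by the defect of total mass. *)
have -> : \int[mu]_s (pairing P (X s) Z * trunc_kern phi psi n K s t) - x =
    \int[mu]_s ((pairing P (X s) Z - x) * trunc_kern phi psi n K s t) +
    x * (\int[mu]_s trunc_kern phi psi n K s t - 1).
  rewrite mulrBr mulr1 addrA; congr (_ - _).
  rewrite -(RintegralZl _ measurableT i2) -(RintegralD measurableT i4 i3).
  by apply: eq_Rintegral => s _; rewrite mulrBl subrK.
apply: lerD; last first.
  apply: le_trans (ler_norm _) _; rewrite normrM ler_wpM2r //.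
  exact: pairing_process_le.
apply: le_trans (ler_norm _) _; apply: le_trans (le_normr_Rintegral measurableT i4) _.
have mI : measurable_fun [set: R] (increment_L1 t).
  by apply: continuous_measurable_fun; exact: increment_L1_continuous.
have i5 := trunc_kern_integrable cphi cpsi phiP psiP hM mI (@increment_dilate_integrable t) n K.
apply: le_Rintegral => //.
- exact: integrable_norm i4.
- have := integrable_norm i5.
  by apply: eq_integrable => // s _ /=; rewrite normrM ger0_norm ?increment_L1_ge0.
- by move=> s _; rewrite normrM ler_wpM2r //; exact: pairing_increment.
Qed.

(** Continuity in [tau] gives the pointwise limit 0, and [weight_affine] with e = 2^-n gives a
    majorant independent of n. *)
Lemma increment_dilate_cvg0 t :
  \int[mu]_u (increment_L1 t (2 / 2 ^+ n * u + t) * Phi `|u|) @[n --> \oo] --> 0.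
Proof.
have two0 : 0 < 2 :> R by [].
have [k k0 hk] := weight_affine c_even c_nd c_gt1 c_doubling t two0.
have iB : mu.-integrable setT (EFin \o (fun u => C * (k + c t) * (c u * Phi `|u|))).
  have := integrableZl measurableT (C * (k + c t)) (weight_integrable c_even c_nd c_gt1 ePhi ic).
  by apply: eq_integrable.
have lim u : 2 / 2 ^+ n * u + t @[n --> \oo] --> t.
  rewrite -[X in _ --> X]add0r; apply: cvgD; last exact: cvg_cst.
  rewrite -(mul0r u) -(mulr0 2); apply: cvgMr_tmp; apply: cvgMl_tmp.
  under eq_fun do rewrite -exprVn.
  by apply: cvg_expr; rewrite gtr0_norm ?invf_lt1 ?invr_gt0 // ltr1n.
have [_ c1] : mu.-integrable setT (EFin \o (fun _ : R => 0 : R)) /\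
    \int[mu]_u (increment_L1 t (2 / 2 ^+ n * u + t) * Phi `|u|) @[n --> \oo] -->
    \int[mu]_u (0 : R).
  apply: (lebesgue_dominated _ _ iB) => [n|u|n u].
  - apply: measurable_funM; last exact: measurable_envelope ePhi.
    apply: continuous_measurable_fun => u.
    apply: (cvg_continuous_comp (@increment_L1_continuous t)).
    by apply: cvgD; [apply: cvgMl_tmp; exact: cvg_id|exact: cvg_cst].
  - rewrite -(mul0r (Phi `|u|)); apply: cvgMr_tmp.
    exact: (cvg_comp _ _ (lim u) (@increment_L1_cvg0 t)).
  - rewrite ger0_norm ?mulr_ge0 ?increment_L1_ge0 ?Phi0 // mulrA ler_wpM2r ?Phi0 //.
    apply: le_trans (increment_L1_le _ _) _; rewrite -[leRHS]mulrA ler_wpM2l //.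
    have e01 : (0 <= (2 ^+ n)^-1 :> R) && ((2 ^+ n)^-1 <= 1 :> R).
      by rewrite invr_ge0 exprn_ge0 //= invf_le1 ?exprn_gt0 // exprn_ege1 // ler1n.
    have h := hk u _ e01.
    rewrite [leRHS]mulrDl lerD // ler_peMr //.
      exact: (weight_ge0 c_even c_nd c_gt1).
    exact: (weight_ge1 c_even c_nd c_gt1).
by move: c1; rewrite Rintegral_cst // mul0r.
Qed.

(** n is chosen first, from the bound on the full kernel; for this n the bound of
    [nrm1_approximant_le] converges in K to a value below e. *)
Lemma approximant_cvg_L1 t (e : R) : 0 < e ->
  \forall n \near \oo, \forall K \near \oo,
  nrm1 P (fun w => approximant phi psi xi eta (TruncIndex n K (fun=> K)) t w - X t w) < e.
Proof.
move=> e0; have e20 : 0 < e / 2 by rewrite divr_gt0.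
have mI : measurable_fun [set: R] (increment_L1 t).
  by apply: continuous_measurable_fun; exact: increment_L1_continuous.
have h1 : 2 * M * \int[mu]_u (increment_L1 t (2 / 2 ^+ n * u + t) * Phi `|u|) @[n --> \oo] --> 0.
  by rewrite -(mulr0 (2 * M)); apply: cvgMl_tmp; exact: increment_dilate_cvg0.
have n1 : \forall n \near \oo,
    2 * M * \int[mu]_u (increment_L1 t (2 / 2 ^+ n * u + t) * Phi `|u|) < e / 2.
  by apply: (cvgr_lt _ h1).
apply: filterS n1 => n hn.
have [_ c1] := trunc_kern_Rintegral_cvg ePhi cphi cpsi phiP psiP hM two_scale
  (@increment_L1_ge0 t) mI (@increment_dilate_integrable t) n.
have le1 := kern_Rintegral_le ePhi cphi cpsi phiP psiP hM two_scale
  (@increment_L1_ge0 t) mI (@increment_dilate_integrable t) n.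
have c2 := trunc_kern_Rintegral1_cvg ePhi cphi cpsi phiP psiP hM two_scale per_phi phi_sqr n t.
have c3 : \int[mu]_s (increment_L1 t s * `|trunc_kern phi psi n K s t|) +
    C * c t * `|\int[mu]_s trunc_kern phi psi n K s t - 1| @[K --> \oo] -->
    \int[mu]_s (increment_L1 t s * `|2 ^+ n * kern phi (2 ^+ n * s) (2 ^+ n * t)|) +
    C * c t * `|1 - 1|.
  apply: cvgD => //; apply: cvgMl_tmp; apply: cvg_norm; apply: cvgB => //; exact: cvg_cst.
have n2 : \forall K \near \oo,
    \int[mu]_s (increment_L1 t s * `|trunc_kern phi psi n K s t|) +
    C * c t * `|\int[mu]_s trunc_kern phi psi n K s t - 1| < e.
  apply: (cvgr_lt _ c3); rewrite subrr normr0 mulr0 addr0.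
  by apply: le_lt_trans le1 _; lra.
by apply: filterS n2 => K; apply: le_lt_trans; exact: nrm1_approximant_le.
Qed.

End process.

(** * Convergence in probability *)

Section power_monotonicity.
Context {R : realType}.

Lemma le_powR2r (r x y : R) : 0 <= r -> 0 <= x -> x <= y -> x `^ r <= y `^ r.
Proof. by move=> r0 x0 xy; apply: ge0_ler_powR; rewrite ?nnegrE // (le_trans x0). Qed.

Lemma le_poweR2r (r : R) (x y : \bar R) : 0 <= r -> (0 <= x)%E -> (x <= y)%E ->
  (x `^ r <= y `^ r)%E.
Proof.
move=> r0 x0 xy; have y0 := le_trans x0 xy.
by apply: gt0_ler_poweR => //; rewrite in_itv /= ?x0 ?y0 ?leey.
Qed.

End power_monotonicity.

Section fatou_twice.
Context {R : realType} {d : measure_display} {T : measurableType d}.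
Variables (mu : {measure set T -> \bar R}) (D : set T).
Hypothesis mD : measurable D.

(** One use of Fatou's lemma for each lower limit; lower limits ignore ranks below N, so the bound
    is required only beyond N. *)
Lemma iterated_fatou (g : nat -> nat -> T -> \bar R) (F : T -> \bar R) (N : nat) (e : \bar R) :
  measurable_fun D F -> (forall t, 0 <= F t)%E ->
  (forall n K, measurable_fun D (g n K)) -> (forall n K t, 0 <= g n K t)%E ->
  (forall t, F t <= limn_einf (fun n => limn_einf (fun K => g n K t)))%E ->
  (forall n K, (N <= n)%N -> (N <= K)%N -> \int[mu]_(t in D) g n K t <= e)%E ->
  (\int[mu]_(t in D) F t <= e)%E.
Proof.
move=> mF F0 mg g0 Fg ge.
pose h n t := limn_einf (fun K => g n K t).
have mh n : measurable_fun D (h n) := measurable_fun_limn_einf (mg n).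
have h0 n t : (0 <= h n t)%E by exact: limn_einf_ge0.
apply: (@le_trans _ _ (\int[mu]_(t in D) limn_einf (h ^~ t))%E).
  apply: ge0_le_integral => //; exact: (measurable_fun_limn_einf mh).
apply: (le_trans (fatou mu mD mh (fun n t _ => h0 n t))).
apply: (@limn_einf_le_near _ _ _ N) => n Nn.
apply: (le_trans (fatou mu mD (mg n) (fun K t _ => g0 n K t))).
by apply: (@limn_einf_le_near _ _ _ N) => K NK; exact: ge.
Qed.

End fatou_twice.

Section tau_lower_semicontinuity.
Context {R : realType} {d : measure_display} {Omega : measurableType d}.
Variables (P : probability Omega R) (v : R -> R).
Hypothesis Hv : orlicz_N_function v.

(** For any number above the iterated lower limit there are indices, far in n and then far in K,
    where tau (Z n K)^p is below it and Z n K is L1-close to Y; [tau_le_approx] concludes. *)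
Lemma tau_powR_le_limn_einf (Y : Omega -> R) (Z : nat -> nat -> Omega -> R) (p : R) : 0 < p ->
  measurable_fun setT Y -> (forall n K, measurable_fun setT (Z n K)) ->
  (forall e : R, 0 < e -> \forall n \near \oo, \forall K \near \oo,
     ('E_P[fun w => `|Z n K w - Y w|%R] < e%:E)%E) ->
  (tau P v Y `^ p <= limn_einf (fun n => limn_einf (fun K => tau P v (Z n K) `^ p)))%E.
Proof.
move=> p0 mY mZ hZ; set L := limn_einf _.
have L0 : (0 <= L)%E.
  by apply: limn_einf_ge0 => n; apply: limn_einf_ge0 => K; exact: poweR_ge0.
case EL : L => [l| |]; [|exact: leey|by rewrite EL in L0].
rewrite EL lee_fin in L0; apply/lee_addgt0Pr => e e0.
have b0 : 0 < l + e by rewrite ltr_wpDl.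
pose a := (l + e) `^ p^-1.
have a0 : 0 < a by rewrite powR_gt0.
have ap : (a%:E `^ p)%E = (l + e)%:E.
  by rewrite poweR_EFin -powRrM mulVf ?gt_eqF // powRr1 // ltW.
suff ta : (tau P v Y <= a%:E)%E.
  by rewrite -EFinD -ap; apply: le_poweR2r => //; [exact: ltW|exact: tau_ge0].
apply: (tau_le_approx Hv mY (ltW a0)) => e' e'0.
have [N _ hN] := hZ e' e'0.
have [|n Nn Ln] := @limn_einf_lt_exists _
  (fun n => limn_einf (fun K => tau P v (Z n K) `^ p)%E) (l + e)%:E _ N.
  by rewrite -/L EL lte_fin ltrDl.
have [K0 _ hK] := hN n Nn.
have [K K0K KL] := limn_einf_lt_exists Ln K0.
exists (Z n K); split => //; first exact: hK.
rewrite leNgt; apply/negP => aZ; move: KL; rewrite ltNge -ap le_poweR2r //.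
- exact: ltW.
- by rewrite lee_fin ltW.
- exact: ltW.
Qed.

End tau_lower_semicontinuity.

Section approximant_tau.
Context {R : realType} {d : measure_display} {Omega : measurableType d}.
Local Notation mu := (@lebesgue_measure R).
Variables (phi psi : R -> R) (xi : int -> Omega -> R) (eta : nat -> int -> Omega -> R).
Hypothesis cphi : continuous phi.
Hypothesis cpsi : continuous psi.
Hypothesis mxi : forall k, measurable_fun setT (xi k).
Hypothesis meta : forall j k, measurable_fun setT (eta j k).

Lemma measurable_approximant k :
  measurable_fun setT (fun z : R * Omega => approximant phi psi xi eta k z.1 z.2).
Proof.
have term (g : R -> R) (cg : continuous g) j i (z : Omega -> R) (mz : measurable_fun setT z) :
    measurable_fun setT (fun y : R * Omega => z y.2 * dilate g j i y.1).
  apply: measurable_funM; first exact: measurableT_comp.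
  apply: (measurableT_comp (f := dilate g j i)) => //.
  by apply: continuous_measurable_fun; exact: dilate_continuous.
apply: measurable_funD.
  by apply: measurable_sum => i; exact: term.
by apply: measurable_sum => j; apply: measurable_sum => i; exact: term.
Qed.

End approximant_tau.

Section convergence_in_probability.
Context {R : realType} {d : measure_display} {Omega : measurableType d}.
Variables (P : probability Omega R) (v f : R -> R).
Hypothesis Hv : orlicz_N_function v.
Hypothesis Hf : density_of v f.

Lemma lt_poweR_inv (p e : R) (J : \bar R) : 0 < p -> 0 < e -> (0 <= J)%E ->
  (e%:E < J `^ p^-1)%E = ((e `^ p)%:E < J)%E.
Proof.
move=> p0 e0 J0; have ip0 : 0 < p^-1 by rewrite invr_gt0.
rewrite !ltNge; congr (~~ _); apply/idP/idP => h.
- have := le_poweR2r (ltW p0) (poweR_ge0 _ _) h.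
  by rewrite -poweRrM mulVf ?gt_eqF // poweRe1 // poweR_EFin.
- have := le_poweR2r (ltW ip0) J0 h.
  by rewrite poweR_EFin -powRrM mulfV ?gt_eqF // powRr1 // ltW.
Qed.

(** As c tends to 0 the tail bound has to become small, but its side condition on the level E must
    hold as well. *)
Lemma small_tail_bound (p E delta : R) : 1 <= p -> 0 < E -> 0 < delta ->
  exists2 h : R, 0 < h & forall c : \bar R, (0 <= c)%E -> (c <= h%:E)%E ->
    (c * (f (p * fine (c / E%:E) `^ p^-1) `^ p)%:E < E%:E)%E /\
    (2%:E * expeR (- young_fenchel v ((E%:E / c) `^ p^-1)) <= delta%:E)%E.
Proof.
move=> p1 E0 d0; have p0 : 0 < p by rewrite (lt_le_trans _ p1).
have ip0 : 0 < p^-1 by rewrite invr_gt0.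
(* With this th the single value y = 1 in the conjugate already gives 2 exp (- (th - v 1)) <=
   delta. *)
pose th := Order.max 1 (v 1 - ln (delta / 2)).
have th0 : 0 < th by rewrite lt_max ltr01.
have thp : 0 < th `^ p by rewrite powR_gt0.
have fp0 : 0 <= f p `^ p by exact: powR_ge0.
(* The three bounds ensure, in order, (E / c)^(1/p) >= th, then c / E <= 1 so that f is evaluated at
   most at p, and c (f p)^p < E. *)
pose h := Order.min (E / th `^ p) (Order.min E (E / (2 * (1 + f p `^ p)))).
have k0 : 0 < 2 * (1 + f p `^ p) by rewrite mulr_gt0 // ltr_wpDr.
have h0 : 0 < h by rewrite !lt_min !divr_gt0 // E0.
exists h => // -[c| |] // c0 ch; rewrite lee_fin in c0; rewrite lee_fin in ch.
have [ch1 ch2 ch3] : [/\ c <= E / th `^ p, c <= E & c <= E / (2 * (1 + f p `^ p))].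
  by move: ch; rewrite !le_min => /andP[-> /andP[-> ->]].
have [fmono _ f0 _ _] := Hf.
split.
  rewrite inver gt_eqF // -EFinM /= lte_fin.
  have q0 : 0 <= c / E by rewrite divr_ge0 // ltW.
  have q1 : (c / E) `^ p^-1 <= 1.
    rewrite (_ : 1 = 1 `^ p^-1); last by rewrite powR1.
    by apply: le_powR2r => //; [exact: ltW|rewrite ler_pdivrMr ?mul1r].
  have g0 : 0 <= p * (c / E) `^ p^-1 by rewrite mulr_ge0 ?powR_ge0 // ltW.
  have g1 : f (p * (c / E) `^ p^-1) <= f p.
    by apply: fmono => //; rewrite ler_piMr // ltW.
  have g2 : 0 <= f (p * (c / E) `^ p^-1) by rewrite -f0; exact: fmono.
  have g3 : f (p * (c / E) `^ p^-1) `^ p <= f p `^ p.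
    by apply: le_powR2r => //; exact: ltW.
  apply: (@le_lt_trans _ _ (E / (2 * (1 + f p `^ p)) * f p `^ p)).
    by apply: ler_pM => //; exact: powR_ge0.
  rewrite mulrAC ltr_pdivrMr // ltr_pM2l //; lra.
have thx : (th%:E <= (E%:E / c%:E) `^ p^-1)%E.
  move: c0; rewrite le_eqVlt => /orP[/eqP <-|c0].
    by rewrite inver eqxx gt0_muley ?lte_fin // poweRyr ?gt_eqF // leey.
  rewrite inver gt_eqF // -EFinM poweR_EFin lee_fin.
  have -> : th = (th `^ p) `^ p^-1 by rewrite -powRrM mulfV ?gt_eqF // powRr1 // ltW.
  apply: le_powR2r; [exact: ltW|exact: ltW|].
  by rewrite ler_pdivlMr // mulrC -ler_pdivlMr.
have yf : ((th - v 1)%:E <= young_fenchel v ((E%:E / c%:E) `^ p^-1))%E.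
  apply: (@le_trans _ _ ((E%:E / c%:E) `^ p^-1 * 1%:E - (v 1)%:E)%E).
    by rewrite mule1 EFinB leeB.
  by apply: ereal_sup_ubound; exists 1.
apply: (@le_trans _ _ (2%:E * expeR (- (th - v 1)%:E))%E).
  by rewrite lee_wpmul2l // ?lee_fin // lee_expeR leeN2.
rewrite -EFinN /= -EFinM lee_fin.
have : - (th - v 1) <= ln (delta / 2).
  by have : v 1 - ln (delta / 2) <= th; [rewrite le_max lexx orbT|lra].
rewrite -ler_expR lnK ?posrE ?divr_gt0 //; lra.
Qed.

Lemma Lp_norm_cvg_in_probability {d1} {T : measurableType d1}
    (mu : {sigma_finite_measure set T -> \bar R}) (D : set T) (p : R)
    {I : Type} (F : set_system I) {FF : Filter F} (Y : I -> T -> Omega -> R) :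
  measurable D -> 1 <= p ->
  (forall k, measurable_fun setT (fun z : T * Omega => Y k z.1 z.2)) ->
  (forall eta : R, 0 < eta ->
     \forall k \near F, (\int[mu]_(t in D) (tau P v (Y k t) `^ p) <= eta%:E)%E) ->
  forall e : R, 0 < e ->
    P [set w | (e%:E < (\int[mu]_(t in D) (`|Y k t w|%R `^ p)%:E) `^ p^-1)%E]
      @[k --> F] --> 0%E.
Proof.
move=> mD p1 mY hY e e0; have p0 : 0 < p by rewrite (lt_le_trans _ p1).
have ip0 : 0 < p^-1 by rewrite invr_gt0.
have ep0 : 0 < e `^ p by rewrite powR_gt0.
pose B k := [set w | ((e `^ p)%:E < \int[mu]_(t in D) (`|Y k t w|%R `^ p)%:E)%E].
have AB k : [set w | (e%:E < (\int[mu]_(t in D) (`|Y k t w|%R `^ p)%:E) `^ p^-1)%E] = B k.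
  apply/seteqP; split => w /=; rewrite /B /= lt_poweR_inv //;
    by apply: integral_ge0 => t _; rewrite lee_fin powR_ge0.
under eq_fun do rewrite AB.
have PB delta : 0 < delta -> \forall k \near F, (P (B k) <= delta%:E)%E.
  move=> d0; have [h h0 hh] := small_tail_bound p1 ep0 d0.
  apply: filterS (hY h h0) => k ck.
  have [|h1 h2] := hh _ _ ck.
    by apply: integral_ge0 => t _; exact: poweR_ge0.
  exact: le_trans (Lp_tail_bound Hv Hf mD (mY k) p1 h1) h2.
have P0 k : (0 <= P (B k))%E by exact: measure_ge0.
have Pf k : (P (B k) <= 1)%E -> P (B k) \is a fin_num.
  by move=> P1; rewrite ge0_fin_numE // (le_lt_trans P1) // ltry.
apply/fine_cvgP; split.
  by apply: filterS (PB 1 ltr01) => k /Pf.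
apply/cvgr0Pnorm_le => delta d0.
apply: filterS2 (PB _ d0) (PB 1 ltr01) => k h /Pf Pk.
by rewrite /= ger0_norm ?fine_ge0 // -lee_fin fineK.
Qed.

End convergence_in_probability.

Theorem theorem4 (R : realType) (d : measure_display) (Omega : measurableType d)
  (P : probability Omega R)
  (varphi f : R -> R) (X : R -> Omega -> R)
  (phi psi Phi c : R -> R)
  (xi : int -> Omega -> R) (eta : nat -> int -> Omega -> R) (T p : R) :
  orlicz_N_function varphi ->
  assumption_Q varphi ->
  density_of varphi f ->
  subphi_process P varphi X ->
  measurable_process X ->
  tau_continuous P varphi X ->
  f_wavelet phi ->
  m_wavelet phi psi ->
  continuous phi ->
  continuous psi ->
  assumption_S Phi phi ->
  assumption_S Phi psi ->
  (forall x, c (- x) = c x) ->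
  (forall x y, 0 <= x -> x <= y -> c x <= c y) ->
  1 < c 0 ->
  (exists (A : R -> R) (x0 : R),
     (forall a, 0 < a -> 0 < A a) /\
     (forall x a, x0 <= x -> 0 < a -> c (a * x) <= c x * A a)) ->
  (\int[lebesgue_measure]_x (c x * Phi `|x|)%:E < +oo)%E ->
  (forall t, (tau P varphi (X t) <= (c t)%:E)%E) ->
  (forall k, ms_integral P (fun t w => X t w * dilate phi 0 k t) (xi k)) ->
  (forall j k,
     ms_integral P (fun t w => X t w * dilate psi j k t) (eta j k)) ->
  0 < T -> 1 <= p ->
  (\int[lebesgue_measure]_(t in `[0%R, T]) (tau P varphi (X t) `^ p) < +oo)%E ->
  let Xk := approximant phi psi xi eta in
  (\int[lebesgue_measure]_(t in `[0%R, T])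
     (tau P varphi (fun w => Xk kk.1 t w - Xk kk.2 t w)%R `^ p))%E
    @[kk --> (trunc_infty, trunc_infty)] --> 0%E ->
  (forall e : R, 0 < e ->
     P [set w | (e%:E < (\int[lebesgue_measure]_(t in `[0%R, T])
                   (`|Xk k t w - X t w|%R `^ p)%:E) `^ p^-1)%E]
       @[k --> trunc_infty] --> 0%E) /\
  (forall (k : trunc_index) (e : R),
     let c_infty := (\int[lebesgue_measure]_(t in `[0%R, T])
       (tau P varphi (fun w => Xk k t w - X t w)%R `^ p))%E in
     (c_infty * (f (p * fine (c_infty / e%:E) `^ p^-1) `^ p)%:E < e%:E)%E ->
     (P [set w | (e%:E < \int[lebesgue_measure]_(t in `[0%R, T])
                    (`|Xk k t w - X t w|%R `^ p)%:E)%E]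
       <= 2%:E * expeR (- young_fenchel varphi ((e%:E / c_infty) `^ p^-1)))%E).
Proof.
move=> Hv _ Hf HX mX cX [_ phi0 _ hsum _] [_ [m0 mask hpsi]] cphi cpsi Sphi Spsi.
move=> ce cn c1 cd icc tc hxi heta T0 p1 _ Xk hC.
have ePhi := assumption_S_envelope Sphi.
have phiP := assumption_S_le Sphi cphi; have psiP := assumption_S_le Spsi cpsi.
have ephi : enveloped phi by split => //; exists Phi.
have epsi : enveloped psi by split => //; exists Phi.
have two_scale s t := kernel_two_scale ephi epsi s t mask hpsi hsum.
have per_phi := fwavelet_per ephi epsi mask hpsi hsum phi0.
have phi_sqr := fwavelet_Rintegral_sqr ephi epsi mask hpsi hsum phi0.
have [M _ hM] := envelope_kernel_bound ePhi.
have approx := approximant_cvg_L1 Hv HX cX ce cn c1 cd ePhi icc tc cphi cpsi phiP psiP hM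
  two_scale per_phi phi_sqr hxi heta.
have L1X := process_L1 HX.
have L1A := approximant_L1 Hv HX cX ce cn c1 cd ePhi icc tc cphi cpsi phiP psiP hxi heta.
have p0 : 0 < p by rewrite (lt_le_trans _ p1).
have mA k := measurable_approximant cphi cpsi (fun k => (hxi k).1) (fun j k => (heta j k).1) k.
have mY k : measurable_fun setT (fun z : R * Omega => Xk k z.1 z.2 - X z.1 z.2).
  exact: measurable_funB.
have mYY k k' : measurable_fun setT (fun z : R * Omega => Xk k z.1 z.2 - Xk k' z.1 z.2).
  exact: measurable_funB.
pose D : set (measurableTypeR R) := `[0, T]%classic.
have mD : measurable D by exact: measurable_itv.
split; last first.
  move=> k e /=.
  exact: (@Lp_tail_bound _ _ _ _ _ lebesgue_measure P varphi f D (fun t w => Xk k t w - X t w)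
    p Hv Hf mD (mY k) p1 e).
apply: (@Lp_norm_cvg_in_probability _ _ _ P varphi f Hv Hf _ _ lebesgue_measure D p _ _ _
  (fun k t w => Xk k t w - X t w) mD p1 mY).
move=> h h0.
(* The Cauchy hypothesis on a product neighbourhood: the first index varies in A, and B contains
   every index beyond rank N. *)
have [[A B] /= [FA [N _ NB]] AB] : \forall kk \near (trunc_infty, trunc_infty),
    (\int[lebesgue_measure]_(t in D)
      (tau P varphi (fun w => Xk kk.1 t w - Xk kk.2 t w)%R `^ p) <= h%:E)%E.
  have /fine_cvgP[hf hc] := hC; have /cvgr0Pnorm_le/(_ h h0) hle := hc.
  apply: filterS2 hf hle => kk kf; rewrite /= ger0_norm => [kh|].
    by rewrite -(fineK kf) lee_fin.
  by rewrite fine_ge0 // integral_ge0 // => t _; exact: poweR_ge0.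
apply: filterS FA => k Ak.
(* With k fixed in A, the second index runs through these; they lie in B as soon as n and K reach
   N. *)
pose kK n K := TruncIndex n K (fun=> K).
pose Z n K t w := Xk k t w - Xk (kK n K) t w.
have mtau (Y : R -> Omega -> R) : measurable_fun setT (fun z : R * Omega => Y z.1 z.2) ->
    measurable_fun D (fun t => tau P varphi (Y t) `^ p)%E.
  move=> mY'; apply: measurable_funTS; apply: (measurableT_comp (measurable_poweR p)).
  exact: (@measurable_tau _ _ _ (measurableTypeR R) _ P varphi Hv Y mY').
apply: (@iterated_fatou _ _ _ lebesgue_measure D mD
  (fun n K t => tau P varphi (Z n K t) `^ p)%E _ N).
- exact: mtau (mY k).
- by move=> t; exact: poweR_ge0.
- by move=> n K; exact: mtau (mYY k (kK n K)).
- by move=> n K t; exact: poweR_ge0.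
- move=> t; apply: (tau_powR_le_limn_einf Hv p0).
  + by apply: measurable_funB; apply: L1_rv_measurable; [exact: L1A|exact: L1X].
  + by move=> n K; apply: measurable_funB; apply: L1_rv_measurable; exact: L1A.
  (* Here Z n K - (X_k - X) is X minus the approximant of index [kK n K]: the index k cancels. *)
  + move=> e e0; have := approx t e e0; apply: filterS => n; apply: filterS => K.
    rewrite -lte_fin nrm1E; last exact: L1_rvB (L1A _ _) (L1X _).
    congr (_ < _)%E; congr (expectation P _); apply/funext => w /=.
    have alg (a b y : R) : `|b - y| = `|a - b - (a - y)|.
      by rewrite distrC; congr `|_|; ring.
    exact: alg.
- move=> n K Nn NK; apply: (AB (k, kK n K)); split => //=; apply: NB.
  by split.
Qed.
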